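(* Let $G=[g_1,\ldots,g_n]$ be a finitely generated transcendental semigroup in which each $g_i$, $i=1,\ldots,n$, is of bounded type. Then $J(G)$ is connected in the Riemann sphere $\widetilde{\mathbb{C}}$.
   Context: $G=[g_1,\ldots,g_n]$ is the set of all finite compositions (of length at least one) of the transcendental entire functions $g_1,\ldots,g_n$. $\widetilde{\mathbb{C}}=\mathbb{C}\cup\{\infty\}$ is the Riemann sphere. The Fatou set $F(G)$ is the largest open subset of $\mathbb{C}$ on which the family $G$ is normal (every sequence in $G$ has a subsequence converging locally uniformly to a holomorphic function or to $\infty$). The Julia set is $J(G)=\widetilde{\mathbb{C}}\setminus F(G)$ (so it contains $\infty$). For a transcendental entire function $f$, $\mathrm{Sing}(f^{-1})$ is the set of critical values and (finite) asymptotic values of $f$ together with their finite limit points; $f$ is of bounded type if $\mathrm{Sing}(f^{-1})$ is bounded. A critical value is $f(w_0)$ with $f'(w_0)=0$; $\zeta\in\mathbb{C}$ is an asymptotic value of $f$ if there is a curve $\Gamma$ tending to infinity with $f(z)\to\zeta$ as $z\to\infty$ along $\Gamma$. *)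

(* Defs.v *)
From HB Require Import structures.
From mathcomp Require Import all_boot all_order all_algebra.
From mathcomp Require Import all_classical all_reals all_analysis.
From mathcomp Require Import complex.

Set Implicit Arguments.
Unset Strict Implicit.
Unset Printing Implicit Defensive.

Import Order.TTheory GRing.Theory Num.Theory.
Import numFieldNormedType.Exports.

Local Open Scope classical_set_scope.
Local Open Scope ring_scope.
Local Open Scope complex_scope.

(* R[i] as a normed space over itself: its topology is that of the modulus,
   and [derivable f z 1] is complex differentiability at z. *)
HB.instance Definition _ (R : realType) := NormedModule.copy R[i] (R[i]^o).

Section ComplexDynamics.
Variable R : realType.
Local Notation C := R[i].

Definition holomorphic_on (U : set C) (f : C -> C) : Prop :=
  forall z, U z -> derivable f z 1.

Definition entire (f : C -> C) : Prop := holomorphic_on setT f.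

Definition transcendental_entire (f : C -> C) : Prop :=
  entire f /\ ~ exists p : {poly C}, forall z, f z = p.[z].

Definition critical_values (f : C -> C) : set C :=
  f @` [set w | derive1 f w = 0].

Definition asymptotic_values (f : C -> C) : set C :=
  [set zeta | exists gamma : R -> C,
     [/\ {within `[0, +oo[, continuous gamma},
         `|gamma t| @[t --> +oo] --> +oo &
         f (gamma t) @[t --> +oo] --> zeta]].

Definition Sing (f : C -> C) : set C :=
  let S := critical_values f `|` asymptotic_values f in S `|` limit_point S.

Definition bounded_type (f : C -> C) : Prop := bounded_set (Sing f).

Inductive semigroup (n : nat) (g : 'I_n -> C -> C) : set (C -> C) :=
| semigroup_gen i : semigroup g (g i)
| semigroup_comp i h : semigroup g h -> semigroup g (g i \o h).

Definition locally_uniform_cvg (U : set C) (f : nat -> C -> C) (h : C -> C) :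
  Prop :=
  forall z, U z -> exists2 V, nbhs z V & {uniform V, f @ \oo --> h}.

(* The modulus takes its values in R[i]; [<] there only compares elements with
   the same imaginary part, so the bound M ranges over the reals. *)
Definition locally_uniform_cvg_infty (U : set C) (f : nat -> C -> C) : Prop :=
  forall z, U z -> exists2 V, nbhs z V &
    forall M : R, \forall k \near \oo, forall w, V w -> M%:C < `|f k w|.

Definition normal_on (G : set (C -> C)) (U : set C) : Prop :=
  forall f : nat -> C -> C, (forall k, G (f k)) ->
  exists2 phi : nat -> nat, {homo phi : m n / (m < n)%N} &
    (exists2 h, holomorphic_on U h & locally_uniform_cvg U (f \o phi) h) \/
    locally_uniform_cvg_infty U (f \o phi).

(* The alternative in [normal_on] is global on U, so it is the right notion on
   connected U only; on different components a sequence may have limits of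
   different kinds. Normality being a local property, the largest open set of
   normality is the union of the open sets satisfying [normal_on]. *)
Definition Fatou (G : set (C -> C)) : set C :=
  \bigcup_(U in [set U | open U /\ normal_on G U]) U.

Definition Julia (G : set (C -> C)) : set (one_point_compactification C) :=
  ~` (Some @` Fatou G).

End ComplexDynamics.

(* Main.v *)
(** The bounded-type hypothesis gives, for each generator g and every large M,
    the following: a bounded open set W with |g| > M on its boundary satisfies
    |g| > M throughout. Otherwise W contains a compact, relatively clopen piece K
    of {|g| <= M}; as g has no singular value of modulus >= M, every ray
    {s g(y) : s >= 1} with y in K, |g(y)| = M, lifts to a path from y, and K together
    with all these lifts is open and closed in the plane. Then g is proper, hence a
    polynomial. By the open mapping theorem the property passes to all h = g_i o k
    in the semigroup, with the same M: apply it to the set k(W).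

    Let V be a bounded open set with boundary in F(G). A sequence in G has a
    subsequence that near each boundary point converges or tends to infinity, which
    splits the boundary of V into two disjoint compact sets E1 and E2. As the plane
    is simply connected, V is covered by two bounded open sets with boundaries in E1
    and E2. On the first the sequence converges by the maximum principle, on the
    second it tends to infinity by the property above. Hence V lies in F(G). If J(G)
    were disconnected, a clopen piece of it avoiding infinity would have such a
    neighbourhood V. *)
Require Import Defs.
From mathcomp Require Import all_boot all_order all_algebra.
From mathcomp Require Import all_classical all_reals all_analysis.
From mathcomp Require Import complex ring lra.

Set Implicit Arguments.
Unset Strict Implicit.
Unset Printing Implicit Defensive.
Import Order.TTheory GRing.Theory Num.Theory.
Import numFieldNormedType.Exports.
Local Open Scope classical_set_scope.
Local Open Scope ring_scope.
Local Open Scope complex_scope.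
Local Notation Re := (@complex.Re _).
Local Notation Im := (@complex.Im _).

(** * The modulus and complex differentiability *)

(** The rays start on the circle of radius M and run outwards, while all singular values lie in a
    smaller disc; hence no path has to be bent round a branch point, and along a finite piece of a
    ray a lift can only fail by producing a finite asymptotic value. The set swept by all lifts is
    unbounded. It is controlled through its truncations at parameter s, which are compact and
    contain every lifted point where the modulus of g is at most sM.

    Normality demands a single kind of limit on a neighbourhood of each point, whereas a subsequence
    may show both kinds on the boundary of V; this forces the splitting into two covering sets,
    which depend on the sequence.

    The function theory rests on contour integrals over rectangles. The number 2 pi i enters only as
    the integral of dw/(w - z), of which the bound 2 from below and the independence of z inside the
    rectangle are used; constants such as 16 stem from such crude bounds. One subdivision argument,
    [bisection], yields Goursat's theorem, the compactness of closed bounded sets, the connectedness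
    of segments and the splitting along E1 and E2. *)

Definition cmod (R : realType) (z : R[i]) : R := Re `|z|.
Arguments cmod : simpl never.

Section Modulus.
Variable R : realType.
Local Notation C := R[i].
Implicit Types (x y z w : C) (a b : R).

Lemma normE z : `|z| = (cmod z)%:C.
Proof. by rewrite /cmod normc_def. Qed.

Lemma cmodE z : cmod z = Num.sqrt ((Re z)^+2 + (Im z)^+2).
Proof. by rewrite /cmod normc_def. Qed.

Lemma cmod_ge0 z : 0 <= cmod z.
Proof. by rewrite cmodE sqrtr_ge0. Qed.

Lemma cmodM x y : cmod (x * y) = cmod x * cmod y.
Proof. by apply: (@complexI R); rewrite -normE normrM !normE rmorphM. Qed.

Lemma cmodN x : cmod (- x) = cmod x.
Proof. by rewrite /cmod normrN. Qed.

Lemma cmodBC x y : cmod (x - y) = cmod (y - x).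
Proof. by rewrite -cmodN opprB. Qed.

Lemma cmod0 : cmod 0 = 0 :> R.
Proof. by rewrite /cmod normr0. Qed.

Lemma cmod_eq0 z : (cmod z == 0) = (z == 0).
Proof. by rewrite -[RHS]normr_eq0 normE -(inj_eq (@complexI R)). Qed.

Lemma cmod_gt0 z : (0 < cmod z) = (z != 0).
Proof. by rewrite lt_def cmod_eq0 cmod_ge0 andbT. Qed.

Lemma cmodV x : cmod x^-1 = (cmod x)^-1.
Proof. by apply: (@complexI R); rewrite -normE normfV !normE fmorphV. Qed.

Lemma cmodX x n : cmod (x ^+ n) = cmod x ^+ n.
Proof. by apply: (@complexI R); rewrite -normE normrX !normE rmorphXn. Qed.

Lemma cmodD x y : cmod (x + y) <= cmod x + cmod y.
Proof. by rewrite -lecR rmorphD -!normE ler_normD. Qed.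

Lemma cmodB x y : cmod (x - y) <= cmod x + cmod y.
Proof. by rewrite -(cmodN y) cmodD. Qed.

Lemma cmod_tri z x y : cmod (x - y) <= cmod (x - z) + cmod (z - y).
Proof. by have := cmodD (x - z) (z - y); rewrite subrKA. Qed.

Lemma cmod_subl x y : cmod x - cmod y <= cmod (x - y).
Proof. by have := cmodD (x - y) y; rewrite subrK; lra. Qed.

Lemma cmod_addl x y : cmod x - cmod y <= cmod (x + y).
Proof. by have := cmod_subl x (- y); rewrite opprK cmodN. Qed.

Lemma cmod_real a : cmod a%:C = `|a|.
Proof. by rewrite cmodE /= expr0n /= addr0 sqrtr_sqr. Qed.

Lemma cmod_i : cmod 'i = 1 :> R.
Proof. by rewrite cmodE /= expr0n expr1n /= add0r sqrtr1. Qed.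

Lemma Re_cmod z : `|Re z| <= cmod z.
Proof. by rewrite -lecR -normE; exact: normc_ge_Re. Qed.

Lemma Im_cmod z : `|Im z| <= cmod z.
Proof.
by rewrite cmodE -sqrtr_sqr ler_sqrt ?addr_ge0 ?sqr_ge0// lerDr sqr_ge0.
Qed.

Lemma cmod_le_ReIm z : cmod z <= `|Re z| + `|Im z|.
Proof.
have -> : z = (Re z)%:C + 'i * (Im z)%:C by rewrite -complexE.
apply: (le_trans (cmodD _ _)); rewrite cmodM cmod_i mul1r !cmod_real.
by case: z => a b /=; rewrite !(mul0r,mul1r,mulr0,subr0,addr0,add0r).
Qed.

Lemma Re_sub x y : Re (x - y) = Re x - Re y.
Proof. by case: x y => [? ?] [? ?]. Qed.

Lemma Im_sub x y : Im (x - y) = Im x - Im y.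
Proof. by case: x y => [? ?] [? ?]. Qed.

Lemma Re_add x y : Re (x + y) = Re x + Re y.
Proof. by case: x y => [? ?] [? ?]. Qed.

Lemma Im_add x y : Im (x + y) = Im x + Im y.
Proof. by case: x y => [? ?] [? ?]. Qed.

Lemma Re_mul x y : Re (x * y) = Re x * Re y - Im x * Im y.
Proof. by case: x y => [? ?] [? ?]. Qed.

Lemma Im_mul x y : Im (x * y) = Re x * Im y + Im x * Re y.
Proof. by case: x y => [? ?] [? ?]. Qed.

Lemma complex_eq x y : Re x = Re y -> Im x = Im y -> x = y.
Proof. by case: x y => [? ?] [? ?] /= -> ->. Qed.

Lemma nbhsCP z (A : set C) :
  nbhs z A <-> exists2 e : R, 0 < e & forall w, cmod (w - z) < e -> A w.
Proof.
split=> [/nbhs_ballP[e /= e0 H]|[e e0 H]].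
  have /complex_realP[k ek] : e \is Num.real by exact: gtr0_real.
  move: e0 H; rewrite ek ltcR => k0 H; exists k => // w wz.
  by apply: H; rewrite /ball /= distrC normE ltcR.
apply/nbhs_ballP; exists e%:C; first by rewrite /= ltcR.
by move=> w; rewrite /ball /= distrC normE ltcR; exact: H.
Qed.

Lemma openCP (A : set C) : open A <->
  forall z, A z -> exists2 e : R, 0 < e & forall w, cmod (w - z) < e -> A w.
Proof.
rewrite openE; split => [H z /H /=|H z /H ?].
  by rewrite /interior => /nbhsCP.
by rewrite /interior; apply/nbhsCP.
Qed.

Lemma closureCP (A : set C) z : closure A z <->
  forall e : R, 0 < e -> exists2 w, A w & cmod (w - z) < e.
Proof.
split=> [H e e0|H B /nbhsCP[e e0 HB]].
  have [|w [Aw zw]] := H [set w | cmod (w - z) < e]; last by exists w.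
  by apply/nbhsCP; exists e.
by have [w Aw wz] := H e e0; exists w; split=> //; exact: HB.
Qed.

Lemma closedCP (A : set C) : closed A <->
  forall z, (forall e : R, 0 < e -> exists2 w, A w & cmod (w - z) < e) -> A z.
Proof. by split=> H z; [move/closureCP/H | move/closureCP/H]. Qed.

(** The estimate contains no quotient and also covers [w = z], so that no punctured neighbourhood
    occurs. *)
Definition cdiff (f : C -> C) (z l : C) :=
  forall e : R, 0 < e -> exists2 d : R, 0 < d &
    forall w, cmod (w - z) < d -> cmod (f w - f z - l * (w - z)) <= e * cmod (w - z).

Definition ccont (f : C -> C) (z : C) :=
  forall e : R, 0 < e -> exists2 d : R, 0 < d &
    forall w, cmod (w - z) < d -> cmod (f w - f z) < e.

Lemma cdiff_cvg f z l : cdiff f z l <->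
  (h^-1 *: (f (h + z) - f z) @[h --> 0^'] --> l).
Proof.
split=> [H A /nbhsCP[e e0 HA]|H e e0].
  have e20 : 0 < e / 2 by lra.
  have [d d0 Hd] := H _ e20.
  apply/nbhsCP; exists d => //= h; rewrite subr0 => hd h0.
  apply: HA => /=; have := Hd (h + z); rewrite addrK => /(_ hd) le1.
  have hn : 0 < cmod h by rewrite cmod_gt0.
  have -> : h^-1 *: (f (h + z) - f z) - l = h^-1 * (f (h + z) - f z - l * h).
    by rewrite mulrBr mulrCA mulVf // mulr1.
  rewrite cmodM cmodV mulrC ltr_pdivrMr //; apply: le_lt_trans le1 _.
  by rewrite ltr_pM2r //; lra.
have /H /nbhsCP[d d0 Hd] : nbhs l [set w | cmod (w - l) < e].
  by apply/nbhsCP; exists e.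
exists d => // w wz; have [->|wz0] := eqVneq w z.
  by rewrite !subrr mulr0 subrr cmod0 mulr0.
have wn : 0 < cmod (w - z) by rewrite cmod_gt0 subr_eq0.
have := Hd (w - z); rewrite subr0 => /(_ wz); rewrite subr_eq0 => /(_ wz0) /=.
rewrite subrK => le1.
have -> : f w - f z - l * (w - z) = (w - z) * ((w - z)^-1 *: (f w - f z) - l).
  have -> : (w - z)^-1 *: (f w - f z) = (w - z)^-1 * (f w - f z) by [].
  by rewrite [RHS]mulrBr mulrA divff ?subr_eq0 // mul1r [l * _]mulrC.
by rewrite cmodM mulrC ler_wpM2r // ltW.
Qed.

Lemma derivable_cdiff f z : derivable f z 1 <-> exists l, cdiff f z l.
Proof.
rewrite /derivable; split.
  move/cvg_ex => [l H]; exists l; apply/cdiff_cvg; move: H.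
  by under eq_fun do rewrite /GRing.scale /= mulr1.
move=> [l /cdiff_cvg H]; apply/cvg_ex; exists l; move: H.
by under [X in _ -> X @ _ --> _]eq_fun do rewrite [_ *: 1]/GRing.scale /= mulr1.
Qed.

Lemma cdiff_derive1 f z l : cdiff f z l -> derive1 f z = l.
Proof. by move/cdiff_cvg => H; rewrite /derive1; exact/cvg_lim. Qed.

End Modulus.

(** * Integration along segments *)

Section Integral.
Variable R : realType.
Local Notation C := R[i].
Local Notation mu := (@lebesgue_measure R).
Implicit Types (f g : R -> C) (a b c t : R).

Definition rcont f t := forall e : R, 0 < e -> exists2 d : R, 0 < d &
  forall s, `|s - t| < d -> cmod (f s - f t) < e.

(** Continuity is two-sided even at the end points, which fits integrands that are restrictions of
    functions continuous at points of the plane. *)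
Definition rcont_on f a b := forall t, a <= t <= b -> rcont f t.

Definition cint f a b : C :=
  (\int[mu]_(t in `[a, b]) (Re (f t)))%R +i* (\int[mu]_(t in `[a, b]) (Im (f t)))%R.

Lemma rcont_Re f t : rcont f t -> {for t, continuous (Re \o f : R -> R)}.
Proof.
move=> H; apply/cvgrPdist_lt => e e0; have [d d0 Hd] := H e e0.
apply/nbhs_ballP; exists d => //= s; rewrite /ball /= => hs.
rewrite -Re_sub; apply: le_lt_trans (Re_cmod _) _.
by rewrite cmodBC; apply: Hd; rewrite distrC.
Qed.

Lemma rcont_Im f t : rcont f t -> {for t, continuous (Im \o f : R -> R)}.
Proof.
move=> H; apply/cvgrPdist_lt => e e0; have [d d0 Hd] := H e e0.
apply/nbhs_ballP; exists d => //= s; rewrite /ball /= => hs.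
rewrite -Im_sub; apply: le_lt_trans (Im_cmod _) _.
by rewrite cmodBC; apply: Hd; rewrite distrC.
Qed.

Lemma itv_integrable (h : R -> R) a b :
  (forall t, a <= t <= b -> {for t, continuous h}) ->
  mu.-integrable `[a, b] (EFin \o h).
Proof.
move=> H; apply: continuous_compact_integrable; first exact: segment_compact.
apply: continuous_in_subspaceT => t; rewrite inE /= in_itv /= => tab.
exact: H.
Qed.

Lemma integrable_Re f a b : rcont_on f a b ->
  mu.-integrable `[a, b] (EFin \o (Re \o f)).
Proof. by move=> H; apply: itv_integrable => t /H; exact: rcont_Re. Qed.

Lemma integrable_Im f a b : rcont_on f a b ->
  mu.-integrable `[a, b] (EFin \o (Im \o f)).
Proof. by move=> H; apply: itv_integrable => t /H; exact: rcont_Im. Qed.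

Lemma eq_cint f g a b : (forall t, a <= t <= b -> f t = g t) ->
  cint f a b = cint g a b.
Proof.
move=> H; rewrite /cint; congr Complex; apply: eq_Rintegral => t;
by rewrite inE /= in_itv /= => /H ->.
Qed.

Lemma cintD f g a b : rcont_on f a b -> rcont_on g a b ->
  cint (fun t => f t + g t) a b = cint f a b + cint g a b.
Proof.
move=> Hf Hg; apply: complex_eq; rewrite /cint /=.
  under eq_Rintegral do rewrite Re_add.
  by rewrite RintegralD //; [exact: integrable_Re|exact: integrable_Re].
under eq_Rintegral do rewrite Im_add.
by rewrite RintegralD //; [exact: integrable_Im|exact: integrable_Im].
Qed.

Lemma integrableZ (h : R -> R) k a b : mu.-integrable `[a, b] (EFin \o h) ->
  mu.-integrable `[a, b] (EFin \o (fun t => k * h t)).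
Proof. by move=> H; apply: (@integrableZl _ _ _ mu `[a, b] _ k (EFin \o h)). Qed.

Lemma cintZ f (k : C) a b : rcont_on f a b ->
  cint (fun t => k * f t) a b = k * cint f a b.
Proof.
move=> Hf; apply: complex_eq; rewrite /cint /=.
  under eq_Rintegral do rewrite Re_mul.
  rewrite RintegralB //; last 2 first.
  - exact/integrableZ/integrable_Re.
  - exact/integrableZ/integrable_Im.
  rewrite !RintegralZl //.
  - by rewrite Re_mul.
  - exact: integrable_Im.
  - exact: integrable_Re.
under eq_Rintegral do rewrite Im_mul.
rewrite RintegralD //; last 2 first.
- exact/integrableZ/integrable_Im.
- exact/integrableZ/integrable_Re.
rewrite !RintegralZl //.
- by rewrite Im_mul.
- exact: integrable_Re.
- exact: integrable_Im.
Qed.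

Lemma Rint_split (h : R -> R) a b c : a <= c <= b ->
  mu.-integrable `[a, b] (EFin \o h) ->
  (\int[mu]_(t in `[a, b]) h t = \int[mu]_(t in `[a, c]) h t + \int[mu]_(t in `[c, b]) h t)%R.
Proof.
move=> /andP[ac cb] H; have := @Rintegral_itvB R h (BLeft a) (BRight b) c H.
rewrite !bnd_simp => /(_ ac cb) /eqP; rewrite subr_eq addrC => /eqP ->.
congr (_ + _); apply: Rintegral_itv_obnd_cbnd.
apply: integrableS H => //; apply: subset_itvr; exact: ac.
Qed.

Lemma cint_split f a b c : a <= c <= b -> rcont_on f a b ->
  cint f a b = cint f a c + cint f c b.
Proof.
move=> abc H; apply: complex_eq; rewrite /cint /=.
  by apply: (@Rint_split (Re \o f)) => //; exact: integrable_Re.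
by apply: (@Rint_split (Im \o f)) => //; exact: integrable_Im.
Qed.

Lemma Rint_cst (k a b : R) : a <= b -> (\int[mu]_(t in `[a, b]) k = k * (b - a))%R.
Proof.
move=> ab; rewrite Rintegral_cst //= lebesgue_measure_itv /= lte_fin.
by move: ab; rewrite le_eqVlt => /orP[/eqP->|->] //=; rewrite ltxx subrr.
Qed.

Lemma cint_cst (k : C) a b : a <= b -> cint (fun=> k) a b = k * (b - a)%:C.
Proof.
move=> ab; apply: complex_eq; rewrite /cint /= Rint_cst //.
  by rewrite Re_mul /=; ring.
by rewrite Im_mul /=; ring.
Qed.

Lemma Rint_bound (h : R -> R) M a b : a <= b ->
  mu.-integrable `[a, b] (EFin \o h) -> (forall t, a <= t <= b -> `|h t| <= M) ->
  `|(\int[mu]_(t in `[a, b]) h t)%R| <= M * (b - a).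
Proof.
move=> ab H HM; rewrite -Rint_cst //.
apply: (le_trans (le_normr_Rintegral _ H)) => //.
apply: le_Rintegral => //.
- have -> : EFin \o (fun t => `|h t|) = abse \o (EFin \o h) by [].
  exact: integrable_abse.
- by apply: itv_integrable => t _; exact: cvg_cst.
Qed.

(** The factor 2 comes from bounding the real and the imaginary part separately. *)
Lemma cint_bound f M a b : a <= b -> rcont_on f a b ->
  (forall t, a <= t <= b -> cmod (f t) <= M) -> cmod (cint f a b) <= 2 * M * (b - a).
Proof.
move=> ab Hf HM; apply: (le_trans (cmod_le_ReIm _)).
have -> : 2 * M * (b - a) = M * (b - a) + M * (b - a) by ring.
apply: lerD; apply: Rint_bound => //; first exact: integrable_Re.
- by move=> t /HM; apply: le_trans; exact: Re_cmod.
- exact: integrable_Im.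
- by move=> t /HM; apply: le_trans; exact: Im_cmod.
Qed.

End Integral.

(** * Rules of continuity and complex differentiation *)

Section CDiff.
Variable R : realType.
Local Notation C := R[i].
Implicit Types (f g : C -> C) (z w l : C).

Lemma cdiff_ccont f z l : cdiff f z l -> ccont f z.
Proof.
move=> H e e0; have [d d0 Hd] := H 1 ltr01.
have l0 := cmod_ge0 l; pose r := e / (cmod l + 1).
have r0 : 0 < r by rewrite divr_gt0 //; lra.
exists (Num.min d r); first by rewrite lt_min d0.
move=> w; rewrite lt_min => /andP[wd wr]; have := Hd w wd; rewrite mul1r => h.
have h1 : cmod (f w - f z) <= (cmod l + 1) * cmod (w - z).
  have := cmod_subl (f w - f z) (l * (w - z)); rewrite cmodM; lra.
apply: le_lt_trans h1 _; rewrite mulrC -ltr_pdivlMr //; lra.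
Qed.

Lemma ccont_cst (k : C) z : ccont (fun=> k) z.
Proof. by move=> e e0; exists 1 => // w _; rewrite subrr cmod0. Qed.

Lemma ccont_id z : ccont id z.
Proof. by move=> e e0; exists e. Qed.

Lemma ccontD f g z : ccont f z -> ccont g z -> ccont (fun w => f w + g w) z.
Proof.
move=> Hf Hg e e0; have e20 : 0 < e / 2 by lra.
have [d d0 Hd] := Hf _ e20; have [d' d'0 Hd'] := Hg _ e20.
exists (Num.min d d'); first by rewrite lt_min d0.
move=> w; rewrite lt_min => /andP[/Hd h1 /Hd' h2].
have -> : f w + g w - (f z + g z) = (f w - f z) + (g w - g z) by ring.
by have := cmodD (f w - f z) (g w - g z); lra.
Qed.

Lemma ccontM f g z : ccont f z -> ccont g z -> ccont (fun w => f w * g w) z.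
Proof.
move=> Hf Hg e e0; pose A := cmod (f z) + cmod (g z) + 1.
have fz := cmod_ge0 (f z); have gz := cmod_ge0 (g z).
have A0 : 0 < A by rewrite /A; lra.
pose r := Num.min 1 (e / (2 * A)).
have r0 : 0 < r by rewrite lt_min ltr01 divr_gt0 // mulr_gt0.
have [d d0 Hd] := Hf _ r0; have [d' d'0 Hd'] := Hg _ r0.
exists (Num.min d d'); first by rewrite lt_min d0.
move=> w; rewrite lt_min => /andP[/Hd h1 /Hd' h2].
have -> : f w * g w - f z * g z =
  (f w - f z) * (g w - g z) + (f w - f z) * g z + f z * (g w - g z) by ring.
apply: le_lt_trans (cmodD _ _) _; rewrite cmodM.
have := cmodD ((f w - f z) * (g w - g z)) ((f w - f z) * g z); rewrite !cmodM.
set a := cmod (f w - f z) in h1 *; set b := cmod (g w - g z) in h2 *.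
have a0 : 0 <= a := cmod_ge0 _; have b0 : 0 <= b := cmod_ge0 _.
move: h1 h2; rewrite !lt_min => /andP[a1 a2] /andP[b1 b2].
have rA : e / (2 * A) * A = e / 2 by field; rewrite gt_eqF.
move: rA a2 b2; set q := e / (2 * A) => rA a2 b2.
rewrite /A in rA; nra.
Qed.

Lemma ccontV f z : f z != 0 -> ccont f z -> ccont (fun w => (f w)^-1) z.
Proof.
move=> fz0 Hf e e0; have F0 : 0 < cmod (f z) by rewrite cmod_gt0.
set F := cmod (f z) in F0 *.
pose r := Num.min (F / 2) (e * F ^+ 2 / 2).
have r0 : 0 < r.
  by rewrite lt_min; apply/andP; split; [lra|rewrite !mulr_gt0 ?exprn_gt0 //; lra].
have [d d0 Hd] := Hf _ r0; exists d => // w /Hd; rewrite lt_min => /andP[h1 h2].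
have h3 : F / 2 < cmod (f w).
  have := cmod_subl (f z) (f w); rewrite cmodBC -/F; lra.
have fw0 : f w != 0 by rewrite -cmod_gt0; lra.
have -> : (f w)^-1 - (f z)^-1 = - (f w - f z) / (f w * f z) by field; rewrite ?fw0 ?fz0 ?fz.
rewrite cmodM cmodN cmodV cmodM -/F ltr_pdivrMr; last by rewrite mulr_gt0 //; lra.
apply: lt_trans h2 _; have : e * F * (F / 2) < e * F * cmod (f w).
  by rewrite ltr_pM2l // mulr_gt0.
by rewrite expr2; lra.
Qed.

Lemma ccont_near f g z r : 0 < r -> (forall w, cmod (w - z) < r -> f w = g w) ->
  ccont f z -> ccont g z.
Proof.
move=> r0 fg Hf e e0; have [d d0 Hd] := Hf e e0.
exists (Num.min d r); first by rewrite lt_min d0.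
move=> w; rewrite lt_min => /andP[wd wr].
by rewrite -!fg //; [exact: Hd | rewrite subrr cmod0].
Qed.

Lemma ccont_comp f g z : ccont f z -> ccont g (f z) -> ccont (g \o f) z.
Proof.
move=> Hf Hg e e0; have [d d0 Hd] := Hg e e0; have [d' d'0 Hd'] := Hf d d0.
by exists d' => // w /Hd'/Hd.
Qed.

(** Caratheodory's criterion: differentiability as a factorisation of the increment through a
    continuous slope. The product, inverse and chain rules then reduce to algebra and the continuity
    rules. *)
Lemma cdiff_slope f z l : cdiff f z l <->
  exists2 phi : C -> C, ccont phi z & phi z = l /\
    exists2 r : R, 0 < r &
      forall w, cmod (w - z) < r -> f w - f z = phi w * (w - z).
Proof.
split=> [H|[phi Hphi [phiz [r r0 Hr]]] e e0].
  exists (fun w => if w == z then l else (f w - f z) / (w - z)); last first.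
    split; first by rewrite eqxx.
    exists 1 => // w _; have [->|wz] := eqVneq; first by rewrite !subrr mulr0.
    by rewrite divfK // subr_eq0.
  move=> e e0; have e20 : 0 < e / 2 by lra.
  have [d d0 Hd] := H _ e20; exists d => // w /Hd; rewrite eqxx.
  have [->|wz] := eqVneq; first by rewrite !subrr cmod0.
  have wz0 : 0 < cmod (w - z) by rewrite cmod_gt0 subr_eq0.
  have -> : f w - f z - l * (w - z) = (w - z) * ((f w - f z) / (w - z) - l).
    by field; rewrite ?subr_eq0.
  by rewrite cmodM mulrC ler_pM2r //; lra.
have [d d0 Hd] := Hphi e e0; exists (Num.min d r); first by rewrite lt_min d0.
move=> w; rewrite lt_min => /andP[wd wr]; rewrite Hr // -mulrBl cmodM.
by rewrite ler_wpM2r ?cmod_ge0 // -phiz ltW // Hd.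
Qed.

Lemma cdiff_near f g z l r : 0 < r -> (forall w, cmod (w - z) < r -> f w = g w) ->
  cdiff f z l -> cdiff g z l.
Proof.
move=> r0 fg Hf e e0; have [d d0 Hd] := Hf e e0.
exists (Num.min d r); first by rewrite lt_min d0.
move=> w; rewrite lt_min => /andP[wd wr].
by rewrite -!fg //; [exact: Hd | rewrite subrr cmod0].
Qed.

Lemma cdiff_cst (k : C) z : cdiff (fun=> k) z 0.
Proof.
by move=> e e0; exists 1 => // w _; rewrite subrr mul0r subrr cmod0 mulr_ge0 ?cmod_ge0 // ltW.
Qed.

Lemma cdiff_id z : cdiff id z 1.
Proof.
by move=> e e0; exists 1 => // w _; rewrite mul1r subrr cmod0 mulr_ge0 ?cmod_ge0 // ltW.
Qed.

Lemma cdiffD f g z l m : cdiff f z l -> cdiff g z m -> cdiff (fun w => f w + g w) z (l + m).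
Proof.
move=> /cdiff_slope[p cp [<- [r r0 Hr]]] /cdiff_slope[q cq [<- [s s0 Hs]]].
apply/cdiff_slope; exists (fun w => p w + q w); first exact: ccontD.
split=> //; exists (Num.min r s); first by rewrite lt_min r0.
move=> w; rewrite lt_min => /andP[wr ws]; rewrite mulrDl -Hr // -Hs //; ring.
Qed.

Lemma cdiffM f g z l m : cdiff f z l -> cdiff g z m ->
  cdiff (fun w => f w * g w) z (l * g z + f z * m).
Proof.
move=> Hf /cdiff_slope[q cq [<- [s s0 Hs]]]; have cf := cdiff_ccont Hf.
move/cdiff_slope: Hf => [p cp [<- [r r0 Hr]]].
apply/cdiff_slope; exists (fun w => p w * g z + f w * q w).
  by apply: ccontD; apply: ccontM => //; exact: ccont_cst.
split=> //; exists (Num.min r s); first by rewrite lt_min r0.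
move=> w; rewrite lt_min => /andP[wr ws].
rewrite mulrDl -(mulrA (f w)) -Hs // mulrAC -Hr //; ring.
Qed.

Lemma cdiffZ f (k : C) z l : cdiff f z l -> cdiff (fun w => k * f w) z (k * l).
Proof. by move=> H; have := cdiffM (cdiff_cst k z) H; rewrite mul0r add0r. Qed.

Lemma cdiffN f z l : cdiff f z l -> cdiff (fun w => - f w) z (- l).
Proof.
move=> /(cdiffZ (-1)); rewrite mulN1r; apply: (@cdiff_near _ _ _ _ 1) => // w _.
by rewrite mulN1r.
Qed.

Lemma cdiffB f g z l m : cdiff f z l -> cdiff g z m -> cdiff (fun w => f w - g w) z (l - m).
Proof. by move=> Hf /cdiffN; exact: cdiffD. Qed.

Lemma cdiffV f z l : f z != 0 -> cdiff f z l ->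
  cdiff (fun w => (f w)^-1) z (- l / (f z * f z)).
Proof.
move=> fz Hf; have cf := cdiff_ccont Hf.
move/cdiff_slope: Hf => [p cp [<- [r r0 Hr]]]; apply/cdiff_slope.
have F0 : 0 < cmod (f z) by rewrite cmod_gt0.
have [d d0 Hd] := cf _ F0.
exists (fun w => - p w / (f w * f z)).
  apply: ccontM.
    apply: (@ccont_near (fun w => -1 * p w) _ _ 1) => // [w _|]; first by rewrite mulN1r.
    by apply: ccontM => //; exact: ccont_cst.
  by apply: ccontV; [rewrite mulf_neq0|apply: ccontM => //; exact: ccont_cst].
split=> //; exists (Num.min r d); first by rewrite lt_min r0.
move=> w; rewrite lt_min => /andP[wr /Hd wd].
have fw0 : f w != 0.
  by rewrite -cmod_gt0; have := cmod_subl (f z) (f w); rewrite cmodBC; lra.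
by rewrite mulrAC mulNr -Hr //; field; rewrite fw0 fz.
Qed.

Lemma cdiff_comp f g z l m : cdiff f z l -> cdiff g (f z) m -> cdiff (g \o f) z (m * l).
Proof.
move=> Hf /cdiff_slope[q cq [<- [s s0 Hs]]]; have cf := cdiff_ccont Hf.
move/cdiff_slope: Hf => [p cp [<- [r r0 Hr]]]; apply/cdiff_slope.
exists (fun w => q (f w) * p w).
  by apply: ccontM => //; exact: (@ccont_comp f q).
split=> //; have [d d0 Hd] := cf _ s0.
exists (Num.min r d); first by rewrite lt_min r0.
move=> w; rewrite lt_min => /andP[wr /Hd wd] /=.
by rewrite Hs // Hr // mulrA.
Qed.

Lemma cdiffX f z l n : cdiff f z l -> exists m, cdiff (fun w => f w ^+ n) z m.
Proof.
move=> H; elim: n => [|n [m IH]].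
  by exists 0; exact: (cdiff_cst 1 z).
exists (l * f z ^+ n + f z * m); apply: (@cdiff_near (fun w => f w * f w ^+ n) _ _ _ 1) => //.
  by move=> ? _; rewrite exprS.
exact: (cdiffM (g := fun w => f w ^+ n)).
Qed.

Lemma cdiff_unique f z l m : cdiff f z l -> cdiff f z m -> l = m.
Proof. by move=> /cdiff_derive1 <- /cdiff_derive1 <-. Qed.

Definition cdable f z := exists l, cdiff f z l.

Lemma cdable_cont f z : cdable f z -> ccont f z.
Proof. by case=> l; exact: cdiff_ccont. Qed.

Lemma cdableD f g z : cdable f z -> cdable g z -> cdable (fun w => f w + g w) z.
Proof. by move=> [l Hl] [m Hm]; exists (l + m); exact: cdiffD. Qed.

Lemma cdableB f g z : cdable f z -> cdable g z -> cdable (fun w => f w - g w) z.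
Proof. by move=> [l Hl] [m Hm]; exists (l - m); exact: cdiffB. Qed.

Lemma cdableM f g z : cdable f z -> cdable g z -> cdable (fun w => f w * g w) z.
Proof. by move=> [l Hl] [m Hm]; eexists; exact: cdiffM Hl Hm. Qed.

Lemma cdableV f z : f z != 0 -> cdable f z -> cdable (fun w => (f w)^-1) z.
Proof. by move=> fz [l Hl]; eexists; exact: cdiffV fz Hl. Qed.

Lemma cdable_comp f g z : cdable f z -> cdable g (f z) -> cdable (g \o f) z.
Proof. by move=> [l Hl] [m Hm]; eexists; exact: cdiff_comp Hl Hm. Qed.

Lemma cdable_cst (k : C) z : cdable (fun=> k) z.
Proof. by exists 0; exact: cdiff_cst. Qed.

Lemma cdable_id z : cdable id z.
Proof. by exists 1; exact: cdiff_id. Qed.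

Lemma cdableX f z n : cdable f z -> cdable (fun w => f w ^+ n) z.
Proof. by case=> l H; exact: (cdiffX _ H). Qed.

Lemma cdable_near f g z r : 0 < r -> (forall w, cmod (w - z) < r -> f w = g w) ->
  cdable f z -> cdable g z.
Proof. by move=> r0 fg [l H]; exists l; exact: (cdiff_near r0 fg). Qed.

End CDiff.

(** * Bisection and Goursat's theorem *)

Section Bisection.
Variable R : realType.
Variables (A B : R) (P : R -> R -> R -> Prop).
Hypotheses (A0 : 0 <= A) (B0 : 0 <= B).
Hypothesis quarter : forall x y s, 0 < s ->
  P x y (s / 2) -> P (x + s / 2 * A) y (s / 2) -> P x (y + s / 2 * B) (s / 2) ->
  P (x + s / 2 * A) (y + s / 2 * B) (s / 2) -> P x y s.
Variables x0 y0 : R.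
Hypothesis local : forall p q, x0 <= p <= x0 + A -> y0 <= q <= y0 + B ->
  exists2 d : R, 0 < d & forall x y s, 0 < s < d ->
    x <= p <= x + s * A -> y <= q <= y + s * B -> P x y s.

(** The premises stand below the existential quantifier so that [choice] yields a total map, which
    can be iterated. *)
Let step (u : R * R * R) : exists v : R * R * R,
  0 < u.2 -> ~ P u.1.1 u.1.2 u.2 ->
  [/\ v.2 = u.2 / 2, ~ P v.1.1 v.1.2 v.2,
      u.1.1 <= v.1.1 /\ v.1.1 + v.2 * A <= u.1.1 + u.2 * A &
      u.1.2 <= v.1.2 /\ v.1.2 + v.2 * B <= u.1.2 + u.2 * B].
Proof.
case: u => [[x y] s] /=.
have [s0|s0] := pselect (0 < s); last by exists (x, y, s).
have sA : 0 <= s / 2 * A by rewrite mulr_ge0 //; lra.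
have sB : 0 <= s / 2 * B by rewrite mulr_ge0 //; lra.
have [h1|h1] := pselect (P x y (s / 2)); last first.
  by exists (x, y, s / 2) => _ _ /=; split=> //; split; lra.
have [h2|h2] := pselect (P (x + s / 2 * A) y (s / 2)); last first.
  by exists (x + s / 2 * A, y, s / 2) => _ _ /=; split=> //; split; lra.
have [h3|h3] := pselect (P x (y + s / 2 * B) (s / 2)); last first.
  by exists (x, y + s / 2 * B, s / 2) => _ _ /=; split=> //; split; lra.
have [h4|h4] := pselect (P (x + s / 2 * A) (y + s / 2 * B) (s / 2)); last first.
  by exists (x + s / 2 * A, y + s / 2 * B, s / 2) => _ _ /=; split=> //; split; lra.
by exists (x, y, s) => _ []; exact: quarter.
Qed.

Lemma nested_intervals (a b : nat -> R) :
  (forall n, a n <= a n.+1) -> (forall n, b n.+1 <= b n) -> (forall n, a n <= b n) ->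
  exists p, forall n, a n <= p <= b n.
Proof.
move=> ai bd ab.
have amono m k : a m <= a (m + k)%N.
  by elim: k => [|k IH]; rewrite ?addn0 ?addnS //; exact: le_trans (ai _).
have bmono m k : b (m + k)%N <= b m.
  by elim: k => [|k IH]; rewrite ?addn0 ?addnS //; exact: le_trans (bd _) IH.
have abmn m n : a m <= b n.
  by apply: le_trans (amono m n) _; apply: le_trans (ab _) _; rewrite addnC.
exists (sup (range a)) => n; apply/andP; split.
  by apply: ub_le_sup; [exists (b 0%N) => _ [m _ <-]|exists n].
by apply: ge_sup; [exists (a 0%N); exists 0%N|move=> _ [m _ <-]].
Qed.

Lemma half_pow_small (d : R) : 0 < d -> exists n : nat, 2^-1 ^+ n < d.
Proof.
move=> d0; have [n Hn] : exists n : nat, d^-1 < n%:R.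
  by exists (Num.truncn d^-1).+1; rewrite truncnS_gt.
exists n; rewrite exprVn invf_plt ?posrE ?exprn_gt0 //.
apply: lt_trans Hn _; rewrite -natrX ltr_nat; exact: ltn_expl.
Qed.

(** A failing rectangle has a failing quarter by [quarter]; iteration gives nested failing
    rectangles that shrink to a point, where [local] is contradicted. The sides [A] and [B] may be
    0, so that segments are covered as well as squares. *)
Theorem bisection : P x0 y0 1.
Proof.
apply: contrapT => nP.
have [F HF] := choice step.
pose u n := iter n F (x0, y0, 1).
have Hu n : (u n).2 = 2^-1 ^+ n /\ ~ P (u n).1.1 (u n).1.2 (u n).2.
  elim: n => [|n [e IH]]; first by rewrite expr0.
  have [|v1 v2 _ _] := HF (u n) _ IH; first by rewrite e exprn_gt0.
  by split=> //; rewrite /u iterS -/(u n) v1 e exprSr.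
have s0 n : 0 < (u n).2 by rewrite (Hu n).1 exprn_gt0.
have Hs n := HF (u n) (s0 n) (Hu n).2.
have [p Hp] : exists p, forall n, (u n).1.1 <= p <= (u n).1.1 + (u n).2 * A.
  apply: nested_intervals => n; try by have [_ _ []] := Hs n.
  by rewrite lerDl mulr_ge0 // ltW.
have [q Hq] : exists q, forall n, (u n).1.2 <= q <= (u n).1.2 + (u n).2 * B.
  apply: nested_intervals => n; try by have [_ _ _ []] := Hs n.
  by rewrite lerDl mulr_ge0 // ltW.
have [||d d0 Hd] := @local p q.
- by have := Hp 0%N; rewrite /= mul1r.
- by have := Hq 0%N; rewrite /= mul1r.
have [n Hn] := half_pow_small d0.
apply: (Hu n).2; apply: Hd => //.
by rewrite s0 (Hu n).1.
Qed.

End Bisection.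

Section Rectangle.
Variable R : realType.
Local Notation C := R[i].
Implicit Types (f g : C -> C) (a b c d : R) (z w : C).

(** The contour integral over the positively oriented boundary of the rectangle [a, b] x [c, d]; the
    factor 'i is the velocity along the vertical sides. *)
Definition rint f a b c d : C :=
  cint (fun t => f (t +i* c)) a b - cint (fun t => f (t +i* d)) a b +
  'i * cint (fun t => f (b +i* t)) c d - 'i * cint (fun t => f (a +i* t)) c d.

Definition hcont f a b c := forall t, a <= t <= b -> ccont f (t +i* c).
Definition vcont f c d a := forall t, c <= t <= d -> ccont f (a +i* t).

Definition rect a b c d z := (a <= Re z <= b) && (c <= Im z <= d).

Definition bcont f a b c d :=
  [/\ hcont f a b c, hcont f a b d, vcont f c d a & vcont f c d b].

Lemma rect_bcont f a b c d : a <= b -> c <= d ->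
  (forall z, rect a b c d z -> ccont f z) -> bcont f a b c d.
Proof.
by move=> ab cd H; split=> t tab; apply: H; rewrite /rect /= tab ?lexx ?ab ?cd.
Qed.

Lemma hcont_rcont f a b c : hcont f a b c -> rcont_on (fun t => f (t +i* c)) a b.
Proof.
move=> H t /H Ht e /Ht[r r0 Hr]; exists r => // s st; apply: Hr.
have -> : (s +i* c) - (t +i* c) = (s - t)%:C by apply: complex_eq; rewrite ?Re_sub ?Im_sub /= ?subrr.
by rewrite cmod_real.
Qed.

Lemma vcont_rcont f c d a : vcont f c d a -> rcont_on (fun t => f (a +i* t)) c d.
Proof.
move=> H t /H Ht e /Ht[r r0 Hr]; exists r => // s st; apply: Hr.
have -> : (a +i* s) - (a +i* t) = 'i * (s - t)%:C.
  by apply: complex_eq; rewrite ?Re_sub ?Im_sub ?Re_mul ?Im_mul /=; ring.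
by rewrite cmodM cmod_i mul1r cmod_real.
Qed.

Lemma rint_splitx f a m b c d : a <= m <= b -> hcont f a b c -> hcont f a b d ->
  rint f a b c d = rint f a m c d + rint f m b c d.
Proof.
move=> amb /hcont_rcont hc /hcont_rcont hd; rewrite /rint.
by rewrite (cint_split amb hc) (cint_split amb hd); ring.
Qed.

Lemma rint_splity f a b c m d : c <= m <= d -> vcont f c d a -> vcont f c d b ->
  rint f a b c d = rint f a b c m + rint f a b m d.
Proof.
move=> cmd /vcont_rcont ha /vcont_rcont hb; rewrite /rint.
by rewrite (cint_split cmd ha) (cint_split cmd hb); ring.
Qed.

Lemma rintD f g a b c d : bcont f a b c d -> bcont g a b c d ->
  rint (fun z => f z + g z) a b c d = rint f a b c d + rint g a b c d.
Proof.
move=> [/hcont_rcont f1 /hcont_rcont f2 /vcont_rcont f3 /vcont_rcont f4].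
move=> [/hcont_rcont g1 /hcont_rcont g2 /vcont_rcont g3 /vcont_rcont g4].
by rewrite /rint !cintD //; ring.
Qed.

Lemma rintZ f (k : C) a b c d : bcont f a b c d ->
  rint (fun z => k * f z) a b c d = k * rint f a b c d.
Proof.
move=> [/hcont_rcont f1 /hcont_rcont f2 /vcont_rcont f3 /vcont_rcont f4].
by rewrite /rint !cintZ //; ring.
Qed.

Definition bdry a b c d z := rect a b c d z &&
  [|| Re z == a, Re z == b, Im z == c | Im z == d].

Lemma bdry_bcont f a b c d : a <= b -> c <= d ->
  (forall z, bdry a b c d z -> ccont f z) -> bcont f a b c d.
Proof.
by move=> ab cd H; split=> t tab; apply: H;
  rewrite /bdry /rect /= tab ?lexx ?ab ?cd ?eqxx ?orbT.
Qed.

Lemma rint_bound f M a b c d : a <= b -> c <= d -> bcont f a b c d ->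
  (forall z, bdry a b c d z -> cmod (f z) <= M) ->
  cmod (rint f a b c d) <= 4 * M * ((b - a) + (d - c)).
Proof.
move=> ab cd [/hcont_rcont f1 /hcont_rcont f2 /vcont_rcont f3 /vcont_rcont f4] H.
rewrite /rint.
have b1 : cmod (cint (fun t => f (t +i* c)) a b) <= 2 * M * (b - a).
  by apply: (cint_bound ab f1) => t tab; apply: H; rewrite /bdry /rect /= tab lexx cd eqxx !orbT.
have b2 : cmod (cint (fun t => f (t +i* d)) a b) <= 2 * M * (b - a).
  by apply: (cint_bound ab f2) => t tab; apply: H; rewrite /bdry /rect /= tab lexx cd eqxx !orbT.
have b3 : cmod (cint (fun t => f (a +i* t)) c d) <= 2 * M * (d - c).
  by apply: (cint_bound cd f3) => t tab; apply: H; rewrite /bdry /rect /= tab lexx ab eqxx.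
have b4 : cmod (cint (fun t => f (b +i* t)) c d) <= 2 * M * (d - c).
  by apply: (cint_bound cd f4) => t tab; apply: H; rewrite /bdry /rect /= tab lexx ab eqxx !orbT.
move: b1 b2 b3 b4; set I1 := cint _ a b; set I2 := cint _ a b.
set I3 := cint _ c d; set I4 := cint _ c d => b1 b2 b3 b4.
have := cmodB (I1 - I2 + 'i * I4) ('i * I3); have := cmodD (I1 - I2) ('i * I4).
by have := cmodB I1 I2; rewrite !cmodM !cmod_i !mul1r; lra.
Qed.

(** The integrand differs by a constant between opposite sides. The horizontal pair contributes -l i
    (d - c)(b - a), the vertical pair i l (b - a)(d - c). *)
Lemma rint_affine (k l z0 : C) a b c d : a <= b -> c <= d ->
  rint (fun z => k + l * (z - z0)) a b c d = 0.
Proof.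
move=> ab cd.
have ca z : ccont (fun z => k + l * (z - z0)) z.
  apply/cdable_cont; apply: cdableD; first exact: cdable_cst.
  apply: cdableM; first exact: cdable_cst.
  by apply: cdableB; [exact: cdable_id|exact: cdable_cst].
have cb : bcont (fun z => k + l * (z - z0)) a b c d by apply: bdry_bcont => // z _.
case: cb => [/hcont_rcont f1 /hcont_rcont f2 /vcont_rcont f3 /vcont_rcont f4].
have rk (m : C) u v : rcont_on (fun=> m) u v.
  by move=> t _ e e0; exists 1 => // s _; rewrite subrr cmod0.
have e1 : cint (fun t => k + l * ((t +i* d) - z0)) a b =
  cint (fun t => k + l * ((t +i* c) - z0)) a b + l * 'i * (d - c)%:C * (b - a)%:C.
  rewrite -cint_cst // -cintD //; apply: eq_cint => t _.
  have -> : t +i* d = (t +i* c) + 'i * (d - c)%:C.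
    by apply: complex_eq; rewrite ?Re_add ?Im_add ?Re_mul ?Im_mul /=; ring.
  ring.
have e2 : cint (fun t => k + l * ((b +i* t) - z0)) c d =
  cint (fun t => k + l * ((a +i* t) - z0)) c d + l * (b - a)%:C * (d - c)%:C.
  rewrite -cint_cst // -cintD //; apply: eq_cint => t _.
  have -> : b +i* t = (a +i* t) + (b - a)%:C.
    by apply: complex_eq; rewrite ?Re_add ?Im_add ?Re_mul ?Im_mul /=; ring.
  ring.
by rewrite /rint e1 e2; ring.
Qed.

End Rectangle.

Section Goursat.
Variable R : realType.
Local Notation C := R[i].
Implicit Types (f g : C -> C) (a b c d : R) (z w : C).

Lemma cmod_eq0_small (x : C) (K e0 : R) : 0 < e0 ->
  (forall e, 0 < e < e0 -> cmod x <= K * e) -> x = 0.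
Proof.
move=> e00 H; apply/eqP; rewrite -cmod_eq0 eq_le cmod_ge0 andbT leNgt.
apply/negP => x0; have K0 : 0 < K.
  have /H : 0 < e0 / 2 < e0 by lra.
  by have [//|K0] := ltP 0 K; nra.
pose e := Num.min (e0 / 2) (cmod x / (2 * K)).
have ee : 0 < e < e0.
  apply/andP; split; last by rewrite /e gt_min; apply/orP; left; lra.
  by rewrite /e lt_min !divr_gt0 // mulr_gt0.
have := H e ee; apply/negP; rewrite -ltNge.
have : e <= cmod x / (2 * K) by rewrite /e ge_min lexx orbT.
rewrite -(ler_pM2l K0) => /le_lt_trans; apply.
have -> : K * (cmod x / (2 * K)) = cmod x / 2 by field; rewrite gt_eqF.
lra.
Qed.

Lemma rect_dist a b c d z w : rect a b c d z -> rect a b c d w ->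
  cmod (w - z) <= (b - a) + (d - c).
Proof.
move=> /andP[/andP[z1 z2] /andP[z3 z4]] /andP[/andP[w1 w2] /andP[w3 w4]].
apply: le_trans (cmod_le_ReIm _) _; rewrite Re_sub Im_sub.
by apply: lerD; rewrite ler_norml; lra.
Qed.

(** Subtracting the affine approximation at [z], whose contour integral vanishes, leaves an
    integrand of order s on a contour whose length is of order s. *)
Lemma goursat_local f z l (A B e : R) : 0 <= A -> 0 <= B -> 0 < e -> cdiff f z l ->
  exists2 r : R, 0 < r & forall x y s, 0 < s < r ->
    rect x (x + s * A) y (y + s * B) z ->
    (forall w, rect x (x + s * A) y (y + s * B) w -> ccont f w) ->
    cmod (rint f x (x + s * A) y (y + s * B)) <= e * s ^+ 2.
Proof.
move=> A0 B0 e0 Hl; pose D := A + B; have D0 : 0 <= D by rewrite /D; lra.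
(* The final bound is 4 D^2 e' s^2; the added 1 avoids a division by 0 when D = 0. *)
pose e' := e / (4 * D ^+ 2 + 1).
have den : 0 < 4 * D ^+ 2 + 1 by have := sqr_ge0 D; lra.
have e'0 : 0 < e' by rewrite divr_gt0.
have [r r0 Hr] := Hl _ e'0.
have D1 : 0 < D + 1 by lra.
exists (r / (D + 1)); first by rewrite divr_gt0.
move=> x y s /andP[s0 sr] zr fc.
have sD : s * D < r.
  by move: sr; rewrite ltr_pdivlMr //; nra.
have xx : x <= x + s * A by rewrite lerDl mulr_ge0 // ltW.
have yy : y <= y + s * B by rewrite lerDl mulr_ge0 // ltW.
pose aff w := f z + l * (w - z); pose g w := f w + -1 * aff w.
have ca w : ccont aff w.
  apply/cdable_cont; apply: cdableD; first exact: cdable_cst.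
  apply: cdableM; first exact: cdable_cst.
  by apply: cdableB; [exact: cdable_id|exact: cdable_cst].
have bf : bcont f x (x + s * A) y (y + s * B) by exact: rect_bcont.
have ba k : bcont (fun w => k * aff w) x (x + s * A) y (y + s * B).
  by apply: rect_bcont => // w _; apply: ccontM => //; exact: ccont_cst.
have bg : bcont g x (x + s * A) y (y + s * B).
  apply: rect_bcont => // w /fc fw; apply: ccontD => //.
  by apply: ccontM => //; exact: ccont_cst.
have -> : rint f x (x + s * A) y (y + s * B) = rint g x (x + s * A) y (y + s * B).
  rewrite /g rintD // rintZ; last by apply: rect_bcont.
  by rewrite rint_affine // mulr0 addr0.
have sDE : x + s * A - x + (y + s * B - y) = s * D by rewrite /D; ring.
apply: le_trans (rint_bound (M := e' * (s * D)) xx yy bg _) _.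
  move=> w /andP[wr _]; rewrite /g /aff mulN1r opprD addrA.
  have wz := rect_dist zr wr; rewrite sDE in wz.
  by apply: le_trans (Hr w (le_lt_trans wz sD)) _; rewrite ler_wpM2l // ltW.
rewrite sDE; have -> : 4 * (e' * (s * D)) * (s * D) = 4 * D ^+ 2 * e' * s ^+ 2 by ring.
rewrite ler_wpM2r ?sqr_ge0 // /e' mulrA ler_pdivrMr // mulrC ler_wpM2l // ?ltW //; lra.
Qed.

(** For each e > 0 the bound e s^2 on the integral survives quartering, because 4 e (s/2)^2 = e s^2,
    and on small rectangles it follows from differentiability at one point. *)
Theorem goursat f a b c d : a <= b -> c <= d ->
  (forall z, rect a b c d z -> cdable f z) -> rint f a b c d = 0.
Proof.
move=> ab cd H; apply: (@cmod_eq0_small _ 1 1) => // e /andP[e0 _]; rewrite mul1r.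
pose A := b - a; pose B := d - c.
have A0 : 0 <= A by rewrite /A; lra.
have B0 : 0 <= B by rewrite /B; lra.
pose P x y s := a <= x -> x + s * A <= b -> c <= y -> y + s * B <= d ->
  cmod (rint f x (x + s * A) y (y + s * B)) <= e * s ^+ 2.
have : P a c 1; last first.
  rewrite /P !mul1r expr1n mulr1 /A /B !subrKC !lexx; exact.
apply: (bisection A0 B0) => [x y s s0 h1 h2 h3 h4 ax xb cy yd|p q pa qc].
  have sA : 0 <= s / 2 * A by rewrite mulr_ge0 //; lra.
  have sB : 0 <= s / 2 * B by rewrite mulr_ge0 //; lra.
  have eA : s * A = s / 2 * A + s / 2 * A by field.
  have eB : s * B = s / 2 * B + s / 2 * B by field.
  rewrite /P in h1 h2 h3 h4; move: h1 h2 h3 h4; rewrite eA eB !addrA.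
  rewrite eA addrA in xb; rewrite eB addrA in yd.
  set m := x + s / 2 * A in xb *; set n := y + s / 2 * B in yd *.
  have xm : x <= m by rewrite lerDl.
  have yn : y <= n by rewrite lerDl.
  have mb : m <= m + s / 2 * A by rewrite lerDl.
  have nd : n <= n + s / 2 * B by rewrite lerDl.
  have hor t : c <= t -> t <= d -> hcont f x (m + s / 2 * A) t.
    move=> ct td u /andP[xu um]; apply/cdable_cont/H; rewrite /rect /= ct td andbT.
    by rewrite (le_trans ax xu) (le_trans um xb).
  have ver t : a <= t -> t <= b -> vcont f y (n + s / 2 * B) t.
    move=> ct td u /andP[xu um]; apply/cdable_cont/H; rewrite /rect /= ct td /=.
    by rewrite (le_trans cy xu) (le_trans um yd).
  have xA := le_trans xm mb; have yB := le_trans yn nd.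
  have am := le_trans ax xm; have m'b := le_trans mb xb; have x'b := le_trans xm m'b.
  have aA := le_trans am mb; have yd' := le_trans yB yd; have cB := le_trans cy yB.
  move=> h1 h2 h3 h4.
  rewrite (@rint_splitx _ f x m); [|by apply/andP; split|exact: hor|exact: hor].
  rewrite (@rint_splity _ f x m y n); [|by apply/andP; split|exact: ver|exact: ver].
  rewrite (@rint_splity _ f m _ y n); [|by apply/andP; split|exact: ver|exact: ver].
  have {}h1 := h1 ax (le_trans mb xb) cy (le_trans nd yd).
  have {}h2 := h2 (le_trans ax xm) xb cy (le_trans nd yd).
  have {}h3 := h3 ax (le_trans mb xb) (le_trans cy yn) yd.
  have {}h4 := h4 (le_trans ax xm) xb (le_trans cy yn) yd.
  have -> : e * s ^+ 2 = 2 * (e * (s / 2) ^+ 2) + 2 * (e * (s / 2) ^+ 2) by field.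
  rewrite !mulr2n !mulrDl !mul1r.
  apply: le_trans (cmodD _ _) _; apply: lerD; apply: le_trans (cmodD _ _) _.
    exact: (lerD h1 h3).
  exact: (lerD h2 h4).
have [l Hl] : cdable f (p +i* q).
  by apply: H; rewrite /rect /=; rewrite /A /B in pa qc; lra.
have [r r0 Hr] := goursat_local A0 B0 e0 Hl; exists r => // x y s sr px qy ax xb cy yd.
apply: Hr => //; first by rewrite /rect /= px qy.
move=> w /andP[w1 w2]; apply/cdable_cont/H; rewrite /rect; lra.
Qed.

(** The frame between the two contours is cut into four rectangles, on each of which Goursat's
    theorem applies. *)
Lemma rint_frame f a b c d a' b' c' d' :
  a <= a' -> a' <= b' -> b' <= b -> c <= c' -> c' <= d' -> d' <= d ->
  (forall z, rect a b c d z -> ~~ ((a' < Re z < b') && (c' < Im z < d')) -> cdable f z) ->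
  rint f a b c d = rint f a' b' c' d'.
Proof.
move=> aa ab bb cc cd dd H.
have hor t u v : a <= u -> v <= b -> c <= t <= d -> (t <= c') || (d' <= t) -> hcont f u v t.
  move=> au vb tcd tt s suv; apply/cdable_cont/H; rewrite /rect /=; first lra.
  by rewrite !negb_and -!leNgt; lra.
have ver t u v : c <= u -> v <= d -> a <= t <= b -> (t <= a') || (b' <= t) -> vcont f u v t.
  move=> au vb tcd tt s suv; apply/cdable_cont/H; rewrite /rect /=; first lra.
  by rewrite !negb_and -!leNgt; lra.
have g0 u v s t : a <= u -> u <= v -> v <= b -> c <= s -> s <= t -> t <= d ->
    [|| v <= a', b' <= u, t <= c' | d' <= s] -> rint f u v s t = 0.
  move=> h1 h2 h3 h4 h5 h6 h7; apply: goursat => // z; rewrite /rect => hz.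
  by apply: H; rewrite ?negb_and -?leNgt /rect; lra.
rewrite (@rint_splitx _ f a a'); [|lra|apply: hor; lra|apply: hor; lra].
rewrite (@rint_splitx _ f a' b'); [|lra|apply: hor; lra|apply: hor; lra].
rewrite (@rint_splity _ f a' b' c c'); [|lra|apply: ver; lra|apply: ver; lra].
rewrite (@rint_splity _ f a' b' c' d'); [|lra|apply: ver; lra|apply: ver; lra].
rewrite (g0 a a'); [|lra..]. rewrite (g0 b' b); [|lra..].
rewrite (g0 _ _ c c'); [|lra..]. rewrite (g0 _ _ d' d); [|lra..].
by rewrite !addr0 !add0r.
Qed.

End Goursat.

(** * Cauchy's formula and Taylor expansions *)

Section Cauchy.
Variable R : realType.
Local Notation C := R[i].
Implicit Types (f g : C -> C) (a b c d : R) (z w : C).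

(** The contour shrinks to any small square centred at [z], the only point where differentiability
    may fail. *)
Lemma square_frame f a b c d z r0 : a < Re z < b -> c < Im z < d -> 0 < r0 ->
  (forall w, rect a b c d w -> w != z -> cdable f w) ->
  exists2 r1 : R, 0 < r1 & forall r, 0 < r < r1 ->
    [/\ r < r0, rint f a b c d = rint f (Re z - r) (Re z + r) (Im z - r) (Im z + r) &
    forall w, rect (Re z - r) (Re z + r) (Im z - r) (Im z + r) w -> rect a b c d w].
Proof.
move=> /andP[az zb] /andP[cz zd] r00 H.
pose r1 := Num.min r0 (Num.min (Num.min (Re z - a) (b - Re z)) (Num.min (Im z - c) (d - Im z))).
exists r1; first by rewrite !lt_min !subr_gt0 r00 az zb cz zd.
move=> r /andP[rp]; rewrite !lt_min => /andP[rr /andP[/andP[h1 h2] /andP[h3 h4]]].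
split=> //; last by move=> w; rewrite /rect; lra.
apply: rint_frame; [lra..|] => w rw hw; apply: H => //.
by apply: contraNneq hw => ->; lra.
Qed.

Lemma cdable_subc z w : cdable (fun u => u - z) w.
Proof. by apply: cdableB; [exact: cdable_id|exact: cdable_cst]. Qed.

Lemma cdable_invsub z w : w != z -> cdable (fun u => (u - z)^-1) w.
Proof. by move=> wz; apply: cdableV; [rewrite subr_eq0|exact: cdable_subc]. Qed.

Lemma bdry_neq a b c d z w : a < Re z < b -> c < Im z < d -> bdry a b c d w -> w != z.
Proof.
move=> /andP[az zb] /andP[cz zd] /andP[_ h]; apply/eqP => e; rewrite e in h.
by move: h; rewrite gt_eqF // lt_eqF // gt_eqF // lt_eqF.
Qed.

(** The difference quotient of [f] at [z] is bounded near [z], so its integral over a square of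
    half-side e is O(e) and, by shrinking, zero. The factor 2 pi i stays in the form of an
    integral. *)
Theorem cauchy_formula f a b c d z : a < Re z < b -> c < Im z < d ->
  (forall w, rect a b c d w -> cdable f w) ->
  rint (fun w => f w * (w - z)^-1) a b c d = f z * rint (fun w => (w - z)^-1) a b c d.
Proof.
move=> zx zy H; have ab : a <= b by move: zx => /andP[]; lra.
have cd : c <= d by move: zy => /andP[]; lra.
have zr : rect a b c d z by rewrite /rect; lra.
pose k w := (f w - f z) * (w - z)^-1.
have kd w : rect a b c d w -> w != z -> cdable k w.
  move=> rw wz; apply: cdableM; last exact: cdable_invsub.
  by apply: cdableB; [exact: H|exact: cdable_cst].
have [l Hl] := H z zr; have [r r0 Hr] := Hl 1 ltr01.
have r40 : 0 < r / 4 by lra.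
have [r1 r10 Hr1] := square_frame zx zy r40 kd.
have k0 : rint k a b c d = 0.
  apply: (@cmod_eq0_small _ _ (16 * (cmod l + 1)) r1) => // e er.
  have /andP[e0 _] := er; have [er0 -> sub] := Hr1 e er.
  pose sq w := bdry (Re z - e) (Re z + e) (Im z - e) (Im z + e) w.
  have bz w : sq w -> w != z by apply: bdry_neq; lra.
  have sz : rect (Re z - e) (Re z + e) (Im z - e) (Im z + e) z by rewrite /rect; lra.
  have wd w : sq w -> cmod (w - z) < r.
    by move=> /andP[rw _]; have := rect_dist sz rw; lra.
  have kb w : sq w -> cmod (k w) <= cmod l + 1.
    move=> sw; have wz := bz w sw; have := Hr w (wd w sw); rewrite mul1r => h.
    have w0 : 0 < cmod (w - z) by rewrite cmod_gt0 subr_eq0.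
    rewrite cmodM cmodV ler_pdivrMr //.
    by have := cmod_subl (f w - f z) (l * (w - z)); rewrite cmodM; lra.
  have -> : 16 * (cmod l + 1) * e =
    4 * (cmod l + 1) * ((Re z + e - (Re z - e)) + (Im z + e - (Im z - e))) by ring.
  apply: rint_bound => //; [lra|lra|].
  apply: bdry_bcont; [lra|lra|] => w sw; have wz := bz w sw.
  by apply/cdable_cont/kd => //; apply: sub; case/andP: sw.
have bi : bcont (fun w => (w - z)^-1) a b c d.
  by apply: bdry_bcont => // w /(bdry_neq zx zy) wz; apply/cdable_cont/cdable_invsub.
have bk : bcont k a b c d.
  apply: bdry_bcont => // w bw; apply/cdable_cont/kd; first by case/andP: bw.
  exact: bdry_neq bw.
have -> : (fun w => f w * (w - z)^-1) = (fun w => k w + f z * (w - z)^-1).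
  by apply/funext => w; rewrite /k mulrBl subrK.
rewrite -[RHS]add0r -k0 -rintZ // -rintD //; last first.
  apply: bdry_bcont => // w bw; apply/cdable_cont/cdableM; first exact: cdable_cst.
  apply: cdable_invsub; exact: bdry_neq bw.
Qed.

Lemma rcontD (f g : R -> C) t : rcont f t -> rcont g t -> rcont (fun s => f s + g s) t.
Proof.
move=> Hf Hg e e0; have e20 : 0 < e / 2 by lra.
have [d d0 Hd] := Hf _ e20; have [d' d'0 Hd'] := Hg _ e20.
exists (Num.min d d'); first by rewrite lt_min d0.
move=> w; rewrite lt_min => /andP[/Hd h1 /Hd' h2].
have -> : f w + g w - (f t + g t) = (f w - f t) + (g w - g t) by ring.
by have := cmodD (f w - f t) (g w - g t); lra.
Qed.

Lemma rcontN (f : R -> C) t : rcont f t -> rcont (fun s => - f s) t.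
Proof.
by move=> H e /H[d d0 Hd]; exists d => // s /Hd; rewrite -opprD cmodN.
Qed.

Lemma rcontZ (k : C) (f : R -> C) t : rcont f t -> rcont (fun s => k * f s) t.
Proof.
move=> H e e0; have k0 := cmod_ge0 k; have [|d d0 Hd] := H (e / (cmod k + 1)).
  by rewrite divr_gt0 //; lra.
exists d => // s /Hd; rewrite ltr_pdivlMr; last by lra.
rewrite -mulrBr cmodM; have := cmod_ge0 (f s - f t).
by set q := cmod _ => q0; nra.
Qed.

Lemma rcont_cst (k : C) t : rcont (fun=> k) t.
Proof. by move=> e e0; exists 1 => // s _; rewrite subrr cmod0. Qed.

Lemma invcE (x y : R) :
  (x +i* y)^-1 = (x / (x ^+ 2 + y ^+ 2)) +i* (- (y / (x ^+ 2 + y ^+ 2))) :> C.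
Proof. by []. Qed.

(** The values of [u] lie between i/e and 2i/e on an interval of length 2e. Replacing them by the
    middle value 3i/(2e) gives 3i; the error is at most 2 * (1/(2e)) * 2e = 2. The true integral is
    pi i. *)
Lemma winding_side (u : R -> C) (p e : R) : 0 < e -> rcont_on u (p - e) (p + e) ->
  (forall t, u t = 0 +i* (2 * e / ((t - p) ^+ 2 + e ^+ 2))) ->
  cmod (cint u (p - e) (p + e) - 'i * 3%:R) <= 2.
Proof.
move=> e0 cu uE; pose k : C := 0 +i* (3 / (2 * e)).
pose v t := u t - k.
have ab : p - e <= p + e by lra.
have cv : rcont_on v (p - e) (p + e).
  by move=> t /cu ct; apply: rcontD => //; exact: rcont_cst.
have -> : cint u (p - e) (p + e) = cint v (p - e) (p + e) + k * (p + e - (p - e))%:C.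
  rewrite -cint_cst // -cintD //; last by move=> t _; exact: rcont_cst.
  by apply: eq_cint => t _; rewrite /v subrK.
have -> : k * (p + e - (p - e))%:C = 'i * 3%:R.
  have -> : 3%:R = 3%:R%:C :> C by rewrite rmorph_nat.
  apply: complex_eq; rewrite ?Re_mul ?Im_mul /=; field; by rewrite gt_eqF.
rewrite addrK.
have -> : (2 : R) = 2 * (1 / (2 * e)) * (p + e - (p - e)) by field; rewrite gt_eqF.
apply: cint_bound => // t te.
have -> : v t = 'i * ((2 * e / ((t - p) ^+ 2 + e ^+ 2)) - 3 / (2 * e))%:C.
  by rewrite /v uE; apply: complex_eq; rewrite ?Re_sub ?Im_sub ?Re_mul ?Im_mul /=; ring.
rewrite cmodM cmod_i mul1r cmod_real.
set s := t - p; have se : - e <= s <= e by rewrite /s; lra.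
have s2 : s ^+ 2 <= e ^+ 2 by nra.
have e2 : 0 < e ^+ 2 by rewrite exprn_gt0.
have s20 : 0 <= s ^+ 2 by rewrite sqr_ge0.
have n0 : 0 < s ^+ 2 + e ^+ 2 by lra.
have -> : 2 * e / (s ^+ 2 + e ^+ 2) - 3 / (2 * e) =
    (e ^+ 2 - 3 * s ^+ 2) / (2 * e * (s ^+ 2 + e ^+ 2)).
  by field; rewrite !gt_eqF.
rewrite normrM normfV (gtr0_norm (x := 2 * e * _)) ?mulr_gt0 //.
rewrite ler_pdivrMr ?mulr_gt0 //.
have -> : 1 / (2 * e) * (2 * e * (s ^+ 2 + e ^+ 2)) = s ^+ 2 + e ^+ 2 by field; rewrite gt_eqF.
by rewrite ler_norml; lra.
Qed.

(** Each pair of opposite sides merges into one integral within 2 of 3i, so the total has modulus at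
    least 6 - 4. *)
Lemma winding_square z e : 0 < e ->
  2 <= cmod (rint (fun w => (w - z)^-1) (Re z - e) (Re z + e) (Im z - e) (Im z + e)).
Proof.
move=> e0; set I := rint _ _ _ _ _.
have bi : bcont (fun w => (w - z)^-1) (Re z - e) (Re z + e) (Im z - e) (Im z + e).
  apply: bdry_bcont; [lra|lra|] => w bw; apply/cdable_cont/cdable_invsub.
  by apply: bdry_neq bw; lra.
case: bi => [/hcont_rcont f1 /hcont_rcont f2 /vcont_rcont f3 /vcont_rcont f4].
have sE x y : (x +i* y) - z = (x - Re z) +i* (y - Im z).
  by apply: complex_eq; rewrite ?Re_sub ?Im_sub.
have Hh : cmod (cint (fun t => ((t +i* (Im z - e)) - z)^-1 - ((t +i* (Im z + e)) - z)^-1)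
    (Re z - e) (Re z + e) - 'i * 3%:R) <= 2.
  apply: winding_side => // t; first by move=> te; apply: rcontD; [exact: f1|exact/rcontN/f2].
  rewrite !sE [Im z - e - _]addrAC [Im z + e - _]addrAC subrr !add0r !invcE.
  by apply: complex_eq; rewrite ?Re_sub ?Im_sub /= sqrrN ?subrr //; ring.
have Hv : cmod (cint (fun t => 'i * (((Re z + e) +i* t - z)^-1 - ((Re z - e) +i* t - z)^-1))
    (Im z - e) (Im z + e) - 'i * 3%:R) <= 2.
  apply: winding_side => // t.
    move=> te; apply: rcontZ; apply: rcontD; [exact: f4|exact/rcontN/f3].
  rewrite !sE [Re z - e - _]addrAC [Re z + e - _]addrAC subrr !add0r !invcE.
  apply: complex_eq; rewrite ?Re_mul ?Im_mul ?Re_sub ?Im_sub /= sqrrN.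
    ring.
  by rewrite [_ ^+ 2 + e ^+ 2]addrC; ring.
have IE : I = cint (fun t => ((t +i* (Im z - e)) - z)^-1 - ((t +i* (Im z + e)) - z)^-1)
    (Re z - e) (Re z + e) +
  cint (fun t => 'i * (((Re z + e) +i* t - z)^-1 - ((Re z - e) +i* t - z)^-1))
    (Im z - e) (Im z + e).
  have cN (g : R -> C) a b : rcont_on g a b -> cint (fun t => - g t) a b = - cint g a b.
    move=> cg; rewrite -mulN1r -cintZ //; apply: eq_cint => t _; by rewrite mulN1r.
  have rN (g : R -> C) a b : rcont_on g a b -> rcont_on (fun t => - g t) a b.
    by move=> cg t /cg; exact: rcontN.
  rewrite cintD //; last exact: rN.
  rewrite cintZ; last by move=> t te; apply: rcontD; [exact: f4|exact/rcontN/f3].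
  rewrite cintD //; last exact: rN.
  by rewrite !cN // /I /rint; ring.
rewrite IE; move: Hh Hv; set H := cint _ _ _; set V := cint _ _ _ => h v.
have -> : H + V = (H - 'i * 3%:R) + (V - 'i * 3%:R) + 'i * 6%:R by ring.
have := cmodD (H - 'i * 3%:R) (V - 'i * 3%:R); set X := _ + _ => hX.
have := cmod_addl ('i * 6%:R) X; rewrite ['i * 6%:R + X]addrC cmodM cmod_i mul1r.
have -> : 6%:R = 6%:R%:C :> C by rewrite rmorph_nat.
rewrite cmod_real ger0_norm //; lra.
Qed.

Lemma winding_ge2 a b c d z : a < Re z < b -> c < Im z < d ->
  2 <= cmod (rint (fun w => (w - z)^-1) a b c d).
Proof.
move=> zx zy; have [|r r0 Hr] := square_frame (f := fun w => (w - z)^-1) zx zy ltr01.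
  by move=> w _; exact: cdable_invsub.
have r2 : 0 < r / 2 < r by lra.
have [_ -> _] := Hr _ r2; apply: winding_square; lra.
Qed.

(** The difference of the two kernels is O(1/L^2) on the boundary of a square of half-side L, whose
    perimeter is O(L). The contour may be enlarged to that square, so the difference of the
    integrals is O(1/L) for all large L. *)
Lemma winding_const a b c d z z' : a < Re z < b -> c < Im z < d ->
  a < Re z' < b -> c < Im z' < d ->
  rint (fun w => (w - z)^-1) a b c d = rint (fun w => (w - z')^-1) a b c d.
Proof.
move=> zx zy zx' zy'; have ab : a <= b by move: zx => /andP[]; lra.
have cd : c <= d by move: zy => /andP[]; lra.
pose k w := (w - z)^-1 + -1 * (w - z')^-1.
have bi u : a < Re u < b -> c < Im u < d -> bcont (fun w => (w - u)^-1) a b c d.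
  move=> ux uy; apply: bdry_bcont => // w /(bdry_neq ux uy) wz.
  exact/cdable_cont/cdable_invsub.
have bi' u : a < Re u < b -> c < Im u < d -> bcont (fun w => -1 * (w - u)^-1) a b c d.
  move=> ux uy; apply: bdry_bcont => // w /(bdry_neq ux uy) wz.
  by apply/cdable_cont/cdableM; [exact: cdable_cst|exact: cdable_invsub].
suff k0 : rint k a b c d = 0.
  move: k0; rewrite /k rintD; [|exact: bi|exact: bi'].
  by rewrite rintZ ?mulN1r; [move/eqP; rewrite subr_eq0 => /eqP|exact: bi].
(* For L > 2N the square of half-side L contains the rectangle, and its boundary keeps distance at
   least L/2 from z and z'. *)
pose N := `|a| + `|b| + `|c| + `|d| + cmod z + cmod z' + 1.
have Na := normr_ge0 a; have Nb := normr_ge0 b; have Nc := normr_ge0 c.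
have Nd := normr_ge0 d; have Nz := cmod_ge0 z; have Nz' := cmod_ge0 z'.
have N0 : 0 < N by rewrite /N; lra.
apply: (@cmod_eq0_small _ _ (64 * cmod (z - z')) (1 / (2 * N))).
  by rewrite divr_gt0 // mulr_gt0.
move=> e /andP[e0 eN]; pose L := e^-1.
have L0 : 0 < L by rewrite invr_gt0.
have NL : 2 * N < L.
  by rewrite /L -[2 * N]invrK ltf_pV2 ?posrE ?invr_gt0 ?mulr_gt0 // -div1r.
have ha := ler_norm a; have ha' := ler_norm (- a); have hb := ler_norm b.
have hb' := ler_norm (- b); have hc := ler_norm c; have hc' := ler_norm (- c).
have hd := ler_norm d; have hd' := ler_norm (- d).
rewrite !normrN in ha' hb' hc' hd'.
have nz w : ~~ ((a < Re w < b) && (c < Im w < d)) -> w != z /\ w != z'.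
  by move=> hw; split; apply: contraNneq hw => ->; [rewrite zx zy|rewrite zx' zy'].
have kd w : w != z -> w != z' -> cdable k w.
  move=> wz wz'; apply: cdableD; first exact: cdable_invsub.
  by apply: cdableM; [exact: cdable_cst|exact: cdable_invsub].
have [aL bL cL dL] : [/\ - L < a, b < L, - L < c & d < L].
  by clear nz kd; rewrite /N in NL; split; lra.
have [zL z'L] : cmod z <= L / 2 /\ cmod z' <= L / 2.
  by clear nz kd; rewrite /N in NL; split; lra.
clear Na Nb Nc Nd Nz Nz' ha ha' hb hb' hc hc' hd hd' N0 NL eN; clear N.
have kb w : bdry (- L) L (- L) L w -> [/\ L / 2 <= cmod (w - z), L / 2 <= cmod (w - z') &
    ~~ ((a < Re w < b) && (c < Im w < d))].
  move=> /andP[_ bw].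
  have wL : L <= cmod w.
    case/or4P: bw => /eqP e1.
    - by apply: le_trans (Re_cmod w); rewrite e1 normrN gtr0_norm.
    - by apply: le_trans (Re_cmod w); rewrite e1 gtr0_norm.
    - by apply: le_trans (Im_cmod w); rewrite e1 normrN gtr0_norm.
    - by apply: le_trans (Im_cmod w); rewrite e1 gtr0_norm.
  have h1 := cmod_subl w z; have h2 := cmod_subl w z'.
  split; [clear h2; lra|clear h1; lra|].
  clear wL h1 h2; rewrite !negb_and -!leNgt.
  by case/or4P: bw => /eqP ->; rewrite ?(ltW aL) ?(ltW bL) ?(ltW cL) ?(ltW dL) ?orbT.
have -> : rint k a b c d = rint k (- L) L (- L) L.
  apply/esym/rint_frame; try exact: ltW; try by [].
  by move=> w _ /nz[wz wz']; exact: kd.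
have -> : 64 * cmod (z - z') * e =
    4 * (cmod (z - z') * (4 / L ^+ 2)) * ((L - - L) + (L - - L)).
  by rewrite /L; field; rewrite gt_eqF.
have LL : - L <= L by clear -L0; lra.
apply: rint_bound => //.
  apply: bdry_bcont => // w /kb[_ _ /nz[wz wz']]; apply/cdable_cont; exact: kd.
move=> w /kb[h1 h2 /nz[wz wz']].
have -> : k w = (z - z') * ((w - z)^-1 * (w - z')^-1).
  by rewrite /k; field; rewrite !subr_eq0 wz wz'.
rewrite cmodM ler_wpM2l ?cmod_ge0 // cmodM !cmodV.
have -> : 4 / L ^+ 2 = (L / 2)^-1 * (L / 2)^-1 by field; rewrite gt_eqF.
have L20 : 0 < L / 2 by clear -L0; lra.
have p1 := lt_le_trans L20 h1; have p2 := lt_le_trans L20 h2.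
by apply: ler_pM; rewrite ?invr_ge0 ?cmod_ge0 // lef_pV2 ?posrE.
Qed.

Lemma eq_rint f g a b c d : a <= b -> c <= d -> (forall w, bdry a b c d w -> f w = g w) ->
  rint f a b c d = rint g a b c d.
Proof.
move=> ab cd H; rewrite /rint.
by congr (_ - _ + 'i * _ - 'i * _); apply: eq_cint => t te; apply: H;
  rewrite /bdry /rect /= te ?lexx ?ab ?cd ?eqxx ?orbT.
Qed.

Section Taylor.
Variables (f : C -> C) (z0 : C) (r M : R).
Hypotheses (r0 : 0 < r) (fd : forall z, cmod (z - z0) <= 2 * r -> cdable f z).
Hypothesis fM : forall z, r <= cmod (z - z0) <= 2 * r -> cmod (f z) <= M.

Let x1 := Re z0 - r. Let x2 := Re z0 + r.
Let y1 := Im z0 - r. Let y2 := Im z0 + r.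
(** The contour is the square of half-side r about [z0]; it lies in the annulus where [f] is bounded
    by [M]. [W] is 2 pi i, [a j] is the Taylor coefficient, and [Rem n] is the integral in Cauchy's
    remainder. *)
Let W := rint (fun w => (w - z0)^-1) x1 x2 y1 y2.
Let a j := W^-1 * rint (fun w => f w * (w - z0) ^- j.+1) x1 x2 y1 y2.
Let Rem n z := rint (fun w => f w * (w - z0) ^- n * (w - z)^-1) x1 x2 y1 y2.

Let x12 : x1 <= x2. Proof. by rewrite /x1 /x2; have := r0; lra. Qed.
Let y12 : y1 <= y2. Proof. by rewrite /y1 /y2; have := r0; lra. Qed.

Let rect2r w : rect x1 x2 y1 y2 w -> cmod (w - z0) <= 2 * r.
Proof.
move=> /andP[h1 h2]; apply: le_trans (cmod_le_ReIm _) _; rewrite Re_sub Im_sub.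
have -> : 2 * r = r + r by ring.
by rewrite /x1 /x2 in h1; rewrite /y1 /y2 in h2; apply: lerD; rewrite ler_norml; lra.
Qed.

Let bdryr w : bdry x1 x2 y1 y2 w -> r <= cmod (w - z0).
Proof.
move=> /andP[_]; have hr := Re_cmod (w - z0); have hi := Im_cmod (w - z0).
rewrite Re_sub Im_sub in hr hi.
by case/or4P => /eqP e; rewrite e /x1 /x2 /y1 /y2 in hr hi;
  [apply: le_trans hr|apply: le_trans hr|apply: le_trans hi|apply: le_trans hi];
  rewrite addrAC subrr add0r ?normrN gtr0_norm.
Qed.

Let inside z : cmod (z - z0) <= r / 2 -> x1 < Re z < x2 /\ y1 < Im z < y2.
Proof.
move=> zr; have := le_trans (Re_cmod (z - z0)) zr; have := le_trans (Im_cmod (z - z0)) zr.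
by have := r0; rewrite Re_sub Im_sub !ler_norml /x1 /x2 /y1 /y2; lra.
Qed.

Let z0in : cmod (z0 - z0) <= r / 2.
Proof. by rewrite subrr cmod0; have := r0; lra. Qed.

Let bnz z w : cmod (z - z0) <= r / 2 -> bdry x1 x2 y1 y2 w -> w != z.
Proof. by move=> /inside[h1 h2]; exact: bdry_neq. Qed.

Let cdf w : bdry x1 x2 y1 y2 w -> cdable f w.
Proof. by move=> /andP[/rect2r h _]; exact: fd. Qed.

Let cdpow n w : bdry x1 x2 y1 y2 w -> cdable (fun w => f w * (w - z0) ^- n) w.
Proof.
move=> bw; apply: cdableM; first exact: cdf.
apply: cdableV; first by rewrite expf_neq0 // subr_eq0 (bnz z0in).
by apply: cdableX; exact: cdable_subc.
Qed.

Let bcpow n : bcont (fun w => f w * (w - z0) ^- n) x1 x2 y1 y2.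
Proof. by apply: bdry_bcont => // w bw; apply/cdable_cont/cdpow. Qed.

Let bcrem n z : cmod (z - z0) <= r / 2 ->
  bcont (fun w => f w * (w - z0) ^- n * (w - z)^-1) x1 x2 y1 y2.
Proof.
move=> zr; apply: bdry_bcont => // w bw; apply/cdable_cont/cdableM; first exact: cdpow.
by apply: cdable_invsub; exact: bnz bw.
Qed.

(** One step of the geometric expansion of 1/(w - z) in powers of (z - z0)/(w - z0). *)
Let Rem_step n z : cmod (z - z0) <= r / 2 ->
  Rem n z = W * a n + (z - z0) * Rem n.+1 z.
Proof.
move=> zr; have W0 : W != 0.
  by have [h1 h2] := inside z0in; rewrite -cmod_gt0; have := winding_ge2 h1 h2; rewrite -/W; lra.
rewrite /a mulrA divff // mul1r /Rem -rintZ; last exact: bcrem.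
rewrite -rintD //; last first.
  apply: bdry_bcont => // w bw; apply/cdable_cont/cdableM; first exact: cdable_cst.
  apply: cdableM; first exact: cdpow.
  by apply: cdable_invsub; exact: bnz bw.
apply: eq_rint => // w bw; have wz := bnz zr bw; have wz0 := bnz z0in bw.
have h : (w - z)^-1 = (w - z0)^-1 + (z - z0) * ((w - z0)^-1 * (w - z)^-1).
  by field; rewrite !subr_eq0 wz wz0.
by rewrite {1}h exprS invfM; ring.
Qed.

(** On the contour |w - z0| >= r and |w - z| >= r/2, so the remainder integral is at most 4 M r^-n
    (2/r) 4r = 32 M r^-n; division by |W| >= 2 leaves 16 M. The case n = 0 already bounds [f] inside
    by its size on the annulus. *)
Theorem taylor : exists a : nat -> C, forall n z, cmod (z - z0) <= r / 2 ->
  cmod (f z - \sum_(j < n) a j * (z - z0) ^+ j) <= 16 * M * (cmod (z - z0) / r) ^+ n.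
Proof.
exists a => n z zr; have [h1 h2] := inside zr; have [h01 h02] := inside z0in.
have W2 : 2 <= cmod W by exact: winding_ge2.
have W0 : W != 0 by rewrite -cmod_gt0; lra.
have e1 : f z * W = Rem 0 z.
  rewrite /W (winding_const h01 h02 h1 h2) -cauchy_formula //.
    by apply: eq_rint => // w _; rewrite expr0 invr1 mulr1.
  by move=> w /rect2r; exact: fd.
have e2 : f z * W = W * (\sum_(j < n) a j * (z - z0) ^+ j) + (z - z0) ^+ n * Rem n z.
  rewrite e1; elim: n => [|n IH]; first by rewrite big_ord0 mulr0 add0r expr0 mul1r.
  by rewrite IH big_ord_recr /= Rem_step // exprSr; ring.
have -> : f z - \sum_(j < n) a j * (z - z0) ^+ j = W^-1 * ((z - z0) ^+ n * Rem n z).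
  apply: (mulIf W0); rewrite mulrBl e2 [RHS]mulrAC mulVf // mul1r; ring.
have rn0 : 0 < r ^+ n by rewrite exprn_gt0.
have RM : cmod (Rem n z) <= 4 * (M * (r ^- n * (r / 2)^-1)) * ((x2 - x1) + (y2 - y1)).
  apply: rint_bound => //; first exact: bcrem.
  move=> w bw; have br := bdryr bw.
  have wd : cmod (w - z0) <= 2 * r by case/andP: bw => /rect2r.
  have wz : r / 2 <= cmod (w - z).
    by have := cmod_tri z w z0; lra.
  have r20 : 0 < r / 2 by have := r0; lra.
  have fw : cmod (f w) <= M by apply: fM; rewrite br wd.
  rewrite -mulrA !cmodM !cmodV cmodX.
  apply: ler_pM => //; rewrite ?cmod_ge0 ?mulr_ge0 ?invr_ge0 ?exprn_ge0 ?cmod_ge0 //.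
  apply: ler_pM; rewrite ?invr_ge0 ?exprn_ge0 ?cmod_ge0 //.
    rewrite lef_pV2 ?posrE //; first by rewrite lerXn2r ?nnegrE ?cmod_ge0 // ltW.
    by rewrite exprn_gt0 //; apply: lt_le_trans br.
  by rewrite lef_pV2 ?posrE //; apply: lt_le_trans wz.
have E : 4 * (M * (r ^- n * (r / 2)^-1)) * (x2 - x1 + (y2 - y1)) = 32 * M * r ^- n.
  by rewrite /x1 /x2 /y1 /y2; field; rewrite !gt_eqF.
rewrite {}E in RM.
rewrite !cmodM cmodV cmodX expr_div_n.
have zn : 0 <= cmod (z - z0) ^+ n by rewrite exprn_ge0 ?cmod_ge0.
have Wi : (cmod W)^-1 <= 2^-1 by rewrite lef_pV2 ?posrE //; lra.
have -> : 16 * M * (cmod (z - z0) ^+ n / r ^+ n) =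
   2^-1 * (cmod (z - z0) ^+ n * (32 * M * r ^- n)) by field; rewrite gt_eqF.
apply: ler_pM => //; rewrite ?invr_ge0 ?cmod_ge0 ?mulr_ge0 ?cmod_ge0 //.
by rewrite ler_wpM2l.
Qed.

End Taylor.
End Cauchy.

(** * Compactness in the plane; zeros of holomorphic functions *)

Section Compactness.
Variable R : realType.
Local Notation C := R[i].
Implicit Types (f g : C -> C) (z w : C) (K A B : set C).

Definition cbounded K := exists M : R, forall z, K z -> cmod z <= M.

(** Compactness as an induction principle: a property of sets that is hereditary and passes to
    finite unions holds for [K] once it holds near each point of [K]. A square containing [K] is
    subdivided; around a point off [K] small squares miss [K], which is closed, and fall under
    [Q set0]. *)
Lemma compact_ind K (Q : set C -> Prop) : closed K -> cbounded K ->
  Q set0 -> (forall A B, A `<=` B -> Q B -> Q A) ->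
  (forall A B, Q A -> Q B -> Q (A `|` B)) ->
  (forall z, K z -> exists2 e : R, 0 < e & Q [set w | cmod (w - z) < e]) -> Q K.
Proof.
move=> cK [M0 HM0] Q0 Qmono QU Qloc.
pose M := Num.max M0 0; have M_ge0 : 0 <= M by rewrite le_max lexx orbT.
have HM z : K z -> cmod z <= M by move=> /HM0 h; rewrite le_max h.
pose P (x y s : R) := Q (K `&` [set w | rect x (x + s * (2 * M)) y (y + s * (2 * M)) w]).
suff : P (- M) (- M) 1.
  apply: Qmono => z Kz; split=> //=; rewrite /rect mul1r.
  have h := HM z Kz; have := le_trans (Re_cmod z) h; have := le_trans (Im_cmod z) h.
  by rewrite !ler_norml; lra.
have M2 : 0 <= 2 * M by lra.
apply: (bisection M2 M2) => [x y s s0 h1 h2 h3 h4|p q _ _].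
  apply: Qmono (QU _ _ (QU _ _ h1 h2) (QU _ _ h3 h4)) => w [Kw /=] hw.
  have e : s * (2 * M) = s / 2 * (2 * M) + s / 2 * (2 * M) by field.
  move: hw; rewrite e /rect; set u := s / 2 * (2 * M) => hw.
  have [hx|hx] := leP (Re w) (x + u); have [hy|hy] := leP (Im w) (y + u).
  - by left; left; split=> //=; rewrite /rect; lra.
  - by right; left; split=> //=; rewrite /rect; lra.
  - by left; right; split=> //=; rewrite /rect; lra.
  - by right; right; split=> //=; rewrite /rect; lra.
have small (e : R) : 0 < e -> exists2 d : R, 0 < d & forall x y s, 0 < s < d ->
    x <= p <= x + s * (2 * M) -> y <= q <= y + s * (2 * M) ->
    forall w, rect x (x + s * (2 * M)) y (y + s * (2 * M)) w -> cmod (w - (p +i* q)) < e.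
  move=> e0; exists (e / (4 * M + 1)); first by rewrite divr_gt0 //; lra.
  move=> x y s /andP[s0]; rewrite ltr_pdivlMr; last by lra.
  move=> se hx hy w rw.
  have rp : rect x (x + s * (2 * M)) y (y + s * (2 * M)) (p +i* q) by rewrite /rect /= hx hy.
  have := rect_dist rp rw; lra.
have [Kz|nK] := pselect (K (p +i* q)).
  have [e e0 Qe] := Qloc _ Kz; have [d d0 Hd] := small e e0.
  by exists d => // x y s sd hx hy; apply: Qmono Qe => w [_ /=]; exact: Hd.
have oK : open (~` K) by exact: closed_openC.
have [e e0 He] := (openCP (~` K)).1 oK _ nK; have [d d0 Hd] := small e e0.
exists d => // x y s sd hx hy; apply: Qmono Q0 => w [Kw /=].
by move/(Hd x y s sd hx hy)/He; exact.
Qed.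

Lemma compact_bound K f : closed K -> cbounded K -> (forall z, K z -> ccont f z) ->
  exists2 M : R, 0 <= M & forall z, K z -> cmod (f z) <= M.
Proof.
move=> cK bK fc.
apply: (compact_ind (Q := fun A => exists2 M : R, 0 <= M & forall z, A z -> cmod (f z) <= M) cK bK).
- by exists 0.
- by move=> A B AB [M M0 H]; exists M => // z /AB/H.
- move=> A B [M M0 H] [N N0 H']; exists (M + N); first lra.
  by move=> z [/H|/H']; lra.
- move=> z /fc /(_ 1 ltr01)[d d0 Hd]; exists d => //.
  exists (cmod (f z) + 1); first by have := cmod_ge0 (f z); lra.
  by move=> w /Hd h; have := cmod_subl (f w) (f z); lra.
Qed.

Lemma compact_max K f : K !=set0 -> closed K -> cbounded K -> (forall z, K z -> ccont f z) ->
  exists2 z, K z & forall w, K w -> cmod (f w) <= cmod (f z).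
Proof.
move=> [k0 Kk0] cK bK fc; apply: contrapT => nmax.
have [M M0 HM] := compact_bound cK bK fc.
pose E := [set cmod (f z) | z in K]; pose S := sup E.
have hE : has_sup E.
  by split; [exists (cmod (f k0)); exists k0|exists M => _ [z Kz <-]; exact: HM].
have leS z : K z -> cmod (f z) <= S.
  by move=> Kz; apply: ub_le_sup; [exact: hE.2|exists z].
have ltS z : K z -> cmod (f z) < S.
  move=> Kz; rewrite lt_def leS // andbT; apply/eqP => SE; apply: nmax.
  by exists z => // w Kw; rewrite -SE leS.
(* A maximum that is not attained is refuted by the local bounds t < S, which combine over a finite
   cover. The premise [K w] is doubled because the property of a set [A] inducted on is restricted
   to points of [K], and here [A] is [K]. *)
have : exists2 t : R, t < S & forall w, K w -> K w -> cmod (f w) <= t.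
  apply: (compact_ind (Q := fun A => exists2 t : R, t < S &
    forall w, A w -> K w -> cmod (f w) <= t) cK bK).
  - by exists (S - 1); first lra.
  - by move=> A B AB [t tS H]; exists t => // w /AB/H.
  - move=> A B [t tS H] [u uS H']; exists (Num.max t u); first by rewrite gt_max tS uS.
    by move=> w [/H h|/H' h] /h h'; rewrite le_max h' ?orbT.
  - move=> z Kz; have zS := ltS z Kz; have e0 : 0 < (S - cmod (f z)) / 2 by lra.
    have [d d0 Hd] := fc z Kz _ e0; exists d => //.
    exists ((S + cmod (f z)) / 2); first lra.
    by move=> w /Hd h _; have := cmod_subl (f w) (f z); lra.
move=> [t tS Ht]; have : S <= t.
  by apply: ge_sup; [exact: hE.1|move=> _ [w Kw <-]; exact: Ht].
lra.
Qed.

Lemma closed_ball_closed z0 (r : R) : closed [set z : C | cmod (z - z0) <= r].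
Proof.
apply/closedCP => z H /=; rewrite leNgt; apply/negP => zr.
have e0 : 0 < cmod (z - z0) - r by lra.
have [w /= wr wz] := H _ e0; have := cmod_tri w z z0; rewrite (cmodBC z w); lra.
Qed.

Lemma closed_ball_bounded z0 (r : R) : cbounded [set z : C | cmod (z - z0) <= r].
Proof. by exists (r + cmod z0) => z /= h; have := cmod_subl z z0; lra. Qed.

End Compactness.

Section LocalTheory.
Variable R : realType.
Local Notation C := R[i].
Implicit Types (f g h : C -> C) (z w l : C) (r M : R).

Lemma hol_bounded f z0 r : (forall z, cmod (z - z0) <= r -> cdable f z) ->
  exists2 M : R, 0 <= M & forall z, cmod (z - z0) <= r -> cmod (f z) <= M.
Proof.
move=> fd; apply: compact_bound; [exact: closed_ball_closed|exact: closed_ball_bounded|].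
by move=> z /= /fd; exact: cdable_cont.
Qed.

(** The case n = 0 of [taylor]: a maximum principle with a loss of 16, enough for the open mapping
    theorem, which then gives the sharp one. *)
Lemma annulus_bound f z0 r M : 0 < r -> (forall z, cmod (z - z0) <= 2 * r -> cdable f z) ->
  (forall z, r <= cmod (z - z0) <= 2 * r -> cmod (f z) <= M) -> cmod (f z0) <= 16 * M.
Proof.
move=> r0 fd fM; have [a Ha] := taylor r0 fd fM.
have := Ha 0%N z0; rewrite big_ord0 subr0 expr0 mulr1; apply.
by rewrite subrr cmod0; lra.
Qed.

(** The first-order coefficient is the derivative by uniqueness. Comparing the estimates of orders 1
    and 2 at distance r/2 gives |l| r/2 <= 8 M + 4 M, hence the constant 24. *)
Lemma taylor2 f z0 l r M : 0 < r -> (forall z, cmod (z - z0) <= 2 * r -> cdable f z) ->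
  (forall z, cmod (z - z0) <= 2 * r -> cmod (f z) <= M) -> cdiff f z0 l ->
  cmod l <= 24 * M / r /\
  forall z, cmod (z - z0) <= r / 2 ->
    cmod (f z - f z0 - l * (z - z0)) <= 16 * M * (cmod (z - z0) / r) ^+ 2.
Proof.
move=> r0 fd fM fl; have [|a Ha] := taylor r0 fd (M := M).
  by move=> z /andP[_]; exact: fM.
have r20 : 0 < r / 2 by lra.
have a0 : f z0 = a 0%N.
  apply/eqP; rewrite -subr_eq0 -cmod_eq0 eq_le cmod_ge0 andbT.
  have := Ha 1%N z0; rewrite big_ord_recr big_ord0 /= add0r expr0 mulr1 subrr cmod0.
  by rewrite mul0r expr1 mulr0; apply; lra.
have H2 z : cmod (z - z0) <= r / 2 ->
    cmod (f z - f z0 - a 1%N * (z - z0)) <= 16 * M * (cmod (z - z0) / r) ^+ 2.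
  move=> zr; have := Ha 2%N z zr; rewrite !big_ord_recr big_ord0 /= add0r expr0 mulr1.
  by rewrite expr1 a0 opprD addrA.
have M0 : 0 <= M.
  by have := fM z0; rewrite subrr cmod0 => /(_ _)/(le_trans (cmod_ge0 _)); apply; lra.
have -> : l = a 1%N.
  apply: cdiff_unique fl _ => e e0; pose K := 16 * M / r ^+ 2 + 1.
  have K0 : 0 < K.
    by rewrite /K ltr_wpDl // divr_ge0 ?mulr_ge0 ?exprn_ge0 ?(ltW r0) //; lra.
  exists (Num.min (r / 2) (e / K)); first by rewrite lt_min r20 divr_gt0.
  move=> z; rewrite lt_min => /andP[/ltW z1 z2]; apply: le_trans (H2 z z1) _.
  rewrite ltr_pdivlMr // in z2; rewrite expr_div_n.
  have -> : 16 * M * (cmod (z - z0) ^+ 2 / r ^+ 2) =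
    cmod (z - z0) * (16 * M / r ^+ 2) * cmod (z - z0) by field; rewrite gt_eqF.
  apply: ler_wpM2r; first exact: cmod_ge0.
  apply: le_trans (ltW z2); apply: ler_wpM2l; first exact: cmod_ge0.
  by rewrite /K lerDl.
split=> //; pose z := z0 + (r / 2)%:C.
have zE : z - z0 = (r / 2)%:C by rewrite /z addrC addKr.
have zr : cmod (z - z0) = r / 2 by rewrite zE cmod_real gtr0_norm.
have h2 := H2 z; rewrite zr lexx in h2; have {}h2 := h2 isT.
have h1 : cmod (f z - f z0) <= 16 * M * (r / 2 / r) ^+ 1.
  have := Ha 1%N z; rewrite big_ord_recr big_ord0 /= add0r expr0 mulr1 -a0 zr.
  by apply; exact: lexx.
have := cmod_subl (a 1%N * (z - z0)) (f z - f z0); rewrite (cmodBC (a 1%N * _)) cmodM zr.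
have e1 : (r / 2 / r) = 2^-1 by field; rewrite gt_eqF.
rewrite e1 in h1 h2; rewrite ler_pdivlMr // => h3.
have : cmod (a 1%N) * (r / 2) <= 16 * M * 2^-1 ^+ 1 + 16 * M * 2^-1 ^+ 2 by lra.
rewrite expr1 expr2; lra.
Qed.

Lemma pow_small (x K e : R) : 0 <= x < 1 -> 0 < e -> 0 <= K -> exists n : nat, K * x ^+ n < e.
Proof.
move=> /andP[x0 x1] e0 K0; have [->|xn0] := eqVneq x 0.
  by exists 1%N; rewrite expr1 mulr0.
have xp : 0 < x by rewrite lt_def xn0.
have Hb n : 1 + n%:R * (x^-1 - 1) <= x^-1 ^+ n.
  have y1 : 0 < x^-1 - 1 by rewrite subr_gt0 invf_gt1.
  elim: n => [|n IH]; first by rewrite mul0r expr0 addr0.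
  rewrite exprS -natr1; set y := x^-1 in y1 IH *.
  have n0 : (0 : R) <= n%:R by [].
  have : y * (1 + n%:R * (y - 1)) <= y * y ^+ n by rewrite ler_wpM2l //; lra.
  apply: le_trans; have := mulr_ge0 n0 (sqr_ge0 (y - 1)); clearbody y; rewrite expr2; lra.
have y1 : 0 < x^-1 - 1 by rewrite subr_gt0 invf_gt1.
exists (Num.truncn (K / e / (x^-1 - 1))).+1; set n := _.+1.
have hn : K / e / (x^-1 - 1) < n%:R by rewrite truncnS_gt.
rewrite ltr_pdivrMr // in hn.
have : K / e < x^-1 ^+ n by apply: lt_le_trans hn _; apply: le_trans (Hb n); rewrite lerDr ler01.
by rewrite exprVn ltr_pdivrMr // mulrC ltr_pdivlMr ?exprn_gt0.
Qed.

(** The first nonzero Taylor coefficient [a m] dominates the remainder near [z0], and half its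
    modulus serves as [c]. If there is none, the remainder bounds tend to 0 on the small disc. *)
Lemma zero_order f z0 r : 0 < r -> (forall z, cmod (z - z0) <= 2 * r -> cdable f z) ->
  (forall z, cmod (z - z0) <= r / 4 -> f z = 0) \/
  exists m : nat, exists2 c : R, 0 < c & exists2 d : R, 0 < d &
    forall z, cmod (z - z0) < d -> c * cmod (z - z0) ^+ m <= cmod (f z).
Proof.
move=> r0 fd; have [M M0 HM] := hol_bounded fd.
have [|a Ha] := taylor r0 fd (M := M); first by move=> z /andP[_]; exact: HM.
have [a0|/existsNP[m0 /eqP am0]] := pselect (forall n, a n = 0).
  left=> z zr; apply: (@cmod_eq0_small _ _ 1 1) => // e /andP[e0 _]; rewrite mul1r.
  rewrite leNgt; apply/negP => h.
  have h12 : 0 <= (2^-1 : R) < 1 by lra.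
  have M16 : 0 <= 16 * M by lra.
  have [n Hn] := pow_small h12 e0 M16.
  have zr2 : cmod (z - z0) <= r / 2 by lra.
  have := Ha n z zr2; rewrite big1 ?subr0; last by move=> i _; rewrite a0 mul0r.
  have : (cmod (z - z0) / r) ^+ n <= 2^-1 ^+ n.
    apply: lerXn2r; rewrite ?nnegrE ?divr_ge0 ?cmod_ge0 ?(ltW r0) //.
    by rewrite ler_pdivrMr //; lra.
  move=> h1 h2; have := ler_wpM2l M16 h1; lra.
right; have ex : exists n, a n != 0 by exists m0.
have [m am mmin] := ex_minnP ex.
have cm0 : 0 < cmod (a m) by rewrite cmod_gt0.
exists m; exists (cmod (a m) / 2); first lra.
pose K := 16 * M / r ^+ m.+1 + 1.
have K0 : 0 < K by rewrite /K ltr_wpDl // divr_ge0 ?exprn_ge0 ?(ltW r0) //; lra.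
exists (Num.min (r / 2) (cmod (a m) / 2 / K)).
  by rewrite lt_min !divr_gt0.
move=> z; rewrite lt_min => /andP[/ltW z1 z2]; have := Ha m.+1 z z1.
rewrite big_ord_recr /= big1 ?add0r; last first.
  move=> i _; apply/eqP; rewrite mulf_eq0; apply/orP; left; apply: contraTT (ltn_ord i).
  by move=> /mmin; rewrite -leqNgt.
have := cmod_subl (a m * (z - z0) ^+ m) (f z); rewrite (cmodBC (a m * _)) cmodM cmodX.
rewrite ltr_pdivlMr // in z2; rewrite expr_div_n => h1 h2.
set t := cmod (z - z0) in z1 z2 h1 h2 *.
have t0 : 0 <= t := cmod_ge0 _.
have tm : 0 <= t ^+ m by rewrite exprn_ge0.
have e1 : 16 * M * (t ^+ m.+1 / r ^+ m.+1) = t ^+ m * (t * (16 * M / r ^+ m.+1)).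
  by rewrite (exprSr t); field; rewrite gt_eqF ?exprn_gt0.
have : t ^+ m * (t * (16 * M / r ^+ m.+1)) <= t ^+ m * (cmod (a m) / 2).
  apply: ler_wpM2l => //; apply: le_trans (ltW z2); apply: ler_wpM2l => //.
  by rewrite /K lerDl.
rewrite -e1; lra.
Qed.

End LocalTheory.

(** * Entire functions *)

Section Entire.
Variable R : realType.
Local Notation C := R[i].
Implicit Types (f g h : C -> C) (z w l : C) (r M : R).

Definition centire f := forall z, cdable f z.

Lemma cmod_point z0 (t : R) : 0 <= t -> exists z, cmod (z - z0) = t.
Proof. by move=> t0; exists (z0 + t%:C); rewrite addrC addKr cmod_real ger0_norm. Qed.

(** The radius of the expansion about [z0] is chosen so large that the quarter disc of [zero_order]
    contains [z]; a finite order at [z0] contradicts the vanishing near [z0]. *)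
Lemma zero_global f z0 (e : R) : centire f -> 0 < e ->
  (forall z, cmod (z - z0) < e -> f z = 0) -> forall z, f z = 0.
Proof.
move=> ef e0 f0 z; have nz := cmod_ge0 (z - z0).
have r0 : 0 < 4 * (cmod (z - z0) + 1) by lra.
have [|H|[m [c c0 [d d0 H]]]] := zero_order (f := f) (z0 := z0) r0.
- by move=> w _; exact: ef.
- by apply: H; lra.
have t0 : 0 < Num.min e d / 2 by rewrite divr_gt0 // lt_min e0.
have [w wt] := cmod_point z0 (ltW t0).
have m1 : Num.min e d <= e by rewrite ge_min lexx.
have m2 : Num.min e d <= d by rewrite ge_min lexx orbT.
have := H w; rewrite wt f0 ?wt ?cmod0; last by lra.
have : 0 < c * (Num.min e d / 2) ^+ m by rewrite mulr_gt0 // exprn_gt0.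
move=> h1 h2; exfalso; have /h2 : Num.min e d / 2 < d by lra.
lra.
Qed.

Lemma entire_order f z0 : centire f -> (exists z, f z != 0) ->
  exists m : nat, exists2 c : R, 0 < c & exists2 d : R, 0 < d &
    forall z, cmod (z - z0) < d -> c * cmod (z - z0) ^+ m <= cmod (f z).
Proof.
move=> ef [z1 /eqP fz1]; have [|H|//] := zero_order (f := f) (z0 := z0) (@ltr01 R).
  by move=> w _; exact: ef.
case: fz1; apply: (zero_global (z0 := z0) (e := 1 / 4) ef) => [|z /ltW/H //]; lra.
Qed.

Lemma centireB f (k : C) : centire f -> centire (fun z => f z - k).
Proof. by move=> ef z; apply: cdableB => //; exact: cdable_cst. Qed.

Definition nonconst f := exists z w, f z != f w.

Lemma nonconst_sub f (k : C) : nonconst f -> exists z, f z - k != 0.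
Proof.
move=> [z [w zw]]; have [e|] := eqVneq (f z) k; last by exists z; rewrite subr_eq0.
by exists w; rewrite subr_eq0 -e eq_sym.
Qed.

(** If [w] were omitted, 1/(f - w) would be holomorphic near [z0]. It exceeds 17/eta at [z0] but is
    at most 17/(16 eta) on the annulus, against [annulus_bound]; the 17 in the choice of the radius
    compensates the 16 there. *)
Theorem open_mapping f z0 (e : R) : centire f -> nonconst f -> 0 < e ->
  exists2 d : R, 0 < d & forall w, cmod (w - f z0) < d -> exists2 z, cmod (z - z0) < e & f z = w.
Proof.
move=> ef nf e0; have [m [c c0 [d d0 H]]] := entire_order z0 (centireB (f z0) ef) (nonconst_sub (f z0) nf).
pose r := Num.min d e / 4.
have m0 : 0 < Num.min d e by rewrite lt_min d0.
have md : Num.min d e <= d by rewrite ge_min lexx.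
have me : Num.min d e <= e by rewrite ge_min lexx orbT.
have r0 : 0 < r by rewrite /r; lra.
have rd : 2 * r < d by rewrite /r; lra.
have re : 2 * r < e by rewrite /r; lra.
pose eta := c * r ^+ m; have eta0 : 0 < eta by rewrite mulr_gt0 // exprn_gt0.
exists (eta / 17); first lra.
move=> w we; apply: contrapT => nz.
have fw z : cmod (z - z0) <= 2 * r -> f z - w != 0.
  by move=> zr; rewrite subr_eq0; apply/eqP => fz; apply: nz; exists z => //; lra.
have : cmod (f z0 - w)^-1 <= 16 * (eta * 16 / 17)^-1; last first.
  rewrite cmodV; have w0 : 0 < cmod (f z0 - w) by rewrite cmod_gt0 fw // subrr cmod0; lra.
  have -> : 16 * (eta * 16 / 17)^-1 = (eta / 17)^-1 by field; rewrite gt_eqF.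
  rewrite lef_pV2 ?posrE //; last lra.
  by rewrite cmodBC; lra.
apply: (annulus_bound (f := fun z => (f z - w)^-1) r0).
- by move=> z zr; apply: cdableV; [exact: fw|exact: centireB].
- move=> z /andP[rz zr]; rewrite cmodV lef_pV2 ?posrE ?cmod_gt0 ?fw //; last by lra.
  have : eta <= cmod (f z - f z0).
    apply: le_trans (H z _); last lra.
    by rewrite /eta ler_pM2l // lerXn2r ?nnegrE ?cmod_ge0 // ltW.
  have := cmod_tri w (f z) (f z0); lra.
Qed.

Lemma larger_near (p : C) (d : R) : 0 < d -> exists2 w, cmod (w - p) < d & cmod p < cmod w.
Proof.
move=> d0; have [->|p0] := eqVneq p 0.
  by exists (d / 2)%:C; rewrite ?subr0 cmod_real ?cmod0 gtr0_norm //; lra.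
have P0 : 0 < cmod p by rewrite cmod_gt0.
exists (p * (1 + d / (2 * cmod p))%:C).
  have -> : p * (1 + d / (2 * cmod p))%:C - p = p * (d / (2 * cmod p))%:C.
    by rewrite rmorphD /= mulrDr mulr1 addrC addKr.
  rewrite cmodM cmod_real gtr0_norm ?divr_gt0 ?mulr_gt0 //.
  have -> : cmod p * (d / (2 * cmod p)) = d / 2 by field; rewrite gt_eqF.
  lra.
have q0 : 0 < d / (2 * cmod p) by rewrite divr_gt0 // mulr_gt0.
rewrite cmodM cmod_real gtr0_norm ?ltr_pMr ?ltrDl //; lra.
Qed.

(** For an open set this is the topological boundary. *)
Definition bd (W : set C) : set C := closure W `\` W.

Lemma closure_bounded (W : set C) : cbounded W -> cbounded (closure W).
Proof.
move=> [M HM]; exists (M + 1) => z /closureCP/(_ 1 ltr01)[w /HM wM zw].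
by have := cmod_subl z w; rewrite cmodBC; lra.
Qed.

Lemma bd_closed (W : set C) : open W -> closed (bd W).
Proof. by move=> oW; apply: closedI; [exact: closed_closure|exact: open_closedC]. Qed.

Lemma bd_bounded (W : set C) : cbounded W -> cbounded (bd W).
Proof. by move=> /closure_bounded[M HM]; exists M => z [/HM]. Qed.

Lemma bd_nonempty (W : set C) : open W -> cbounded W -> W !=set0 -> bd W !=set0.
Proof.
move=> oW bW [z Wz]; have [||||p cp pmax] := @compact_max _ (closure W) id.
- by exists z; exact: subset_closure.
- exact: closed_closure.
- exact: closure_bounded.
- by move=> w _; exact: ccont_id.
exists p; split=> // Wp; have [e e0 He] := (openCP W).1 oW p Wp.
have [w wp pw] := larger_near p e0; have := pmax w (subset_closure (He w wp)); rewrite /=; lra.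
Qed.

(** At a maximum inside [W] the open mapping theorem supplies a nearby value of larger modulus. A
    constant [f] is settled by the existence of a boundary point. *)
Theorem max_modulus f (W : set C) (e : R) : centire f -> open W -> cbounded W ->
  (forall z, bd W z -> cmod (f z) <= e) -> forall z, W z -> cmod (f z) <= e.
Proof.
move=> ef oW bW fe z Wz; have Wn : W !=set0 by exists z.
have [nf|cf] := pselect (nonconst f); last first.
  have [b bb] := bd_nonempty oW bW Wn; have -> : f z = f b; last exact: fe.
  by apply/eqP; apply: contrapT => /negP zb; apply: cf; exists z, b.
have [||||p cp pmax] := @compact_max _ (closure W) f.
- by exists z; exact: subset_closure.
- exact: closed_closure.
- exact: closure_bounded.
- by move=> w _; exact/cdable_cont.
apply: (le_trans (pmax z (subset_closure Wz))); apply: fe; split=> // Wp.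
have [d d0 Hd] := (openCP W).1 oW p Wp.
have [d' d'0 Hd'] := open_mapping p ef nf d0.
have [w wp pw] := larger_near (f p) d'0; have [u up fu] := Hd' w wp.
by have := pmax u (subset_closure (Hd u up)); rewrite fu; lra.
Qed.

(** The singularity is removable: the third-order Taylor estimate, divided by z - z0, shows that the
    quotient has derivative [a 2] at [z0]. *)
Lemma cdable_div f z0 l r : 0 < r -> (forall z, cmod (z - z0) <= 2 * r -> cdable f z) ->
  f z0 = 0 -> cdiff f z0 l -> cdable (fun z => if z == z0 then l else f z / (z - z0)) z0.
Proof.
move=> r0 fd f0 fl; have [M M0 HM] := hol_bounded fd.
have [|a Ha] := taylor r0 fd (M := M); first by move=> z /andP[_]; exact: HM.
have r20 : 0 < r / 2 by lra.
have a0 : a 0%N = 0.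
  apply/eqP; rewrite -cmod_eq0 eq_le cmod_ge0 andbT.
  have := Ha 1%N z0; rewrite big_ord_recr big_ord0 /= add0r expr0 mulr1 subrr cmod0.
  by rewrite mul0r expr1 mulr0 f0 sub0r cmodN; apply; lra.
have bnd n (e : R) : 0 < e -> exists2 d : R, 0 < d & d <= r / 2 /\
    forall t, 0 <= t < d -> 16 * M * (t / r) ^+ n.+2 <= e * t ^+ n.+1.
  move=> e0; pose K := 16 * M / r ^+ n.+2 + 1.
  have K0 : 0 < K by rewrite /K ltr_wpDl // divr_ge0 ?exprn_ge0 ?(ltW r0) //; lra.
  exists (Num.min (r / 2) (e / K)); first by rewrite lt_min r20 divr_gt0.
  split; first by rewrite ge_min lexx.
  move=> t /andP[t0]; rewrite lt_min => /andP[_]; rewrite ltr_pdivlMr // => tK.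
  rewrite expr_div_n (exprSr t n.+1).
  have -> : 16 * M * (t ^+ n.+1 * t / r ^+ n.+2) = t * (16 * M / r ^+ n.+2) * t ^+ n.+1.
    by ring.
  apply: ler_wpM2r; first exact: exprn_ge0.
  by apply: le_trans (ltW tK); apply: ler_wpM2l => //; rewrite /K lerDl.
have a1 : l = a 1%N.
  apply: cdiff_unique fl _ => e e0; have [d d0 [dr Hd]] := bnd 0%N e e0.
  exists d => // z zd; have t0 := cmod_ge0 (z - z0).
  have zr : cmod (z - z0) <= r / 2 by lra.
  have := Ha 2%N z zr; rewrite !big_ord_recr big_ord0 /= add0r a0 mul0r add0r expr1.
  rewrite f0 subr0 => /le_trans; apply.
  by have := Hd (cmod (z - z0)); rewrite expr1; apply; rewrite t0.
exists (a 2%N) => e e0; have [d d0 [dr Hd]] := bnd 1%N e e0.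
exists d => // z zd; rewrite eqxx; have [->|zz0] := eqVneq z z0.
  by rewrite !subrr mulr0 subrr cmod0 mulr0.
have t0 : 0 < cmod (z - z0) by rewrite cmod_gt0 subr_eq0.
have zr : cmod (z - z0) <= r / 2 by lra.
have := Ha 3%N z zr; rewrite !big_ord_recr big_ord0 /= add0r a0 mul0r add0r expr1 -a1.
have -> : f z / (z - z0) - l - a 2%N * (z - z0) =
  (f z - (l * (z - z0) + a 2%N * (z - z0) ^+ 2)) * (z - z0)^-1.
  by field; rewrite subr_eq0.
rewrite cmodM cmodV ler_pdivrMr // => /le_trans; apply.
by have := Hd (cmod (z - z0)); rewrite expr2 (mulrA e); apply; rewrite ltW.
Qed.

Lemma entire_div f z0 : centire f -> f z0 = 0 ->
  exists2 g, centire g & forall z, f z = (z - z0) * g z.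
Proof.
move=> ef f0; have [l fl] := ef z0.
exists (fun z => if z == z0 then l else f z / (z - z0)); last first.
  move=> z; have [->|zz0] := eqVneq; first by rewrite subrr mul0r.
  by rewrite mulrC divfK // subr_eq0.
move=> z; have [->|zz0] := eqVneq z z0; first by apply: (cdable_div (r := 1) _ _ f0 fl).
have t0 : 0 < cmod (z - z0) by rewrite cmod_gt0 subr_eq0.
apply: (@cdable_near _ (fun z => f z / (z - z0)) _ _ _ t0).
  by move=> w; have [->|//] := eqVneq w z0; rewrite cmodBC ltxx.
by apply: cdableM => //; exact: cdable_invsub.
Qed.

(** The Taylor estimate of order 1 on discs of radius 1/e bounds f z - f 0 by a multiple of e. *)
Theorem liouville f M : centire f -> (forall z, cmod (f z) <= M) -> forall z, f z = f 0.
Proof.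
move=> ef fM z; have M0 : 0 <= M := le_trans (cmod_ge0 _) (fM 0).
apply/eqP; rewrite -subr_eq0; apply/eqP; pose t := cmod z.
have t0 : 0 <= t := cmod_ge0 _.
apply: (@cmod_eq0_small _ _ (16 * M * t) (1 / (2 * t + 1))); first by rewrite divr_gt0 //; lra.
move=> e /andP[e0 et]; rewrite ltr_pdivlMr in et; last lra.
have r0 : 0 < e^-1 by rewrite invr_gt0.
have [a Ha] := @taylor _ f 0 (e^-1) M r0 (fun w _ => ef w) (fun w _ => fM w).
have zr : cmod (z - 0) <= e^-1 / 2.
  by rewrite subr0 -/t ler_pdivlMr // -div1r ler_pdivlMr //; lra.
have a0 : f 0 = a 0%N.
  apply/eqP; rewrite -subr_eq0 -cmod_eq0 eq_le cmod_ge0 andbT.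
  have := Ha 1%N 0; rewrite big_ord_recr big_ord0 /= !add0r oppr0 expr0 mulr1 cmod0.
  by rewrite mul0r expr1 mulr0; apply; lra.
have := Ha 1%N z zr; rewrite big_ord_recr big_ord0 /= add0r expr0 mulr1 subr0 -a0 expr1 invrK.
by rewrite mulrA.
Qed.

(** The quotient (f - f 0)/z is entire and its growth exponent is one less; exponent 0 is
    Liouville's theorem. *)
Theorem growth_poly m f : centire f ->
  (exists B rho : R, forall z, rho <= cmod z -> cmod (f z) <= B * cmod z ^+ m) ->
  exists p : {poly C}, forall z, f z = p.[z].
Proof.
elim: m f => [|m IH] f ef [B [rho H]].
  have [|M M0 HM] := @hol_bounded _ f 0 rho; first by move=> z _; exact: ef.
  exists (f 0)%:P => z; rewrite hornerC; apply: (liouville (M := M + `|B|) ef) => {}z.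
  have B0 := normr_ge0 B; have B1 := ler_norm B.
  have [h|h] := leP rho (cmod z); first by have := H z h; rewrite expr0 mulr1; lra.
  by have := HM z; rewrite subr0 => /(_ (ltW h)); lra.
have [||g eg Hg] := @entire_div (fun z => f z - f 0) 0; [exact: centireB|by rewrite subrr|].
have [|p Hp] := IH g eg; last first.
  exists (p * 'X + (f 0)%:P) => z; rewrite !hornerE -Hp.
  by have := Hg z; rewrite subr0 => /eqP; rewrite subr_eq => /eqP ->; rewrite [z * _]mulrC.
exists (B + cmod (f 0)), (Num.max rho 1) => z; rewrite ge_max => /andP[h1 h2].
have z0 : 0 < cmod z by lra.
have zm : 1 <= cmod z ^+ m by rewrite exprn_ege1.
have F0 := cmod_ge0 (f 0).
have e1 : cmod z * cmod (g z) = cmod (f z - f 0) by rewrite Hg subr0 cmodM.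
rewrite -(ler_pM2l z0) e1; apply: le_trans (cmodB _ _) _.
have := H z h1; rewrite exprS; have : cmod (f 0) <= cmod (f 0) * (cmod z * cmod z ^+ m).
  by rewrite ler_peMr // -[leLHS]mulr1 ler_pM.
lra.
Qed.

(** Infinity is a pole: [k w] = w^2 / f(1/w) extends by 0 to w = 0, and the factor w^2 makes it
    differentiable there since |k w| <= |w|^2. As [k] is nonzero near 0 away from 0, it has a finite
    order m, and |k w| >= c |w|^m turns into |f z| <= |z|^m / c for large z. *)
Theorem proper_poly f : centire f ->
  (forall r, exists rho : R, forall z, cmod (f z) <= r -> cmod z <= rho) ->
  exists p : {poly C}, forall z, f z = p.[z].
Proof.
move=> ef H; have [rho0 Hrho0] := H 1; pose rho := Num.max rho0 1.
have rho1 : 1 <= rho by rewrite le_max lexx orbT.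
have f1 z : rho < cmod z -> 1 < cmod (f z).
  move=> zr; rewrite ltNge; apply/negP => /Hrho0 h.
  by have : rho0 <= rho; [rewrite le_max lexx|lra].
pose k w := w ^+ 2 * (f w^-1)^-1; pose r := (4 * rho)^-1.
have r0 : 0 < r by rewrite invr_gt0; lra.
have wr w : w != 0 -> cmod (w - 0) <= 2 * r -> rho < cmod w^-1.
  move=> w0; rewrite subr0 cmodV => h; rewrite -[rho]invrK ltf_pV2 ?posrE ?cmod_gt0 //.
    apply: le_lt_trans h _; rewrite /r invfM mulrA.
    by have : 0 < rho^-1; [rewrite invr_gt0; lra|lra].
  by rewrite invr_gt0; lra.
have k0 : k 0 = 0 by rewrite /k expr0n mul0r.
have kle w : cmod (w - 0) <= 2 * r -> cmod (k w) <= cmod w ^+ 2.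
  have [->|w0] := eqVneq w 0; first by rewrite k0 cmod0 expr0n.
  move=> /(wr w w0)/f1 h; rewrite cmodM cmodX cmodV ler_piMr ?exprn_ge0 ?cmod_ge0 //.
  by rewrite invf_le1 //; lra.
have [|H0|[m [c c0 [d d0 Hd]]]] := @zero_order _ k 0 r r0.
- move=> w wr0; have [->|w0] := eqVneq w 0; last first.
    apply: cdableM; first by apply: cdableX; exact: cdable_id.
    apply: cdableV; first by rewrite -cmod_gt0; have := f1 _ (wr w w0 wr0); lra.
    by apply: (@cdable_comp _ (fun w => w^-1) f) => //; apply: cdableV => //; exact: cdable_id.
  exists 0 => e e0; exists (Num.min e r); first by rewrite lt_min e0.
  move=> u; rewrite lt_min => /andP[ue ur]; rewrite mul0r subr0 k0 subr0.
  apply: le_trans (kle u _) _; first by lra.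
  by rewrite expr2 subr0; rewrite subr0 in ue; rewrite ler_wpM2r ?cmod_ge0 // ltW.
- have [w] := cmod_point 0 (ltW (divr_gt0 r0 (ltr0Sn R 3))).
  move=> wE; have w0 : w != 0 by rewrite -cmod_gt0 -[w]subr0 wE; lra.
  have := H0 w; rewrite wE => /(_ (lexx _))/eqP; rewrite /k mulf_eq0 expf_eq0 (negbTE w0) /=.
  rewrite invr_eq0 => /eqP fw; have := f1 w^-1; rewrite fw cmod0 => /(_ (wr w w0 _)).
  by rewrite wE; lra.
apply: (growth_poly (m := m) ef).
exists (c^-1), (Num.max (2 / d) (Num.max (2 * rho) 1)) => z.
rewrite !ge_max => /andP[zd /andP[zr z1]]; have z0 : 0 < cmod z by lra.
have zn : z != 0 by rewrite -cmod_gt0.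
have fz : 1 < cmod (f z) by apply: f1; lra.
have zid : cmod (z^-1 - 0) < d.
  rewrite subr0 cmodV -[d]invrK ltf_pV2 ?posrE ?invr_gt0 //.
  by rewrite ler_pdivrMr // in zd; rewrite -div1r ltr_pdivrMr //; lra.
have := Hd z^-1 zid; rewrite subr0 cmodV /k invrK cmodM cmodX !cmodV exprVn => h.
have F0 : 0 < cmod (f z) by lra.
have zm : 0 < cmod z ^+ m by rewrite exprn_gt0.
have h2 : c / cmod z ^+ m * (cmod z ^+ m * cmod (f z) / c) <=
  cmod z^-1 ^+ 2 / cmod (f z) * (cmod z ^+ m * cmod (f z) / c).
  by rewrite cmodV ler_wpM2r // !mulr_ge0 ?invr_ge0 // ltW.
have e1 : c / cmod z ^+ m * (cmod z ^+ m * cmod (f z) / c) = cmod (f z).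
  by field; rewrite !gt_eqF.
have e2 : cmod z^-1 ^+ 2 / cmod (f z) * (cmod z ^+ m * cmod (f z) / c) =
  cmod z^-1 ^+ 2 * (c^-1 * cmod z ^+ m) by field; rewrite !gt_eqF.
rewrite e1 e2 in h2; apply: le_trans h2 _; rewrite ler_piMl //.
  by rewrite mulr_ge0 ?invr_ge0 // ltW.
by rewrite exprn_ile1 ?cmod_ge0 // cmodV invf_le1.
Qed.

End Entire.

(** * Uniform limits and local injectivity *)

Section Limits.
Variable R : realType.
Local Notation C := R[i].
Implicit Types (f g h : C -> C) (z w l : C) (r M : R).

Lemma real_cauchy (u : nat -> R) :
  (forall e, 0 < e -> exists N, forall m n, (N <= m)%N -> (N <= n)%N -> `|u m - u n| <= e) ->
  exists a : R, forall e, 0 < e -> exists N, forall n, (N <= n)%N -> `|u n - a| <= e.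
Proof.
move=> H; have /cauchy_cvg cu : cauchy (u @ \oo).
  apply: cauchy_exP => e e0; have e20 : 0 < e / 2 by lra.
  have [N HN] := H _ e20; exists (u N); exists N => // n /= Nn.
  by rewrite /ball /=; have := HN N n (leqnn _) Nn; lra.
exists (lim (u @ \oo)) => e e0; move/cvgrPdist_le : cu => /(_ e e0)[N _ HN].
by exists N => n Nn; rewrite distrC; exact: HN.
Qed.

Lemma complex_cauchy (u : nat -> C) :
  (forall e, 0 < e -> exists N, forall m n, (N <= m)%N -> (N <= n)%N -> cmod (u m - u n) <= e) ->
  exists l, forall e, 0 < e -> exists N, forall n, (N <= n)%N -> cmod (u n - l) <= e.
Proof.
move=> H; have [|a Ha] := @real_cauchy (fun n => Re (u n)).
  move=> e /H[N HN]; exists N => m n mN nN; rewrite -Re_sub.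
  exact: le_trans (Re_cmod _) (HN m n mN nN).
have [|b Hb] := @real_cauchy (fun n => Im (u n)).
  move=> e /H[N HN]; exists N => m n mN nN; rewrite -Im_sub.
  exact: le_trans (Im_cmod _) (HN m n mN nN).
exists (a +i* b) => e e0; have e20 : 0 < e / 2 by lra.
have [N1 H1] := Ha _ e20; have [N2 H2] := Hb _ e20.
exists (maxn N1 N2) => n; rewrite geq_max => /andP[/H1 h1 /H2 h2].
apply: le_trans (cmod_le_ReIm _) _; rewrite Re_sub Im_sub /=; lra.
Qed.

(** The estimate on first derivatives makes the derivatives of [F k] at [z0] a Cauchy sequence. The
    second-order remainder is bounded uniformly in k, so the bound passes to the limit and gives
    differentiability of [h]. *)
Theorem weierstrass (F : nat -> C -> C) h z0 r : 0 < r ->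
  (forall k z, cmod (z - z0) <= 2 * r -> cdable (F k) z) ->
  (forall e, 0 < e -> exists N, forall k, (N <= k)%N -> forall z, cmod (z - z0) <= 2 * r ->
    cmod (F k z - h z) <= e) ->
  cdable h z0.
Proof.
move=> r0 Fd Fh.
have zz : cmod (z0 - z0) <= 2 * r by rewrite subrr cmod0; lra.
have [L HL] := choice (fun k => Fd k z0 zz).
have [|l Hl] := @complex_cauchy L.
  (* Two such errors bound F m - F n by e r/24, and the derivative bound 24 M / r then equals e. *)
  move=> e e0; have e'0 : 0 < e * r / 48 by rewrite divr_gt0 // mulr_gt0.
  have [N HN] := Fh _ e'0; exists N => m n mN nN.
  have [| | |h1 _] := @taylor2 _ (fun z => F m z - F n z) z0 (L m - L n) r (e * r / 24) r0.
  - by move=> z zr; apply: cdableB; exact: Fd.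
  - move=> z zr; have := cmod_tri (h z) (F m z) (F n z); rewrite (cmodBC (h z)).
    by have := HN m mN z zr; have := HN n nN z zr; lra.
  - exact: cdiffB.
  by apply: le_trans h1 _; rewrite le_eqVlt; apply/orP; left; apply/eqP; field; rewrite gt_eqF.
have [N0 HN0] := Fh 1 ltr01.
have [M M0 HM] := hol_bounded (Fd N0).
pose M' := M + 2.
have FM k : (N0 <= k)%N -> forall z, cmod (z - z0) <= 2 * r -> cmod (F k z) <= M'.
  move=> kN z zr; have := HN0 k kN z zr; have := HN0 N0 (leqnn _) z zr; have := HM z zr.
  have := cmod_subl (F k z) (F N0 z); have := cmod_tri (h z) (F k z) (F N0 z).
  by rewrite (cmodBC (h z)) /M'; lra.
have key z : cmod (z - z0) <= r / 2 ->
    cmod (h z - h z0 - l * (z - z0)) <= 16 * M' * (cmod (z - z0) / r) ^+ 2.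
  move=> zr; rewrite leNgt; apply/negP => lt1; set B := 16 * M' * _ in lt1.
  (* The three errors made at index k add up to e (2 + |z - z0|), which is half of A - B. *)
  set A := cmod _ in lt1; pose e := (A - B) / (2 * (2 + cmod (z - z0))).
  have t0 := cmod_ge0 (z - z0).
  have e0 : 0 < e by rewrite divr_gt0 //; lra.
  have [N1 H1] := Fh _ e0; have [N2 H2] := Hl _ e0.
  pose k := maxn N0 (maxn N1 N2).
  have k0 : (N0 <= k)%N by rewrite leq_maxl.
  have k1 : (N1 <= k)%N by rewrite /k !leq_max leqnn orbT.
  have k2 : (N2 <= k)%N by rewrite /k !leq_max leqnn !orbT.
  have [_ h3] := taylor2 r0 (Fd k) (FM k k0) (HL k).
  have {}h3 := h3 z zr; rewrite -/B in h3.
  have zr2 : cmod (z - z0) <= 2 * r by lra.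
  have h4 := H1 k k1 z zr2; have h5 := H1 k k1 z0 zz; have h6 := H2 k k2.
  have E : h z - h z0 - l * (z - z0) = (F k z - F k z0 - L k * (z - z0))
    - (F k z - h z) + (F k z0 - h z0) + (L k - l) * (z - z0) by ring.
  have : A <= B + e + e + e * cmod (z - z0).
    rewrite /A E; apply: le_trans (cmodD _ _) _; rewrite cmodM.
    apply: lerD; last by apply: ler_wpM2r.
    apply: le_trans (cmodD _ _) _; apply: lerD => //.
    by apply: le_trans (cmodB _ _) _; apply: lerD.
  have : e * (2 * (2 + cmod (z - z0))) = A - B by rewrite /e divfK // gt_eqF //; lra.
  clear -e0 t0 lt1; nra.
exists l => e e0; pose K := 16 * M' / r ^+ 2 + 1.
have M'0 : 0 <= M' by rewrite /M'; lra.
have K0 : 0 < K.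
  by rewrite /K ltr_wpDl // divr_ge0 ?mulr_ge0 ?exprn_ge0 ?(ltW r0) //; lra.
exists (Num.min (r / 2) (e / K)); first by rewrite lt_min !divr_gt0.
move=> z; rewrite lt_min => /andP[/ltW z1 z2]; apply: le_trans (key z z1) _.
rewrite ltr_pdivlMr // in z2; rewrite expr_div_n.
have -> : 16 * M' * (cmod (z - z0) ^+ 2 / r ^+ 2) =
  cmod (z - z0) * (16 * M' / r ^+ 2) * cmod (z - z0) by field; rewrite gt_eqF.
apply: ler_wpM2r; first exact: cmod_ge0.
apply: le_trans (ltW z2); apply: ler_wpM2l; first exact: cmod_ge0.
by rewrite /K lerDl.
Qed.

(** Expanding from [p] to [w] and from [w] to [p] bounds the variation of the derivative by 32 M |w
    - p|. Near [p] this and the quadratic remainder use up at most half of |l|. *)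
Lemma local_injectivity f p l : centire f -> cdiff f p l -> l != 0 ->
  exists2 eta : R, 0 < eta & forall z w, cmod (z - p) < eta -> cmod (w - p) < eta ->
    cmod l / 2 * cmod (z - w) <= cmod (f z - f w).
Proof.
move=> ef fl l0; have L0 : 0 < cmod l by rewrite cmod_gt0.
(* The disc of radius 3 contains the discs of radius 2 about every [w] with |w - p| <= 1, on which
   [taylor2] is applied with r = 1. *)
have [|M M0 HM] := @hol_bounded _ f p 3; first by move=> z _; exact: ef.
have T w m : cmod (w - p) <= 1 -> cdiff f w m -> forall z, cmod (z - w) <= 1 / 2 ->
    cmod (f z - f w - m * (z - w)) <= 16 * M * cmod (z - w) ^+ 2.
  move=> wp fm z zw; have [| |_ h] := @taylor2 _ f w m 1 M ltr01 _ _ fm.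
  - by move=> u _; exact: ef.
  - by move=> u uw; apply: HM; have := cmod_tri w u p; lra.
  by have := h z zw; rewrite divr1.
pose K := 128 * M + 1; have K0 : 0 < K by rewrite /K; lra.
exists (Num.min (1 / 4) (cmod l / K)); first by rewrite lt_min !divr_gt0.
move=> z w; rewrite !lt_min => /andP[z1 z2] /andP[w1 w2].
rewrite !ltr_pdivlMr // in z2 w2; rewrite /K in z2 w2.
have [m fm] := ef w; set t := cmod (z - w).
have t0 : 0 <= t := cmod_ge0 _.
have zw : cmod (z - w) <= 1 / 2 by have := cmod_tri p z w; rewrite (cmodBC p); lra.
have w1' : cmod (w - p) <= 1 by lra.
have pp : cmod (p - p) <= 1 by rewrite subrr cmod0; lra.
have h1 := T w m w1' fm z zw.
have wp : cmod (w - p) <= 1 / 2 by lra.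
have pw : cmod (p - w) <= 1 / 2 by rewrite cmodBC.
have h2 := T w m w1' fm p pw; have h3 := T p l pp fl w wp.
have h4 : cmod (m - l) <= 32 * M * cmod (w - p).
  have [e|wp0] := eqVneq w p.
    by move: fm; rewrite e => /cdiff_unique/(_ fl) ->; rewrite !subrr !cmod0 mulr0.
  have n0 : 0 < cmod (w - p) by rewrite cmod_gt0 subr_eq0.
  rewrite -(ler_pM2r n0) -cmodM.
  have -> : (m - l) * (w - p) = (f p - f w - m * (p - w)) + (f w - f p - l * (w - p)) by ring.
  apply: le_trans (cmodD _ _) _; rewrite (cmodBC p w) in h2.
  by have := h2; have := h3; rewrite expr2; lra.
have zwt : t <= cmod (z - p) + cmod (w - p).
  by rewrite /t; have := cmod_tri p z w; rewrite (cmodBC p).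
have E : l * (z - w) = (f z - f w) - (f z - f w - m * (z - w)) - (m - l) * (z - w) by ring.
have h5 : cmod l * t <= cmod (f z - f w) + 16 * M * t ^+ 2 + 32 * M * cmod (w - p) * t.
  rewrite -cmodM E; apply: le_trans (cmodB _ _) _; rewrite cmodM; apply: lerD.
    by apply: le_trans (cmodB _ _) _; apply: lerD.
  by apply: ler_wpM2r.
have h6 : 16 * M * t ^+ 2 + 32 * M * cmod (w - p) * t <= cmod l / 2 * t.
  rewrite expr2 mulrA -mulrDl; apply: ler_wpM2r => //.
  have : 16 * M * t <= 16 * M * (cmod (z - p) + cmod (w - p)) by rewrite ler_wpM2l //; lra.
  have a0 := cmod_ge0 (z - p); have b0 := cmod_ge0 (w - p).
  clear -z2 w2 a0 b0; lra.
lra.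
Qed.

End Limits.

(** * Lifting of rays *)

Section Connectedness.
Variable R : realType.
Local Notation C := R[i].
Implicit Types (f g h : C -> C) (z w : C).

(** Connectedness of a segment, obtained from [bisection] with second side 0: the truth value of [Q]
    is constant on small pieces, and adjacent pieces share an end point. *)
Lemma itv_locally_const (Q : R -> Prop) (a b : R) : a <= b ->
  (forall t, a <= t <= b -> exists2 d : R, 0 < d &
    forall s, a <= s <= b -> `|s - t| < d -> (Q s <-> Q t)) ->
  forall s t, a <= s <= b -> a <= t <= b -> (Q s <-> Q t).
Proof.
move=> ab loc.
pose P (x y l : R) := forall s t, a <= s <= b -> a <= t <= b ->
  x <= s <= x + l * (b - a) -> x <= t <= x + l * (b - a) -> (Q s <-> Q t).
have A0 : 0 <= b - a by lra.
suff PP : P a 0 1 by move=> s t sab tab; apply: PP => //; lra.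
apply: (bisection A0 (lexx 0)) => [x y l l0 h1 h2 _ _|p q pab _].
  have e : l * (b - a) = l / 2 * (b - a) + l / 2 * (b - a) by field.
  rewrite /P e; set m := l / 2 * (b - a) in h1 h2 *.
  have m0 : 0 <= m by rewrite mulr_ge0 //; lra.
  have glue s t : a <= s <= b -> a <= t <= b -> x <= s <= x + m ->
      x + m <= t <= x + (m + m) -> (Q s <-> Q t).
    move=> sab tab sx tx; have mab : a <= x + m <= b by lra.
    rewrite (h1 s (x + m)) //; last by rewrite -/m; lra.
    by apply: h2 => //; rewrite -/m; lra.
  move=> s t sab tab sx tx; have [s1|s1] := leP s (x + m); have [t1|t1] := leP t (x + m).
  - by apply: h1 => //; rewrite -/m; lra.
  - by apply: glue => //; lra.
  - by apply: iff_sym; apply: glue => //; lra.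
  - by apply: h2 => //; rewrite -/m; lra.
have pab' : a <= p <= b by lra.
have [d d0 Hd] := loc p pab'; exists (d / (b - a + 1)); first by rewrite divr_gt0 //; lra.
move=> x y l /andP[l0]; rewrite ltr_pdivlMr; last lra.
move=> ld px _ s t sab tab sx tx.
have near u : x <= u <= x + l * (b - a) -> `|u - p| < d.
  have ld' : l * (b - a) < d by move: ld; rewrite mulrDr mulr1; lra.
  by move=> ux; rewrite ltr_norml; move: ux px ld'; set m := l * (b - a); lra.
by rewrite (Hd s) ?(Hd t) //; exact: near.
Qed.

Lemma segment_cvx z w (e : R) t : 0 < e -> exists2 d : R, 0 < d &
  forall s, `|s - t| < d -> cmod ((z + s%:C * (w - z)) - (z + t%:C * (w - z))) < e.
Proof.
move=> e0; exists (e / (cmod (w - z) + 1)).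
  by rewrite divr_gt0 //; have := cmod_ge0 (w - z); lra.
move=> s; have n0 := cmod_ge0 (w - z); rewrite ltr_pdivlMr; last lra.
have -> : (z + s%:C * (w - z)) - (z + t%:C * (w - z)) = (s - t)%:C * (w - z).
  by rewrite rmorphB /=; ring.
by rewrite cmodM cmod_real; have := normr_ge0 (s - t); nra.
Qed.

Lemma complex_connected (A : C -> Prop) :
  (forall z, exists2 e : R, 0 < e & forall w, cmod (w - z) < e -> (A w <-> A z)) ->
  forall z w, A z <-> A w.
Proof.
move=> loc z w.
have := @itv_locally_const (fun t => A (z + t%:C * (w - z))) 0 1 ler01 _ 0 1.
rewrite rmorph0 rmorph1 mul0r addr0 mul1r subrKC; apply; rewrite ?lexx ?ler01 //.
move=> t _; have [e e0 He] := loc (z + t%:C * (w - z)).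
have [d d0 Hd] := segment_cvx z w t e0.
by exists d => // s _ /Hd/He.
Qed.

End Connectedness.

Section Lifting.
Variable R : realType.
Local Notation C := R[i].
Implicit Types (g h : C -> C) (z w u v p : C).
Variable f : C -> C.
Hypotheses (ef : centire f) (nf : nonconst f).

Definition loc_inj p := exists2 eta : R, 0 < eta &
  forall z w, cmod (z - p) < eta -> cmod (w - p) < eta -> f z = f w -> z = w.

(** Preimages near [p] exist by the open mapping theorem; the lower Lipschitz bound of
    [local_injectivity] makes any choice of them continuous. *)
Lemma local_inverse p l : cdiff f p l -> l != 0 ->
  exists2 eta : R, 0 < eta &
    (forall z w, cmod (z - p) < eta -> cmod (w - p) < eta -> f z = f w -> z = w) /\
    exists2 d : R, 0 < d & exists psi : C -> C, forall w, cmod (w - f p) < d ->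
      [/\ cmod (psi w - p) < eta, f (psi w) = w & ccont psi w].
Proof.
move=> fl l0; have [eta eta0 H] := local_injectivity ef fl l0.
have L0 : 0 < cmod l by rewrite cmod_gt0.
exists eta => //; split.
  move=> z w zp wp fzw; apply/eqP; rewrite -subr_eq0 -cmod_eq0 eq_le cmod_ge0 andbT.
  have := H z w zp wp; rewrite fzw subrr cmod0 => h.
  by have := cmod_ge0 (z - w); nra.
have [d d0 Hd] := open_mapping p ef nf eta0; exists d => //.
have [psi Hpsi] : exists psi : C -> C, forall w, cmod (w - f p) < d ->
    cmod (psi w - p) < eta /\ f (psi w) = w.
  have /choice[psi Hpsi] : forall w, exists z, cmod (w - f p) < d ->
      cmod (z - p) < eta /\ f z = w.
    move=> w; have [wd|wd] := ltP (cmod (w - f p)) d; last by exists 0.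
    by have [z z1 z2] := Hd w wd; exists z.
  by exists psi.
exists psi => w wd; have [h1 h2] := Hpsi w wd; split=> // e e0.
have d1 : 0 < d - cmod (w - f p) by lra.
exists (Num.min (d - cmod (w - f p)) (cmod l / 2 * e)).
  by rewrite lt_min d1 mulr_gt0 //; lra.
move=> w'; rewrite lt_min => /andP[w'1 w'2].
have w'd : cmod (w' - f p) < d by have := cmod_tri w w' (f p); lra.
have [h3 h4] := Hpsi w' w'd; have := H _ _ h3 h1; rewrite h4 h2 => h5.
have l2 : 0 < cmod l / 2 by lra.
by rewrite -(ltr_pM2l l2); lra.
Qed.

Lemma loc_inj_deriv p : (forall l, cdiff f p l -> l != 0) -> loc_inj p.
Proof.
move=> H; have [l fl] := ef p; have [eta eta0 [inj _]] := local_inverse fl (H l fl).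
by exists eta.
Qed.

(** Agreement of the two lifts is an open condition by local injectivity, and disagreement is one by
    continuity. *)
Lemma path_lift_unique (p q : R -> C) (a b t0 : R) : a <= b ->
  rcont_on p a b -> rcont_on q a b -> (forall t, a <= t <= b -> f (p t) = f (q t)) ->
  (forall t, a <= t <= b -> loc_inj (p t)) -> a <= t0 <= b -> p t0 = q t0 ->
  forall t, a <= t <= b -> p t = q t.
Proof.
move=> ab cp cq fpq inj t0ab e0 t tab.
have := @itv_locally_const _ (fun s => p s = q s) a b ab _ t t0 tab t0ab.
move=> [| _ h]; last exact: h.
move=> s sab; have [e|/eqP ne] := pselect (p s = q s).
  have [eta eta0 Heta] := inj s sab.
  have [d d0 Hd] := cp s sab _ eta0; have [d' d'0 Hd'] := cq s sab _ eta0.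
  exists (Num.min d d'); first by rewrite lt_min d0.
  move=> s' s'ab; rewrite lt_min => /andP[/Hd h1 /Hd' h2]; split=> // _.
  by apply: Heta => //; [rewrite e|exact: fpq].
have n0 : 0 < cmod (p s - q s) / 2 by rewrite divr_gt0 // cmod_gt0 subr_eq0.
have [d d0 Hd] := cp s sab _ n0; have [d' d'0 Hd'] := cq s sab _ n0.
exists (Num.min d d'); first by rewrite lt_min d0.
move=> s' s'ab; rewrite lt_min => /andP[/Hd h1 /Hd' h2].
split=> [e|e]; last by rewrite e eqxx in ne.
exfalso; have := cmod_tri (p s') (p s) (q s); rewrite (cmodBC (p s) (p s')) {2}e; lra.
Qed.

Definition strip (a b d : R) u := (a < Re u < b) && (`|Im u| < d).

Lemma strip_convex a b d u v (t : R) : strip a b d u -> strip a b d v -> 0 <= t <= 1 ->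
  strip a b d (u + t%:C * (v - u)).
Proof.
rewrite /strip !ltr_norml Re_add Im_add Re_mul Im_mul Re_sub Im_sub /= !mul0r subr0 addr0.
move=> /andP[/andP[u1 u2] /andP[u3 u4]] /andP[/andP[v1 v2] /andP[v3 v4]] /andP[t0 t1].
have aff (x y m : R) : m < x -> m < y -> m < x + t * (y - x).
  by move=> mx my; have [->|t1'] := eqVneq t 1; [lra|have : t < 1 by rewrite lt_def eq_sym t1']; nra.
have aff' (x y m : R) : x < m -> y < m -> x + t * (y - x) < m.
  by move=> mx my; have := aff (- x) (- y) (- m); rewrite !ltrN2 => /(_ mx my); lra.
by rewrite !aff ?aff'.
Qed.

Lemma strip_lift_unique (phi psi : C -> C) (a b d : R) u0 :
  (forall u, strip a b d u -> ccont phi u) -> (forall u, strip a b d u -> ccont psi u) ->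
  (forall u, strip a b d u -> f (phi u) = f (psi u)) ->
  (forall u, strip a b d u -> loc_inj (phi u)) ->
  strip a b d u0 -> phi u0 = psi u0 -> forall u, strip a b d u -> phi u = psi u.
Proof.
move=> cphi cpsi fe inj su0 e0 u su.
have st t : 0 <= t <= 1 -> strip a b d (u0 + t%:C * (u - u0)) by exact: strip_convex.
have cont (h : C -> C) : (forall u, strip a b d u -> ccont h u) ->
    rcont_on (fun t => h (u0 + t%:C * (u - u0))) 0 1.
  move=> ch t t01 e e_gt0; have [d1 d10 H1] := ch _ (st t t01) e e_gt0.
  by have [d2 d20 H2] := segment_cvx u0 u t d10; exists d2 => // s /H2/H1.
have := @path_lift_unique _ _ 0 1 0 ler01 (cont _ cphi) (cont _ cpsi).
move=> /(_ _ _ _ _ 1); rewrite rmorph0 rmorph1 mul0r addr0 mul1r subrKC; apply=> //.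
- by move=> t /st/fe.
- by move=> t /st/inj.
- by rewrite lexx ler01.
- by rewrite lexx ler01.
Qed.

End Lifting.

Section Rays.
Variable R : realType.
Local Notation C := R[i].
Implicit Types (g h phi psi : C -> C) (x y z w u v p : C) (s t d : R).
Variable f : C -> C.
Variables M0 M : R.
Hypotheses (ef : centire f) (nf : nonconst f) (M00 : 0 <= M0) (M0M : M0 < M).
Hypothesis nocrit : forall p l, M0 < cmod (f p) -> cdiff f p l -> l != 0.
Hypothesis noasym : forall zeta, asymptotic_values f zeta -> cmod zeta <= M0.

(* [phi] inverts [f] along the ray segment [[1, s] * f y], on a thin strip around
   it; the strip stays where [f] has no singular value. *)
Definition branch y s d phi :=
  [/\ 0 < d, M0 <= (1 - d) * M, phi 1 = y &
    forall u, strip (1 - d) (s + d) d u -> ccont phi u /\ f (phi u) = u * f y].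

Let Mpos : 0 < M. Proof. exact: le_lt_trans M00 M0M. Qed.

Lemma strip_sub a b d a' b' d' u : a' <= a -> b <= b' -> d <= d' ->
  strip a b d u -> strip a' b' d' u.
Proof. by rewrite /strip => h1 h2 h3 /andP[/andP[h4 h5] h6]; lra. Qed.

Lemma strip_real (a b d t : R) : a < t < b -> 0 < d -> strip a b d t%:C.
Proof. by move=> tab d0; rewrite /strip /= tab normr0. Qed.

Lemma strip_cmod a b d u : strip a b d u -> a < cmod u.
Proof.
move=> /andP[/andP[h _] _]; apply: lt_le_trans h _; apply: le_trans (Re_cmod u).
exact: ler_norm.
Qed.

Lemma branch_inj y s d phi u : cmod (f y) = M -> branch y s d phi ->
  strip (1 - d) (s + d) d u -> loc_inj f (phi u).
Proof.
move=> fy [d0 dM _ H] su; apply: loc_inj_deriv => // l; apply: nocrit.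
have [_ ->] := H u su; rewrite cmodM fy; apply: le_lt_trans dM _.
by rewrite ltr_pM2r //; exact: strip_cmod su.
Qed.

Lemma branch_mono y s d s' d' phi : branch y s d phi -> s' + d' <= s + d ->
  0 < d' -> d' <= d -> branch y s' d' phi.
Proof.
move=> [d0 dM e H] ss d'0 dd; split=> //.
  by apply: le_trans dM _; rewrite ler_pM2r //; lra.
by move=> u su; apply: H; apply: strip_sub su; lra.
Qed.

Lemma branch_unique y s d phi s' d' phi' t : cmod (f y) = M -> branch y s d phi ->
  branch y s' d' phi' -> 1 <= t -> t <= s -> t <= s' -> phi t%:C = phi' t%:C.
Proof.
move=> fy b b' t1 ts ts'; pose d1 := Num.min d d'.
have [d0 _ e _] := b; have [d'0 _ e' _] := b'.
have d10 : 0 < d1 by rewrite lt_min d0.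
have dd : d1 <= d by rewrite ge_min lexx.
have dd' : d1 <= d' by rewrite ge_min lexx orbT.
have bt : branch y t d1 phi by apply: (branch_mono b); lra.
have bt' : branch y t d1 phi' by apply: (branch_mono b'); lra.
have [_ _ _ H] := bt; have [_ _ _ H'] := bt'.
apply: (@strip_lift_unique _ f phi phi' (1 - d1) (t + d1) d1 1) => //.
- by move=> u /H[].
- by move=> u /H'[].
- by move=> u su; rewrite (H u su).2 (H' u su).2.
- by move=> u; exact: branch_inj bt.
- by apply: strip_real => //; lra.
- by rewrite e e'.
- by apply: strip_real => //; lra.
Qed.

Lemma deriv_at p : M0 < cmod (f p) -> exists2 l, cdiff f p l & l != 0.
Proof. by move=> fp; have [l fl] := ef p; exists l => //; exact: nocrit fp fl. Qed.

Lemma square_dist (s d : R) u : `|Re u - s| < d -> `|Im u| < d -> cmod (u - s%:C) < 2 * d.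
Proof.
move=> h1 h2; apply: le_lt_trans (cmod_le_ReIm _) _; rewrite Re_sub Im_sub /= subr0; lra.
Qed.

Lemma ccont_scale psi k u : ccont psi (u * k) -> ccont (fun u => psi (u * k)) u.
Proof.
move=> H; apply: (@ccont_comp _ (fun u => u * k) psi) => //.
by apply: ccontM; [exact: ccont_id|exact: ccont_cst].
Qed.

Lemma branch_start y : cmod (f y) = M -> exists d phi, branch y 1 d phi.
Proof.
move=> fy; have [|l fl l0] := @deriv_at y; first by rewrite fy.
have [eta eta0 [inj [r r0 [psi Hpsi]]]] := local_inverse ef nf fl l0.
(* The first bound keeps the strip where no singular value occurs. The second gives |u - 1| < 2d,
   hence |u f(y) - f(y)| < r, which is the domain of [psi]. *)
pose d := Num.min (1 - M0 / M) (r / (4 * M)).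
have d1 : d <= 1 - M0 / M by rewrite ge_min lexx.
have d2 : d <= r / (4 * M) by rewrite ge_min lexx orbT.
have M4 : 0 < 4 * M by rewrite mulr_gt0.
have d0 : 0 < d by rewrite lt_min subr_gt0 ltr_pdivrMr // mul1r M0M divr_gt0.
exists d, (fun u => psi (u * f y)); split=> //.
- have : M0 / M <= 1 - d by lra.
  by rewrite ler_pdivrMr.
- rewrite mul1r; have [|h1 h2 _] := Hpsi (f y); first by rewrite subrr cmod0.
  by apply: inj => //; rewrite subrr cmod0.
- move=> u su; have ur : cmod (u * f y - f y) < r.
    have -> : u * f y - f y = (u - 1%:C) * f y by rewrite mulrBl mul1r.
    rewrite cmodM fy -ltr_pdivlMr //.
    have -> : r / M = 4 * (r / (4 * M)) by field; rewrite gt_eqF.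
    have : cmod (u - 1%:C) < 2 * d.
      move/andP: su => [/andP[h1 h2] h3]; apply: square_dist => //.
      by rewrite ltr_norml; lra.
    lra.
  have [_ h2 h3] := Hpsi _ ur; split=> //; exact: ccont_scale.
Qed.

(** The local inverse at the accumulation point [p] continues the branch past t. A lift is kept up
    to a parameter s < t at which it is close to [p]; there it agrees with the local inverse by
    injectivity, and on the overlap of the strips by uniqueness. *)
Lemma branch_extend y (t : R) p : cmod (f y) = M -> 1 <= t -> f p = t%:C * f y ->
  (forall e : R, 0 < e -> exists s d phi, [/\ 1 <= s < t, t - s < e, branch y s d phi &
     cmod (phi s%:C - p) < e]) ->
  exists s d phi, t < s /\ branch y s d phi.
Proof.
move=> fy t1 fp H.
have fpM : cmod (f p) = t * M by rewrite fp cmodM cmod_real fy ger0_norm //; lra.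
have [|l fl l0] := @deriv_at p.
  by rewrite fpM; apply: lt_le_trans M0M _; rewrite ler_peMl // ltW.
have [eta eta0 [inj [r r0 [psi Hpsi]]]] := local_inverse ef nf fl l0.
pose psi' u := psi (u * f y).
have M4 : 0 < 4 * M by rewrite mulr_gt0.
pose e := r / (4 * M); have e0 : 0 < e by rewrite divr_gt0.
have Hpsi' u : `|Re u - t| < e -> `|Im u| < e ->
    [/\ cmod (psi' u - p) < eta, f (psi' u) = u * f y & ccont psi' u].
  move=> h1 h2; have ur : cmod (u * f y - f p) < r.
    have -> : u * f y - f p = (u - t%:C) * f y by rewrite fp mulrBl.
    rewrite cmodM fy -ltr_pdivlMr //.
    have -> : r / M = 4 * e by rewrite /e; field; rewrite gt_eqF.
    by have := square_dist h1 h2; lra.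
  by have [k1 k2 k3] := Hpsi _ ur; split=> //; exact: ccont_scale.
have [|s [d [phi [/andP[s1 st] ts b ps]]]] := H (Num.min e eta); first by rewrite lt_min e0.
move: ts ps; rewrite !lt_min => /andP[ts _] /andP[_ ps].
have [d0 dM phi1 Hphi] := b.
have agree u : 1 - d < Re u < s + d -> t - e < Re u < t + e -> `|Im u| < Num.min d e ->
    phi u = psi' u.
  move=> h1 h2 h3; pose a1 := Num.max (1 - d) (t - e); pose b1 := Num.min (s + d) (t + e).
  have S v : strip a1 b1 (Num.min d e) v -> strip (1 - d) (s + d) d v /\
      (`|Re v - t| < e /\ `|Im v| < e).
    move=> /andP[]; rewrite /a1 /b1 gt_max !lt_min => /andP[/andP[k1 k2] /andP[k3 k4]].
    move=> /andP[k5 k6]; rewrite /strip k1 k3 k5; split=> //; split=> //.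
    by rewrite ltr_norml; lra.
  apply: (@strip_lift_unique _ f phi psi' a1 b1 (Num.min d e) s%:C) => //.
  - by move=> v /S[/Hphi[]].
  - by move=> v /S[_ [k1 k2]]; have [] := Hpsi' v k1 k2.
  - by move=> v /S[/Hphi[_ ->] [k1 k2]]; have [_ ->] := Hpsi' v k1 k2.
  - by move=> v /S[k _]; exact: branch_inj b k.
  - apply: strip_real; last by rewrite lt_min d0.
    by rewrite /a1 /b1 gt_max !lt_min; lra.
  - have ss : strip (1 - d) (s + d) d s%:C by apply: strip_real => //; lra.
    have [| |k1 k2 _] := Hpsi' s%:C; [by rewrite /= ltr_norml; lra|by rewrite /= normr0|].
    by apply: inj => //; rewrite k2 (Hphi _ ss).2.
  - by rewrite /strip h3 andbT /a1 /b1 gt_max !lt_min; lra.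
pose chi u := if Re u <= s then phi u else psi' u.
have m1 : Num.min d (e / 4) <= d by rewrite ge_min lexx.
have m2 : Num.min d (e / 4) <= e / 4 by rewrite ge_min lexx orbT.
have m0 : 0 < Num.min d (e / 4) by rewrite lt_min d0; lra.
exists (t + e / 2), (Num.min d (e / 4)), chi; split; first lra.
split=> //.
- by apply: le_trans dM _; rewrite ler_pM2r //; lra.
- by rewrite /chi /= s1.
move=> u /andP[/andP[u1 u2] u3].
have [us|us|us] := ltgtP (Re u) s.
- have su : strip (1 - d) (s + d) d u by rewrite /strip; lra.
  have [k1 k2] := Hphi u su; have -> : chi u = phi u by rewrite /chi ltW.
  split=> //.
  apply: (@ccont_near _ phi _ _ (s - Re u)) => //; first lra.
  move=> w wu; rewrite /chi; have := le_lt_trans (Re_cmod _) wu; rewrite Re_sub ltr_norml.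
  by move=> ww; rewrite ifT //; lra.
- have [| |_ k2 k3] := Hpsi' u; [by rewrite ltr_norml; lra|lra|].
  have -> : chi u = psi' u by rewrite /chi leNgt us.
  split=> //.
  apply: (@ccont_near _ psi' _ _ (Re u - s)) => //; first lra.
  move=> w wu; rewrite /chi; have := le_lt_trans (Re_cmod _) wu; rewrite Re_sub ltr_norml.
  by move=> ww; rewrite ifF //; apply/negbTE; rewrite -ltNge; lra.
- have su : strip (1 - d) (s + d) d u by rewrite /strip; lra.
  have [k1 k2] := Hphi u su; have -> : chi u = phi u by rewrite /chi us lexx.
  split=> //.
  (* On the seam Re u = s the two definitions of [chi] meet; [q] keeps nearby points in the overlap,
     where [agree] identifies them. *)
  pose q := Num.min (Num.min (d - `|Im u|) (e / 4)) (e - (t - s)).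
  have n0 := normr_ge0 (Im u).
  have ud : `|Im u| < d by lra.
  have q0 : 0 < q by rewrite !lt_min; lra.
  apply: (@ccont_near _ phi _ _ q) => // w wu; rewrite /chi; case: ifP => // ws.
  have w1 := le_lt_trans (Re_cmod _) wu; have w2 := le_lt_trans (Im_cmod _) wu.
  have w3 : `|Im w| <= `|Im u| + `|Im (w - u)|.
    by have := ler_normD (Im u) (Im (w - u)); rewrite Im_sub addrC subrK addrC.
  move: w1 w2; rewrite Re_sub us ltr_norml /q !lt_min => /andP[w1] /andP[/andP[w4 w5] w6] /andP[/andP[w7 w8] w9].
  have [w10 w11 w12] : [/\ - (d - `|Im u|) < Re w - s, - (e / 4) < Re w - s &
      - (e - (t - s)) < Re w - s].
    have g1 : q <= d - `|Im u| by rewrite /q !ge_min lexx.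
    have g2 : q <= e / 4 by rewrite /q !ge_min lexx orbT.
    have g3 : q <= e - (t - s) by rewrite /q !ge_min lexx orbT.
    by split; apply: le_lt_trans w1; rewrite lerN2.
  apply: agree; [lra|lra|].
  by rewrite lt_min; lra.
Qed.

(** The map r(x) = T - (T - 1)/(1 + x) carries the half-line [0, +oo[ of the definition onto [1,
    T). *)
Lemma asymptotic_curve (gam : R -> C) (T : R) zeta : 1 < T ->
  (forall t, 1 <= t < T -> forall e : R, 0 < e -> exists2 d : R, 0 < d &
     forall t', 1 <= t' < T -> `|t' - t| < d -> cmod (gam t' - gam t) < e) ->
  (forall B : R, exists2 s, s < T & forall t, 1 <= t < T -> s < t -> B < cmod (gam t)) ->
  (forall e : R, 0 < e -> exists2 s, s < T & forall t, 1 <= t < T -> s < t ->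
     cmod (f (gam t) - zeta) < e) ->
  asymptotic_values f zeta.
Proof.
move=> T1 gc ginf gz; pose r (x : R) := T - (T - 1) / (1 + x).
have T10 : 0 < T - 1 by rewrite subr_gt0.
have r1 (x : R) : 0 <= x -> 1 <= r x < T.
  move=> x0; have x1 : 0 < 1 + x by rewrite ltr_pwDl.
  rewrite /r ltrBlDr ltrDl divr_gt0 // andbT lerBrDr addrC -lerBrDr ler_pdivrMr //.
  by rewrite ler_peMr ?(ltW T10) // lerDl.
have rT s : s < T -> exists2 x0 : R, 0 <= x0 & forall x : R, x0 < x -> s < r x.
  move=> sT; have sT0 : 0 < T - s by rewrite subr_gt0.
  exists ((T - 1) / (T - s)); first by rewrite divr_ge0 // ltW.
  move=> x xx; have x0 : 0 < x by apply: le_lt_trans xx; rewrite divr_ge0 // ltW.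
  have x1 : 0 < 1 + x by rewrite addr_gt0.
  rewrite /r ltrBrDr addrC -ltrBrDr ltr_pdivrMr //.
  by rewrite ltr_pdivrMr // in xx; rewrite mulrC in xx; apply: lt_le_trans xx _;
    rewrite ler_pM2l // lerDr ler01.
exists (gam \o r); split.
- apply/subspace_continuousP => x /=; rewrite in_itv /= andbT => x0 A /nbhsCP[e e0 HA].
  have [d d0 Hd] := gc (r x) (r1 x x0) e e0.
  have x1 : 0 < 1 + x by rewrite ltr_pwDl.
  rewrite /= nbhs_simpl /within /=; apply/nbhs_ballP.
  exists (d / (T - 1)); first by rewrite /= divr_gt0.
  move=> y; rewrite /ball /= distrC => yx; rewrite in_itv /= andbT => y0.
  apply: HA => /=; apply: Hd; first exact: r1.
  have y1 : 0 < 1 + y by rewrite ltr_pwDl.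
  have -> : r y - r x = (T - 1) * (y - x) / ((1 + y) * (1 + x)).
    by rewrite /r; field; rewrite !gt_eqF.
  rewrite !normrM normfV (gtr0_norm T10) (gtr0_norm (mulr_gt0 y1 x1)).
  rewrite ltr_pdivlMr // mulrC in yx; apply: le_lt_trans yx.
  rewrite ler_piMr ?mulr_ge0 ?(ltW T10) // invf_le1 ?mulr_gt0 //.
  by rewrite -[leLHS]mulr1 ler_pM // lerDl.
- move=> A [B [/complex_realP[b ->] HB]]; have [s sT Hs] := ginf b.
  have [x0 x00 Hx] := rT s sT; exists x0; split; first exact: num_real.
  move=> x xx; apply: HB => /=; rewrite normE ltcR; apply: Hs; last exact: Hx.
  by apply: r1; exact: ltW (le_lt_trans x00 xx).
- move=> A /nbhsCP[e e0 HA]; have [s sT Hs] := gz e e0.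
  have [x0 x00 Hx] := rT s sT; exists x0; split; first exact: num_real.
  move=> x xx; apply: HA => /=; apply: Hs; last exact: Hx.
  by apply: r1; exact: ltW (le_lt_trans x00 xx).
Qed.

(** Let T be the supremum of the parameters reached. If the lift tended to infinity at T, then T
    f(y) would be an asymptotic value of modulus T M > M0. Otherwise it accumulates at some [p] with
    f p = T f(y), and [branch_extend] passes beyond T. *)
Theorem ray_lift y s : cmod (f y) = M -> 1 <= s -> exists d phi, branch y s d phi.
Proof.
move=> fy s1; apply: contrapT => nb.
pose S := [set t : R | 1 <= t /\ exists d phi, branch y t d phi].
have S1 : S 1 by split; [exact: lexx|exact: branch_start].
have Sle t : S t -> t <= s.
  move=> [t1 [d [phi b]]]; rewrite leNgt; apply/negP => st; apply: nb.
  exists d, phi; have [d0 _ _ _] := b; apply: (branch_mono b) => //.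
  by rewrite lerD2r ltW.
have hS : has_sup S by split; [exists 1|exists s].
pose T := sup S.
have STle t : S t -> t <= T by move=> St; apply: ub_le_sup => //; exact: hS.2.
have ST t : 1 <= t < T -> S t.
  move=> /andP[t1 tT]; have e0 : 0 < T - t by rewrite subr_gt0.
  have [t' [t'1 [d [phi b]]]] := sup_adherent e0 hS; rewrite opprB subrKC => tt'.
  split=> //; exists d, phi; have [d0 _ _ _] := b; apply: (branch_mono b) => //.
  by rewrite lerD2r ltW.
have T1 : 1 < T.
  have [d [phi b]] := branch_start fy; have [d0 _ _ _] := b.
  have d2 : 0 < d / 2 by rewrite divr_gt0.
  apply: (@lt_le_trans _ _ (1 + d / 2)); first by rewrite ltrDl.
  apply: STle; split; first by rewrite lerDl ltW.
  exists (d / 2), phi; apply: (branch_mono b) => //; last by lra.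
  by rewrite -addrA -splitr.
have /choice[F HF] : forall t, exists x : R * (C -> C), 1 <= t < T -> branch y t x.1 x.2.
  move=> t; have [h|h] := boolP (1 <= t < T); last by exists (0, id).
  by have [_ [d [phi b]]] := ST t h; exists (d, phi).
pose gam t := (F t).2 t%:C.
have agree t t' d phi : 1 <= t <= t' -> t' < T -> branch y t' d phi -> gam t = phi t%:C.
  move=> /andP[t1 tt'] t'T b; have tT := le_lt_trans tt' t'T.
  by apply: (branch_unique fy (HF t _) b) => //; rewrite t1 tT.
have val t d phi t' : branch y t' d phi -> 1 <= t -> t <= t' ->
    ccont phi t%:C /\ f (phi t%:C) = t%:C * f y.
  move=> [d0 _ _ H] t1 tt'; apply: H; apply: strip_real => //; lra.
have fgam t : 1 <= t < T -> f (gam t) = t%:C * f y.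
  by move=> tT; have /andP[t1 _] := tT; have [_] := val t _ _ t (HF t tT) t1 (lexx t).
have gc t : 1 <= t < T -> forall e : R, 0 < e -> exists2 d : R, 0 < d &
    forall t', 1 <= t' < T -> `|t' - t| < d -> cmod (gam t' - gam t) < e.
  move=> /andP[t1 tT] e e0; pose t2 := (t + T) / 2.
  have [tt2 t2T] : t < t2 /\ t2 < T by rewrite /t2; split; lra.
  have [_ [d [phi b]]] : S t2 by apply: ST; rewrite t2T andbT; lra.
  have [c _] := val t d phi t2 b t1 (ltW tt2); have [d1 d10 H1] := c e e0.
  exists (Num.min d1 (t2 - t)); first by rewrite lt_min d10 subr_gt0.
  move=> t' /andP[t'1 t'T]; rewrite lt_min => /andP[h1 h2].
  have t't2 : t' <= t2 by move: h2; rewrite ltr_norml; lra.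
  rewrite (agree t' t2 d phi) ?t'1 // (agree t t2 d phi) ?t1 ?ltW //; apply: H1.
  by rewrite -rmorphB cmod_real.
have nz : 0 < cmod (f y) by rewrite fy Mpos.
(* Either the lift returns to a fixed disc at parameters arbitrarily close to T, or it tends to
   infinity. *)
have [[B HB]|nB] := pselect (exists B : R, forall s, s < T ->
    exists2 t, 1 <= t < T & s < t /\ cmod (gam t) <= B); last first.
  have : asymptotic_values f (T%:C * f y).
    apply: (@asymptotic_curve gam T) => //.
      move=> B; apply: contrapT => nex; apply: nB; exists B => s' s'T.
      apply: contrapT => nex'; apply: nex; exists s' => // t tT st.
      by rewrite ltNge; apply/negP => h; apply: nex'; exists t.
    move=> e e0; exists (T - e / M); first by rewrite ltrBlDr ltrDl divr_gt0 // Mpos.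
    move=> t tT st; rewrite fgam // -mulrBl cmodM fy -rmorphB cmod_real -ltr_pdivlMr ?Mpos //.
    have q0 : 0 < e / M by rewrite divr_gt0 ?Mpos.
    by rewrite ltr_norml; lra.
  move=> /noasym; rewrite cmodM cmod_real fy gtr0_norm; last lra.
  by apply/negP; rewrite -ltNge; apply: lt_trans M0M _; rewrite ltr_pMl ?Mpos.
(* Without an accumulation point every point of the disc has a neighbourhood that the lift finally
   avoids, and by compactness so does the disc. *)
have [p Hp] : exists p, forall e : R, 0 < e -> exists2 t, 1 <= t < T &
    T - t < e /\ cmod (gam t - p) < e.
  apply: contrapT => np.
  have : exists2 e : R, 0 < e & forall t, 1 <= t < T -> T - t < e ->
      ~ [set z : C | cmod (z - 0) <= B] (gam t).
    apply: (@compact_ind _ _ (fun A : set C => exists2 e : R, 0 < e &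
      forall t, 1 <= t < T -> T - t < e -> ~ A (gam t))).
    - exact: closed_ball_closed.
    - exact: closed_ball_bounded.
    - by exists 1 => // t _ _ [].
    - by move=> A A' AA [e e0 H]; exists e => // t tT te /AA; exact: H.
    - move=> A A' [e e0 H] [e' e'0 H']; exists (Num.min e e'); first by rewrite lt_min e0.
      by move=> t tT; rewrite lt_min => /andP[te te'] [/(H t tT te)|/(H' t tT te')].
    - move=> z _; apply: contrapT => nz'; apply: np; exists z => e e0.
      apply: contrapT => nt; apply: nz'; exists e => //; exists e => // t tT te /= gz.
      by apply: nt; exists t.
  move=> [e e0 H]; have [|t tT [te tB]] := HB (T - e); first by rewrite ltrBlDr ltrDl.
  by apply: (H t tT); rewrite ?subr0 //=; [rewrite ltrBlDr addrC -ltrBlDr|rewrite subr0].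
have fp : f p = T%:C * f y.
  apply/eqP; rewrite -subr_eq0; apply: contrapT => /negP ne.
  have D0 : 0 < cmod (f p - T%:C * f y) / 2 by rewrite divr_gt0 // cmod_gt0.
  have [d d0 Hd] := cdable_cont (ef p) D0.
  have m0 : 0 < Num.min d (cmod (f p - T%:C * f y) / 2 / M) by rewrite lt_min d0 divr_gt0 ?Mpos.
  have [t tT [te tp]] := Hp _ m0; move: te tp; rewrite !lt_min => /andP[_ te] /andP[/Hd tp _].
  have := cmod_tri (f (gam t)) (f p) (T%:C * f y); rewrite (cmodBC (f p) (f (gam t))).
  rewrite {2}fgam // -mulrBl cmodM fy -rmorphB cmod_real distrC.
  rewrite ltr_pdivlMr ?Mpos // in te; rewrite gtr0_norm; first lra.
  by move/andP: tT => [_]; rewrite subr_gt0.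
have [|s' [d [phi [Ts b]]]] := @branch_extend y T p fy (ltW T1) fp.
  move=> e e0; have [t tT [te tp]] := Hp e e0.
  by exists t, (F t).1, (F t).2; split=> //; exact: HF.
have : S s' by split; [lra|exists d, phi].
by move/STle; rewrite leNgt Ts.
Qed.

(** This is where the strip of complex parameters pays off: multiplying the parameter by [v] of
    modulus 1 near 1 turns the lift from [y] into lifts from all neighbouring starting points, over
    rotated rays, with a common margin. *)
Lemma rotate_branch y s d phi : 1 <= s -> branch y s d phi ->
  exists2 k : R, 0 < k & forall v, cmod v = 1 -> cmod (v - 1) < k ->
    f (phi v) = v * f y /\ branch (phi v) s (d / 2) (fun x => phi (x * v)).
Proof.
move=> s1 [d0 dM e H].
have d1 : d <= 1.
  by have := le_trans M00 dM; rewrite pmulr_lge0 ?Mpos // subr_ge0.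
have den : 0 < 2 * (s + d + 1) by lra.
pose k := d / (2 * (s + d + 1)); have k0 : 0 < k by rewrite divr_gt0.
have kd : (s + d + 1) * k = d / 2 by rewrite /k; field; lra.
(* Points of the smaller strip have |x| < s + d, so x v is within (s + d) k < d/2 of x and stays in
   the larger strip. *)
exists k => // v v1 vk.
have S x : strip (1 - d / 2) (s + d / 2) (d / 2) x -> strip (1 - d) (s + d) d (x * v).
  move=> /andP[/andP[x1 x2] x3].
  have xs : cmod x < s + d.
    by apply: le_lt_trans (cmod_le_ReIm x) _; rewrite gtr0_norm; lra.
  have xv : cmod (x * v - x) < d / 2.
    have -> : x * v - x = x * (v - 1) by ring.
    rewrite cmodM; apply: le_lt_trans (ler_wpM2r (cmod_ge0 _) (ltW xs)) _.
    have h : (s + d) * cmod (v - 1) <= (s + d) * k by rewrite ler_wpM2l ?ltW //; lra.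
    by apply: le_lt_trans h _; lra.
  have := le_lt_trans (Re_cmod _) xv; have := le_lt_trans (Im_cmod _) xv.
  rewrite Re_sub Im_sub; set a := Re (x * v); set b := Im (x * v) => h1 h2.
  move: h1 h2 x3; rewrite /strip -/a -/b !ltr_norml => h1 h2 x3.
  by clear xs xv; lra.
have d2 : 0 < d / 2 by lra.
have [cv fv] : ccont phi v /\ f (phi v) = v * f y.
  have := S 1; rewrite mul1r => h; apply/H/h; apply: strip_real => //; lra.
split=> //; split=> //.
- by apply: le_trans dM _; rewrite ler_pM2r ?Mpos //; lra.
- by rewrite mul1r.
- move=> x /S/H[c fx]; split; first exact: ccont_scale.
  by rewrite fx fv mulrA.
Qed.

(** * The set swept by the rays from a bounded piece *)

Variable W : set C.
Hypotheses (oW : open W) (bW : cbounded W) (bdW : forall z, bd W z -> M < cmod (f z)).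

Let K z := W z /\ cmod (f z) <= M.
Let L y := K y /\ cmod (f y) = M.

Let lift y t x := exists s d phi, [/\ branch y s d phi, 1 <= t <= s & x = phi t%:C].
Let Lam s : set C := [set x | exists y t, [/\ L y, 1 <= t <= s & lift y t x]].
Let A z := K z \/ exists2 s, 1 <= s & Lam s z.

Let branch_val y s d phi t : branch y s d phi -> 1 <= t <= s ->
  ccont phi t%:C /\ f (phi t%:C) = t%:C * f y.
Proof. by move=> [d0 _ _ H] ts; apply: H; apply: strip_real => //; lra. Qed.

Let lift_val y t x : lift y t x -> f x = t%:C * f y.
Proof. by move=> [s [d [phi [b ts ->]]]]; have [_] := branch_val b ts. Qed.

Let K_closed : closed K.
Proof.
apply/closedCP => z H.
have fz : cmod (f z) <= M.
  rewrite leNgt; apply/negP => Mz; have e0 : 0 < cmod (f z) - M by rewrite subr_gt0.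
  have [d d0 Hd] := cdable_cont (ef z) e0; have [w [_ Kw] wz] := H d d0.
  by have := Hd w wz; rewrite cmodBC; have := cmod_subl (f z) (f w); lra.
split=> //; apply: contrapT => nW; have : bd W z.
  by split=> //; apply/closureCP => e /H[w [Ww _] wz]; exists w.
by move/bdW; rewrite ltNge fz.
Qed.

Let L_closed : closed L.
Proof.
apply/closedCP => z H; have Kz : K z.
  by move/closedCP : K_closed; apply=> e /H[w [Kw _] wz]; exists w.
split=> //; apply/eqP; rewrite eq_le (proj2 Kz) /= leNgt; apply/negP => Mz.
have e0 : 0 < M - cmod (f z) by rewrite subr_gt0.
have [d d0 Hd] := cdable_cont (ef z) e0; have [w [_ fw] wz] := H d d0.
by have := Hd w wz; have := cmod_subl (f w) (f z); rewrite fw; lra.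
Qed.

Let L_bounded : cbounded L.
Proof. by have [B HB] := bW; exists B => z [[/HB]]. Qed.

Lemma rect_closed (a b c d : R) : closed [set z : C | rect a b c d z].
Proof.
apply/closedCP => z H; rewrite /= /rect.
have G (q : C -> R) m : (forall x w, `|q x - q w| <= cmod (x - w)) ->
    (forall w, rect a b c d w -> q w <= m) -> q z <= m.
  move=> lq Hq; rewrite leNgt; apply/negP => mz.
  have e0 : 0 < q z - m by rewrite subr_gt0.
  have [w /Hq qw wz] := H _ e0; have := lq w z.
  by have := ler_norm (- (q w - q z)); rewrite normrN; lra.
apply/andP; split; apply/andP; split.
- rewrite -lerN2; apply: (G (fun w => - Re w)) => [x w|w /andP[/andP[h _] _]].
    by rewrite -opprD normrN -Re_sub Re_cmod.
  by rewrite lerN2.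
- apply: (G (fun w => Re w)) => [x w|w /andP[/andP[_ h] _] //].
  by rewrite -Re_sub Re_cmod.
- rewrite -lerN2; apply: (G (fun w => - Im w)) => [x w|w /andP[_ /andP[h _]]].
    by rewrite -opprD normrN -Im_sub Im_cmod.
  by rewrite lerN2.
- apply: (G (fun w => Im w)) => [x w|w /andP[_ /andP[_ h]] //].
  by rewrite -Im_sub Im_cmod.
Qed.

Lemma rect_bounded (a b c d : R) : cbounded [set z : C | rect a b c d z].
Proof.
exists (`|a| + `|b| + (`|c| + `|d|)) => z /andP[h1 h2].
apply: le_trans (cmod_le_ReIm z) _.
have G (p q m : R) : p <= m <= q -> `|m| <= `|p| + `|q|.
  move=> h; have := ler_norm (- p); have := ler_norm q; rewrite normrN ler_norml.
  by have := normr_ge0 p; have := normr_ge0 q; lra.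
by apply: lerD; exact: G.
Qed.

Let cmodfy y : L y -> cmod (f y) = M. Proof. by case. Qed.

(* Compactness of [Lam s], in the form provided by [compact_ind]. *)
Let Lam_compact s (Q : set C -> Prop) : 1 <= s -> Q set0 ->
  (forall B D, B `<=` D -> Q D -> Q B) -> (forall B D, Q B -> Q D -> Q (B `|` D)) ->
  (forall z, Lam s z -> exists2 e : R, 0 < e & Q [set w | cmod (w - z) < e]) -> Q (Lam s).
Proof.
move=> s1 Q0 Qm QU Qloc.
(* The first [L y] is the condition that the induction over the compact set [L] replaces by y in a
   subset; the second remains available throughout. *)
have : Q [set x | exists y t, [/\ L y, L y, 1 <= t <= s & lift y t x]]; last first.
  by apply: Qm => x [y [t [Ly ts yx]]]; exists y, t.
apply: (@compact_ind _ L (fun Y => Q [set x | exists y t, [/\ Y y, L y, 1 <= t <= s & lift y t x]])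
  L_closed L_bounded).
- by apply: Qm Q0 => x [y [t []]].
- by move=> Y Z YZ; apply: Qm => x [y [t [/YZ Zy Ly ts l]]]; exists y, t.
- move=> Y Z QY QZ; apply: Qm (QU _ _ QY QZ) => x [y [t [[Yy|Zy] Ly ts l]]].
    by left; exists y, t.
  by right; exists y, t.
move=> y Ly; have fy := cmodfy Ly; have [d [phi b]] := ray_lift fy s1.
have [d0 dM e1 Hb] := b.
have [k k0 Hk] := rotate_branch s1 b.
(* A second compactness argument, along the parameter: the segment [1, s] is the degenerate
   rectangle [rect 1 s 0 0], and [Q] holds for the image under [phi] of a neighbourhood of it. *)
have [k2 k20 Hk2] : exists2 k2 : R, 0 < k2 &
    Q [set x | exists u t, [/\ rect 1 s 0 0 t%:C, 1 <= t <= s, cmod (u - t%:C) < k2 & x = phi u]].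
  apply: (@compact_ind _ [set z : C | rect 1 s 0 0 z] (fun T => exists2 k2 : R, 0 < k2 &
    Q [set x | exists u t, [/\ T t%:C, 1 <= t <= s, cmod (u - t%:C) < k2 & x = phi u]])).
  - exact: rect_closed.
  - exact: rect_bounded.
  - by exists 1 => //; apply: Qm Q0 => x [u [t []]].
  - move=> T U TU [k2 k20 H]; exists k2 => //; apply: Qm H => x [u [t [/TU Tt ts ut xu]]].
    by exists u, t.
  - move=> T U [k2 k20 H] [k3 k30 H']; exists (Num.min k2 k3); first by rewrite lt_min k20.
    apply: Qm (QU _ _ H H') => x [u [t [TU ts]]]; rewrite lt_min => /andP[u2 u3] xu.
    by case: TU => Tt; [left|right]; exists u, t.
  - move=> z /andP[/= z1 z2]; have zE : z = (Re z)%:C.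
      by apply: complex_eq => //=; lra.
    have [c _] := branch_val b z1.
    have [e e0 Qe] : exists2 e : R, 0 < e & Q [set w | cmod (w - phi (Re z)%:C) < e].
      by apply: Qloc; exists y, (Re z); split=> //; exists s, d, phi.
    have [r r0 Hr] := c e e0; have r2 : 0 < r / 2 by lra.
    exists (r / 2) => //; exists (r / 2) => //.
    apply: Qm Qe => x [u [t [/= tz ts ut ->]]]; apply: Hr.
    by rewrite -zE; have := cmod_tri t%:C u z; lra.
have m0 : 0 < Num.min k (k2 / s) by rewrite lt_min k0 divr_gt0 //; lra.
have [|l fl l0] := @deriv_at y; first by rewrite fy.
have [eta eta0 [inj _]] := local_inverse ef nf fl l0.
have [cphi _] : ccont phi 1 /\ f (phi 1) = 1 * f y.
  by apply: Hb; apply: (@strip_real _ _ _ 1) => //; lra.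
have [k3 k30 Hk3] := cphi _ eta0.
have q0 : 0 < Num.min (Num.min k (k2 / s)) k3 * M by rewrite mulr_gt0 ?Mpos // lt_min m0.
have [r r0 Hr] := cdable_cont (ef y) q0.
exists (Num.min r eta); first by rewrite lt_min r0.
apply: Qm Hk2 => x [y' [t [/=]]]; rewrite lt_min => /andP[y'r y'e] Ly' ts lx.
have fy0 : f y != 0 by rewrite -cmod_gt0 fy Mpos.
have fy' := cmodfy Ly'.
(* The ratio [v] has modulus 1 and is close to 1, and phi v = y' by injectivity near [y]; so the
   lift from [y'] is the rotated lift from [y] and stays in the neighbourhood just covered. *)
pose v := f y' / f y; have v1 : cmod v = 1.
  by rewrite /v cmodM cmodV fy fy' divff // gt_eqF ?Mpos.
have vy : cmod (v - 1) < Num.min (Num.min k (k2 / s)) k3.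
  have -> : v - 1 = (f y' - f y) / f y by rewrite /v; field.
  by rewrite cmodM cmodV fy ltr_pdivrMr ?Mpos //; exact: Hr.
move: vy; rewrite !lt_min => /andP[/andP[vk vk2] vk3].
have [fv bv] := Hk v v1 vk.
have y'E : phi v = y'.
  apply: inj => //; first by rewrite -e1; exact: Hk3.
  by rewrite fv /v divfK.
rewrite y'E in bv; have [s' [d' [phi' [b' ts' xE]]]] := lx.
have /andP[t1 tls] := ts; have /andP[_ tls'] := ts'.
exists (t%:C * v), t; split=> //.
- by rewrite /rect /= ts lexx.
- have -> : t%:C * v - t%:C = t%:C * (v - 1) by ring.
  rewrite cmodM cmod_real gtr0_norm; last lra.
  rewrite ltr_pdivlMr in vk2; last lra.
  by apply: le_lt_trans vk2; rewrite mulrC ler_wpM2l ?cmod_ge0.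
- by rewrite xE; apply: (branch_unique fy' b' bv t1 tls' tls).
Qed.

(** Near a lifted point z = phi t every [w] is phi u with u close to t. Writing u = rho v with |v| =
    1, for rho >= 1 the point [w] is the lift at parameter rho from the rotated start phi v, which
    is again in [L]. For rho < 1 necessarily t = 1, and [w] belongs to [K] because it is near
    [y]. *)
Let A_open z : A z -> exists2 e : R, 0 < e & forall w, cmod (w - z) < e -> A w.
Proof.
have inK : K z -> cmod (f z) < M -> exists2 e : R, 0 < e & forall w, cmod (w - z) < e -> A w.
  move=> [Wz _] fz; have e0 : 0 < M - cmod (f z) by rewrite subr_gt0.
  have [d d0 Hd] := cdable_cont (ef z) e0; have [r r0 Hr] := (openCP W).1 oW z Wz.
  exists (Num.min d r); first by rewrite lt_min d0.
  move=> w; rewrite lt_min => /andP[/Hd h1 /Hr h2]; left; split=> //.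
  by have := cmod_subl (f w) (f z); lra.
have onLam s : 1 <= s -> Lam s z -> exists2 e : R, 0 < e & forall w, cmod (w - z) < e -> A w.
  move=> s1 [y [t [Ly /andP[t1 _] lz]]]; have fy := cmodfy Ly.
  (* Lifting one unit beyond t leaves room for parameters slightly larger than t. *)
  have t11 : 1 <= t + 1 by lra.
  have [d [phi b]] := ray_lift fy t11; have [d0 dM e1 Hb] := b.
  have zE : z = phi t%:C.
    have [s' [d' [phi' [b' ts' ->]]]] := lz; have /andP[_ tls'] := ts'.
    by apply: (branch_unique fy b' b t1 tls'); lra.
  have [k k0 Hk] := rotate_branch t11 b.
  have st : strip (1 - d) (t + 1 + d) d t%:C by apply: strip_real => //; lra.
  have [ct ft] := Hb _ st.
  have [eta eta0 inj] := branch_inj fy b st; rewrite -zE in inj ct ft.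
  have [r r0 Hr] := ct eta eta0; rewrite -zE in Hr.
  have [Wy _] := (proj1 Ly); have [rW rW0 HrW] := (openCP W).1 oW y Wy.
  have [c1 _] : ccont phi 1 /\ f (phi 1) = 1 * f y.
    by apply: Hb; apply: (@strip_real _ _ _ 1) => //; lra.
  have [r1 r10 Hr1] := c1 _ rW0; rewrite e1 in Hr1.
  pose q := Num.min (Num.min (Num.min r d) (Num.min k r1)) (1 : R).
  have q0 : 0 < q by rewrite !lt_min r0 d0 k0 r10 ltr01.
  have q20 : 0 < q / 2 * M by rewrite mulr_gt0 ?Mpos //; lra.
  have [r2 r20 Hr2] := cdable_cont (ef z) q20.
  have tW : t = 1 -> forall w, cmod (w - z) < rW -> W w.
    by move=> t_1 w; rewrite zE t_1 e1; exact: HrW.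
  (* For t > 1 the margin t - 1 excludes rho < 1; for t = 1 the value 1 merely keeps the radius
     positive. *)
  pose tt := if t == 1 then 1 else t - 1.
  have tt0 : 0 < tt by rewrite /tt; case: eqP => // /eqP tn; rewrite subr_gt0 lt_def tn.
  have ttM : 0 < tt * M by rewrite mulr_gt0 ?Mpos.
  have [r3 r30 Hr3] := cdable_cont (ef z) ttM.
  exists (Num.min (Num.min r2 eta) (Num.min r3 rW)); first by rewrite !lt_min r20 eta0 r30.
  move=> w; rewrite !lt_min => /andP[/andP[/Hr2 w2 weta] /andP[/Hr3 w3 wW]].
  have fy0 : f y != 0 by rewrite -cmod_gt0 fy Mpos.
  pose u := f w / f y; have fw : f w = u * f y by rewrite /u divfK.
  have ut : cmod (u - t%:C) < q / 2.
    by move: w2; rewrite ft fw -mulrBl cmodM fy ltr_pM2r ?Mpos.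
  have [qr qd qk qr1] : [/\ q <= r, q <= d, q <= k & q <= r1].
    by split; rewrite /q !ge_min lexx ?orbT.
  have q1 : q <= 1 by rewrite /q ge_min lexx orbT.
  have su : strip (1 - d) (t + 1 + d) d u.
    have := le_lt_trans (Re_cmod _) ut; have := le_lt_trans (Im_cmod _) ut.
    rewrite Re_sub Im_sub /= subr0 /strip => h1; rewrite ltr_norml => h2.
    have qd2 : q / 2 < d by lra.
    by rewrite (lt_trans h1 qd2) andbT; lra.
  have [cu fu] := Hb u su.
  have wE : w = phi u.
    apply: inj => //; last by rewrite fu.
    by apply: Hr; apply: lt_le_trans qr; lra.
  pose rho := cmod u.
  have rt : `|rho - t| < q / 2.
    have tn : cmod t%:C = t by rewrite cmod_real gtr0_norm; lra.
    have := cmod_subl u t%:C; have := cmod_subl t%:C u; rewrite (cmodBC t%:C) tn.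
    by rewrite ltr_norml /rho; lra.
  have rho0 : 0 < rho by move: rt; rewrite ltr_norml; lra.
  have [rho1|rho1] := leP 1 rho; last first.
    left; have fwM : cmod (f w) < M by rewrite fw cmodM fy gtr_pMl ?Mpos.
    split; last exact: ltW.
    apply: tW wW; apply/eqP; apply: contraTT rho1 => tn; rewrite -leNgt.
    rewrite /tt (negbTE tn) in w3; move: w3; rewrite ft fw -mulrBl cmodM fy ltr_pM2r ?Mpos //.
    have := cmod_subl t%:C u; rewrite (cmodBC t%:C) cmod_real gtr0_norm /rho; lra.
  pose v := u / rho%:C; have v1 : cmod v = 1.
    by rewrite /v cmodM cmodV cmod_real gtr0_norm // divff // gt_eqF.
  have rhoC : rho%:C != 0 by rewrite -cmod_gt0 cmod_real gtr0_norm.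
  have uE : u = rho%:C * v by rewrite /v mulrC divfK.
  have vq : cmod (v - 1) < q.
    have -> : v - 1 = (u - rho%:C) / rho%:C by rewrite /v; field.
    rewrite cmodM cmodV cmod_real gtr0_norm // ltr_pdivrMr //.
    have : cmod (u - rho%:C) < q.
      have := cmod_tri t%:C u rho%:C; rewrite -rmorphB cmod_real distrC; lra.
    by move=> h; apply: lt_le_trans h _; rewrite ler_peMr // ltW.
  have [fv bv] := Hk v v1 (lt_le_trans vq qk).
  right; exists (t + 1) => //; exists (phi v), rho.
  have Lv : L (phi v).
    split; last by rewrite fv cmodM v1 mul1r.
    by split; [apply: HrW; apply: Hr1; exact: lt_le_trans vq qr1|rewrite fv cmodM v1 mul1r fy].
  have rho2 : 1 <= rho <= t + 1 by rewrite rho1 /=; move: rt; rewrite ltr_norml; lra.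
  split=> //; exists (t + 1), (d / 2), (fun x => phi (x * v)); split=> //.
  by rewrite wE {1}uE.
move=> [Kz|[s s1 Lz]]; last exact: onLam Lz.
have [fz|fz] := ltP (cmod (f z)) M; first exact: inK.
have Lz : L z by split=> //; apply/eqP; rewrite eq_le fz andbT; case: Kz.
apply: (onLam 1 (lexx 1)); exists z, 1; split; rewrite ?lexx //.
have [d [phi b]] := ray_lift (cmodfy Lz) (lexx 1).
by exists 1, d, phi; split; rewrite ?lexx //; have [_ _ ->] := b.
Qed.

Let in_Lam y t x s : L y -> 1 <= t -> lift y t x -> t * M <= s * M -> Lam s x.
Proof.
by move=> Ly t1 lx; rewrite ler_pM2r ?Mpos // => ts; exists y, t; rewrite t1.
Qed.

Let lift_mod y t x : L y -> 1 <= t -> lift y t x -> cmod (f x) = t * M.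
Proof.
move=> Ly t1 /lift_val ->; rewrite cmodM cmod_real (cmodfy Ly) ger0_norm //.
exact: le_trans ler01 t1.
Qed.

(** A lift at parameter t has |f| = t M, and near [z] one has |f| < |f z| + M = s M. So only the
    compact truncation [Lam s] and the closed set [K] have to be avoided. *)
Let A_closed z : ~ A z -> exists2 e : R, 0 < e & forall w, cmod (w - z) < e -> ~ A w.
Proof.
move=> nA; pose s := cmod (f z) / M + 1.
have s1 : 1 <= s by rewrite lerDr divr_ge0 ?cmod_ge0 // ltW // Mpos.
have sM : s * M = cmod (f z) + M by rewrite /s mulrDl mul1r divfK // gt_eqF // Mpos.
have [e e0 He] : exists2 e : R, 0 < e & forall x, Lam s x -> e <= cmod (x - z).
  apply: (@Lam_compact s (fun T => exists2 e : R, 0 < e & forall x, T x -> e <= cmod (x - z)) s1).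
  - by exists 1.
  - by move=> B D BD [e e0 H]; exists e => // x /BD/H.
  - move=> B D [e e0 H] [e' e'0 H']; exists (Num.min e e'); first by rewrite lt_min e0.
    by move=> x [/H h|/H' h]; rewrite ge_min h ?orbT.
  - move=> x Lx; have xz : 0 < cmod (x - z) / 2.
      rewrite divr_gt0 // cmod_gt0 subr_eq0; apply/eqP => xz; apply: nA; right.
      by exists s => //; rewrite -xz.
    by exists (cmod (x - z) / 2) => //; exists (cmod (x - z) / 2) => // w /= wx;
      have := cmod_tri w x z; rewrite (cmodBC x w); lra.
have oK : open (~` K) by exact: closed_openC.
have nK : (~` K) z by move=> Kz; apply: nA; left.
have [e' e'0 He'] := (openCP _).1 oK z nK.
have [d d0 Hd] := cdable_cont (ef z) Mpos.
exists (Num.min (Num.min e e') d); first by rewrite !lt_min e0 e'0.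
move=> w; rewrite !lt_min => /andP[/andP[we we'] /Hd wd] [Kw|[s' s'1 [y [t [Ly /andP[t1 _] lw]]]]].
  exact: He' we' Kw.
have /He : Lam s w.
  apply: (in_Lam Ly t1 lw); rewrite sM -(lift_mod Ly t1 lw).
  by have := cmod_subl (f w) (f z); lra.
by rewrite leNgt we.
Qed.

(** Since [A] is open, closed and not empty, it is the plane. A point with |f z| <= r therefore lies
    in [K] or in [Lam s] with s = max(1, r/M), and both are bounded. *)
Theorem bounded_piece_proper : (exists z, K z) ->
  forall r : R, exists rho : R, forall z, cmod (f z) <= r -> cmod z <= rho.
Proof.
move=> [z0 Kz0] r.
have AT z : A z.
  have loc u : exists2 e : R, 0 < e & forall w, cmod (w - u) < e -> (A w <-> A u).
    have [Au|nAu] := pselect (A u).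
      by have [e e0 He] := A_open Au; exists e => // w /He.
    by have [e e0 He] := A_closed nAu; exists e => // w /He.
  by apply/(complex_connected loc z0 z); left.
pose s := Num.max 1 (r / M); have s1 : 1 <= s by rewrite le_max lexx.
have rs : r <= s * M by rewrite -ler_pdivrMr ?Mpos // le_max lexx orbT.
have [B HB] : exists B : R, forall x, Lam s x -> cmod x <= B.
  apply: (@Lam_compact s (fun T => exists B : R, forall x, T x -> cmod x <= B) s1).
  - by exists 0.
  - by move=> D E DE [B H]; exists B => x /DE/H.
  - move=> D E [B H] [B' H']; exists (Num.max B B').
    by move=> x [/H h|/H' h]; rewrite le_max h ?orbT.
  - move=> x _; exists 1 => //; exists (cmod x + 1) => w /= wx.
    by have := cmod_subl w x; lra.
have [B' HB'] := bW; exists (Num.max B B') => z fz.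
have [[Wz _]|[s' s'1 [y [t [Ly /andP[t1 _] lz]]]]] := AT z.
  by rewrite le_max (HB' z Wz) orbT.
have /HB h : Lam s z.
  by apply: (in_Lam Ly t1 lz); rewrite -(lift_mod Ly t1 lz); exact: le_trans rs.
by rewrite le_max h.
Qed.

End Rays.

(** * Functions of bounded type *)

Section BoundedType.
Variable R : realType.
Local Notation C := R[i].
Implicit Types (f g h : C -> C) (z w p : C).

Lemma entire_centire f : entire f <-> centire f.
Proof.
split=> [H z|H z _]; first exact: ((derivable_cdiff f z).1 (H z I)).
exact: ((derivable_cdiff f z).2 (H z)).
Qed.

Lemma transcendental_nonconst f : transcendental_entire f -> nonconst f.
Proof.
move=> [_ np]; apply: contrapT => nn; apply: np; exists (f 0)%:P => z; rewrite hornerC.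
by apply/eqP; apply: contrapT => /negP fz; apply: nn; exists z, 0.
Qed.

Lemma bounded_setP (A : set C) : bounded_set A -> exists2 M : R, 0 <= M & forall z, A z -> cmod z <= M.
Proof.
move=> [b [/complex_realP[r ->] H]].
exists (`|r| + 1); first by rewrite addr_ge0.
move=> z Az; have h : `|z| <= (`|r| + 1)%:C.
  by apply: (H _ _ z Az); rewrite ltcR; have := ler_norm r; lra.
by rewrite normE lecR in h.
Qed.

Lemma bounded_type_bound f : bounded_type f -> exists2 M : R, 0 <= M &
  (forall p l, M < cmod (f p) -> cdiff f p l -> l != 0) /\
  (forall zeta, asymptotic_values f zeta -> cmod zeta <= M).
Proof.
move=> /bounded_setP[M M0 HM]; exists M => //; split.
  move=> p l fp fl; apply/eqP => l0; move: fp; rewrite ltNge => /negP; apply.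
  apply: HM; left; left; exists p => //=; rewrite -l0; exact: cdiff_derive1.
by move=> zeta az; apply: HM; left; right.
Qed.

Theorem tract_full f : transcendental_entire f -> bounded_type f ->
  exists2 M0 : R, 0 <= M0 & forall M (W : set C), M0 < M -> open W -> cbounded W ->
    (forall z, bd W z -> M < cmod (f z)) -> forall z, W z -> M < cmod (f z).
Proof.
move=> tf /bounded_type_bound[M0 M00 [nc na]]; exists M0 => // M W M0M oW bW bdW z Wz.
have ef : centire f by apply/entire_centire; exact: (proj1 tf).
rewrite ltNge; apply/negP => fz; apply: (proj2 tf).
apply: proper_poly => //.
apply: (bounded_piece_proper ef (transcendental_nonconst tf) M00 M0M nc na oW bW bdW).
by exists z.
Qed.

(** The closure of [V] is compact, so a limit of values on [V] is attained on the closure; being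
    outside the image of [V], it is attained on the boundary. *)
Lemma bd_image h (V : set C) w : centire h -> cbounded V -> bd (h @` V) w ->
  exists2 z, bd V z & h z = w.
Proof.
move=> eh bV [cw nw]; apply: contrapT => nz.
have nc z : closure V z -> h z != w.
  move=> cz; apply/eqP => hz; have [Vz|nV] := pselect (V z); first by apply: nw; exists z.
  by apply: nz; exists z.
have [e e0 He] : exists2 e : R, 0 < e & forall z, closure V z -> closure V z -> e <= cmod (h z - w).
  apply: (@compact_ind _ (closure V) (fun T => exists2 e : R, 0 < e &
    forall z, T z -> closure V z -> e <= cmod (h z - w))).
  - exact: closed_closure.
  - exact: closure_bounded.
  - by exists 1.
  - by move=> A B AB [e e0 H]; exists e => // z /AB/H.
  - move=> A B [e e0 H] [e' e'0 H']; exists (Num.min e e'); first by rewrite lt_min e0.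
    by move=> z [/H h1|/H' h1] /h1 h2; rewrite ge_min h2 ?orbT.
  - move=> z cz; have n0 : 0 < cmod (h z - w) / 2.
      by rewrite divr_gt0 // cmod_gt0 subr_eq0 nc.
    have [d d0 Hd] := cdable_cont (eh z) n0; exists d => //; exists (cmod (h z - w) / 2) => //.
    by move=> u /Hd hu _; have := cmod_tri (h u) (h z) w; rewrite (cmodBC (h z) (h u)); lra.
have [_ [z Vz <-] zw] := (closureCP _ _).1 cw e e0.
have cz : closure V z by exact: subset_closure.
by have := He z cz cz; rewrite leNgt zw.
Qed.

Lemma image_open h (V : set C) : centire h -> nonconst h -> open V -> open (h @` V).
Proof.
move=> eh nh oV; apply/openCP => _ [z Vz <-]; have [e e0 He] := (openCP V).1 oV z Vz.
have [d d0 Hd] := open_mapping z eh nh e0; exists d => // w /Hd[u /He Vu <-].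
by exists u.
Qed.

Lemma image_bounded h (V : set C) : centire h -> cbounded V -> cbounded (h @` V).
Proof.
move=> eh bV; have [|||M _ HM] := @compact_bound _ (closure V) h.
- exact: closed_closure.
- exact: closure_bounded.
- by move=> z _; exact/cdable_cont.
by exists M => _ [z Vz <-]; apply: HM; exact: subset_closure.
Qed.

Lemma centire_comp f g : centire f -> centire g -> centire (f \o g).
Proof. by move=> ef eg z; apply: cdable_comp. Qed.

(** The image of [g] contains a disc; if the composite were constant, [f] would be constant on that
    disc, hence everywhere. *)
Lemma nonconst_comp f g : centire f -> centire g -> nonconst f -> nonconst g -> nonconst (f \o g).
Proof.
move=> ef eg nf ng; apply: contrapT => nn.
have [d d0 Hd] := open_mapping 0 eg ng (@ltr01 R).
have cc z : f (g z) = f (g 0).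
  by apply/eqP; apply: contrapT => /negP h; apply: nn; exists z, 0.
have fc : forall z, f z - f (g 0) = 0.
  apply: (@zero_global _ (fun z => f z - f (g 0)) (g 0) d (centireB _ ef) d0).
  by move=> z /Hd[u _ <-]; rewrite cc subrr.
by case: nf => z [w /eqP]; apply; have := fc z; have := fc w => /subr0_eq -> /subr0_eq.
Qed.

Section Semigroup.
Variables (n : nat) (g : 'I_n -> C -> C).
Hypothesis tg : forall i, transcendental_entire (g i).

Lemma semigroup_entire h : semigroup g h -> centire h /\ nonconst h.
Proof.
elim=> [i|i k _ [ek nk]].
  by split; [apply/entire_centire; exact: (proj1 (tg i))|exact: transcendental_nonconst].
have eg : centire (g i) by apply/entire_centire; exact: (proj1 (tg i)).
split; first exact: centire_comp.
by apply: nonconst_comp => //; exact: transcendental_nonconst.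
Qed.

Theorem semigroup_full : (forall i, bounded_type (g i)) ->
  exists2 M0 : R, 0 <= M0 & forall h M (V : set C), semigroup g h -> M0 < M -> open V ->
    cbounded V -> (forall z, bd V z -> M < cmod (h z)) -> forall z, V z -> M < cmod (h z).
Proof.
move=> bg.
have /choice[m Hm] : forall i, exists M0 : R, 0 <= M0 /\ forall M (W : set C), M0 < M ->
    open W -> cbounded W -> (forall z, bd W z -> M < cmod (g i z)) ->
    forall z, W z -> M < cmod (g i z).
  by move=> i; have [M0 M00 H] := tract_full (tg i) (bg i); exists M0.
(* Finite generation enters here: the sum of the nonnegative constants [m i] dominates each of
   them. *)
exists (\sum_i m i); first by apply: sumr_ge0 => i _; exact: (Hm i).1.
move=> h M V sh; have mM i : \sum_i m i < M -> m i < M.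
  apply: le_lt_trans; rewrite (bigD1 i) //= lerDl; apply: sumr_ge0 => j _; exact: (Hm j).1.
case: sh => [i|i k sk] M0M oV bV bdV z Vz.
  exact: (Hm i).2 (mM i M0M) oV bV bdV z Vz.
have [ek nk] := semigroup_entire sk.
apply: (Hm i).2 (k @` V) (mM i M0M) _ _ _ (k z) _; last by exists z.
- exact: image_open.
- exact: image_bounded.
- by move=> w /(bd_image ek bV)[u /bdV h1 <-].
Qed.

End Semigroup.
End BoundedType.

(** * Splitting an open set along two disjoint closed parts of its boundary *)

Section Separation.
Variable R : realType.
Local Notation C := R[i].
Implicit Types (z w p : C) (Q E V : set C).

Definition loc_const Q (a : C -> bool) := forall z, Q z -> exists2 e : R, 0 < e &
  forall w, Q w -> cmod (w - z) < e -> a w = a z.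

Lemma rect_const (a : C -> bool) x1 x2 y1 y2 : loc_const [set z | rect x1 x2 y1 y2 z] a ->
  forall z w, rect x1 x2 y1 y2 z -> rect x1 x2 y1 y2 w -> a z = a w.
Proof.
move=> ca z w rz rw.
have cv t : 0 <= t <= 1 -> rect x1 x2 y1 y2 (z + t%:C * (w - z)).
  move=> t01; move: rz rw; rewrite /rect Re_add Im_add Re_mul Im_mul Re_sub Im_sub /=.
  rewrite !mul0r subr0 addr0 => /andP[/andP[z1 z2] /andP[z3 z4]] /andP[/andP[w1 w2] /andP[w3 w4]].
  by apply/andP; split; apply/andP; split; nra.
have := @itv_locally_const _ (fun t => a (z + t%:C * (w - z)) = a z) 0 1 ler01 _ 1 0.
rewrite rmorph0 rmorph1 mul0r addr0 mul1r subrKC => H; apply/esym/H; rewrite ?lexx ?ler01 //.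
move=> t t01; have [e e0 He] := ca _ (cv t t01).
have [d d0 Hd] := segment_cvx z w t e0.
by exists d => // s s01 /Hd h; rewrite (He _ (cv s s01) h).
Qed.

Variables (V E1 E2 : set C).
Hypotheses (oV : open V) (bV : cbounded V) (cE1 : closed E1) (cE2 : closed E2).
Hypothesis E12 : forall z, E1 z -> E2 z -> False.
Hypothesis bdE : forall z, bd V z <-> E1 z \/ E2 z.

(** A Mayer-Vietoris splitting with coefficients in Z/2 of the indicator of [V] over [Q]: [a1] may
    jump only across [E1], and [a2] only across [E2]. *)
Let good Q := exists a1 a2 : C -> bool,
  [/\ loc_const (Q `\` E1) a1, loc_const (Q `\` E2) a2 &
    forall z, Q z -> ~ E1 z -> ~ E2 z -> `[< V z >] = a1 z (+) a2 z].

Let V_const Q : loc_const (Q `\` (E1 `|` E2)) (fun z => `[< V z >]).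
Proof.
move=> z [_ nE]; have [Vz|nV] := pselect (V z).
  have [e e0 He] := (openCP V).1 oV z Vz; exists e => // w _ /He Vw.
  by apply/asboolP/asboolP.
have nc : (~` closure V) z by move=> cz; apply: nE; apply/bdE.
have [e e0 He] := (openCP _).1 (closed_openC (@closed_closure _ V)) z nc.
exists e => // w _ /He nw; apply: asbool_equiv_eq; split=> // Vw.
by case: nw; exact: subset_closure.
Qed.

Let avoid E z : closed E -> ~ E z -> exists2 e : R, 0 < e & forall w, cmod (w - z) < e -> ~ E w.
Proof. by move=> cE nE; exact: (openCP _).1 (closed_openC cE) z nE. Qed.

(** On the overlap the two splittings differ by [c], which is a1 + b1 off [E1] and a2 + b2 off [E2].
    As these sets are disjoint, [c] is locally constant on the whole overlap, hence a constant k.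
    Adding k to both b1 and b2 makes the pieces fit and leaves their sum modulo 2 unchanged. *)
Let glue Q1 Q2 : closed Q1 -> closed Q2 ->
  (forall c, loc_const (Q1 `&` Q2) c -> exists k, forall z, Q1 z -> Q2 z -> c z = k) ->
  good Q1 -> good Q2 -> good (Q1 `|` Q2).
Proof.
move=> cQ1 cQ2 conn [a1 [a2 [h1 h2 h3]]] [b1 [b2 [k1 k2 k3]]].
pose c z := if `[< E1 z >] then a2 z (+) b2 z else a1 z (+) b1 z.
have c1 z : ~ E1 z -> c z = a1 z (+) b1 z by rewrite /c => /asboolPn/negbTE ->.
have c2 z : Q1 z -> Q2 z -> ~ E2 z -> c z = a2 z (+) b2 z.
  move=> q1 q2 n2; rewrite /c; case: asboolP => // n1.
  have := h3 z q1 n1 n2; rewrite (k3 z q2 n1 n2).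
  by case: (a1 z) (a2 z) (b1 z) (b2 z) => [] [] [] [].
have [k Hk] : exists k, forall z, Q1 z -> Q2 z -> c z = k.
  apply: conn => z [q1 q2]; have [n1|e1] := pselect (~ E1 z).
    have [d d0 Hd] := h1 z (conj q1 n1); have [d' d'0 Hd'] := k1 z (conj q2 n1).
    have [e e0 He] := avoid cE1 n1.
    exists (Num.min (Num.min d d') e); first by rewrite !lt_min d0 d'0.
    move=> w [w1 w2]; rewrite !lt_min => /andP[/andP[wd wd'] /He nw].
    by rewrite !c1 // Hd // Hd'.
  have n2 : ~ E2 z by move=> z2; apply: e1 => z1; exact: E12 z1 z2.
  have [d d0 Hd] := h2 z (conj q1 n2); have [d' d'0 Hd'] := k2 z (conj q2 n2).
  have [e e0 He] := avoid cE2 n2.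
  exists (Num.min (Num.min d d') e); first by rewrite !lt_min d0 d'0.
  move=> w [w1 w2]; rewrite !lt_min => /andP[/andP[wd wd'] /He nw].
  by rewrite !c2 // Hd // Hd'.
have patch E (a b : C -> bool) : closed E -> loc_const (Q1 `\` E) a -> loc_const (Q2 `\` E) b ->
    (forall z, Q1 z -> Q2 z -> ~ E z -> a z = b z (+) k) ->
    loc_const ((Q1 `|` Q2) `\` E) (fun z => if `[< Q1 z >] then a z else b z (+) k).
  move=> cE ha hb ab z [q nE].
  have [q1|n1] := pselect (Q1 z); last first.
    have q2 : Q2 z by case: q.
    have [e e0 He] := avoid cQ1 n1; have [d d0 Hd] := hb z (conj q2 nE).
    exists (Num.min e d); first by rewrite lt_min e0.
    move=> w [qw nw]; rewrite lt_min => /andP[/He w1 wd].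
    rewrite (asboolF n1) (asboolF w1); congr (_ (+) _); apply: Hd => //; split=> //.
    by case: qw.
  have [d d0 Hd] := ha z (conj q1 nE).
  have [q2|n2] := pselect (Q2 z); last first.
    have [e e0 He] := avoid cQ2 n2; exists (Num.min e d); first by rewrite lt_min e0.
    move=> w [qw nw]; rewrite lt_min => /andP[/He w2 wd].
    have w1 : Q1 w by case: qw.
    by rewrite (asboolT q1) (asboolT w1); apply: Hd.
  have [e e0 He] := hb z (conj q2 nE); exists (Num.min e d); first by rewrite lt_min e0.
  move=> w [qw nw]; rewrite lt_min => /andP[we wd]; rewrite (asboolT q1).
  have [w1|w1] := pselect (Q1 w); first by rewrite (asboolT w1); exact: Hd.
  have w2 : Q2 w by case: qw.
  by rewrite (asboolF w1) He // -ab.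
exists (fun z => if `[< Q1 z >] then a1 z else b1 z (+) k).
exists (fun z => if `[< Q1 z >] then a2 z else b2 z (+) k).
split.
- apply: patch => // z q1 q2 nE; rewrite -(Hk z q1 q2) c1 //.
  by case: (a1 z) (b1 z) => [] [].
- apply: patch => // z q1 q2 nE; rewrite -(Hk z q1 q2) c2 //.
  by case: (a2 z) (b2 z) => [] [].
- move=> z [q1|q2] n1 n2; first by rewrite (asboolT q1); exact: h3.
  have [q1|q1] := pselect (Q1 z); first by rewrite (asboolT q1); exact: h3.
  by rewrite (asboolF q1) k3 //; case: (b1 z) (b2 z) (k) => [] [] [].
Qed.

Let good_eq Q Q' : (forall z, Q z <-> Q' z) -> good Q -> good Q'.
Proof. by move=> H; have -> : Q = Q' by apply/funext => z; apply/propext. Qed.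

Let rset x1 x2 y1 y2 : set C := [set z | rect x1 x2 y1 y2 z].

Let glue_rect x1 x2 y1 y2 x1' x2' y1' y2' u1 u2 v1 v2 Q :
  (forall z, rect x1 x2 y1 y2 z /\ rect x1' x2' y1' y2' z <-> rect u1 u2 v1 v2 z) ->
  (forall z, rect x1 x2 y1 y2 z \/ rect x1' x2' y1' y2' z <-> Q z) ->
  u1 <= u2 -> v1 <= v2 ->
  good (rset x1 x2 y1 y2) -> good (rset x1' x2' y1' y2') -> good Q.
Proof.
move=> HI HU u12 v12 g1 g2; apply: (good_eq (Q := rset x1 x2 y1 y2 `|` rset x1' x2' y1' y2')) => //.
apply: glue => //; [exact: rect_closed|exact: rect_closed|].
move=> c lc; exists (c (u1 +i* v1)) => z z1 z2.
apply: (@rect_const c u1 u2 v1 v2); last by rewrite /rect /= !lexx u12.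
  move=> w /= rw; have [e e0 He] := lc w (proj2 (HI w) rw).
  by exists e => // w' rw' ww'; apply: He => //; exact: (proj2 (HI w') rw').
by apply/HI.
Qed.

(** A small square misses [E1] or [E2], so that one summand can be zero and the other the indicator
    of [V]. Squares are reassembled along common sides, which are connected. *)
Let good_square (N : R) : 0 <= N -> good (rset (- N) N (- N) N).
Proof.
move=> N0; have N2 : 0 <= 2 * N by lra.
have NE : - N + 1 * (2 * N) = N by ring.
suff : good (rset (- N) (- N + 1 * (2 * N)) (- N) (- N + 1 * (2 * N))) by rewrite NE.
apply: (@bisection _ _ _ (fun x y s => good (rset x (x + s * (2 * N)) y (y + s * (2 * N)))) N2 N2).
  move=> x y s s0; have -> : s * (2 * N) = s / 2 * (2 * N) + s / 2 * (2 * N) by field.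
  set m := s / 2 * (2 * N); have m0 : 0 <= m by rewrite mulr_ge0 //; lra.
  rewrite -!(addrA x) -!(addrA y) => g1 g2 g3 g4.
  have G1 : good (rset x (x + (m + m)) y (y + m)).
    apply: (glue_rect (u1 := x + m) (u2 := x + m) (v1 := y) (v2 := y + m) _ _ _ _ g1 g2);
      rewrite /rset /rect /=; [move=> z; split; lra|move=> z; split; [lra|]|lra|lra].
    by have [h|h] := leP (Re z) (x + m); [left|right]; lra.
  have G2 : good (rset x (x + (m + m)) (y + m) (y + (m + m))).
    apply: (glue_rect (u1 := x + m) (u2 := x + m) (v1 := y + m) (v2 := y + (m + m)) _ _ _ _ g3 g4);
      rewrite /rset /rect /=; [move=> z; split; lra|move=> z; split; [lra|]|lra|lra].
    by have [h|h] := leP (Re z) (x + m); [left|right]; lra.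
  apply: (glue_rect (u1 := x) (u2 := x + (m + m)) (v1 := y + m) (v2 := y + m) _ _ _ _ G1 G2);
    rewrite /rset /rect /=; [move=> z; split; lra|move=> z; split; [lra|]|lra|lra].
  by have [h|h] := leP (Im z) (y + m); [left|right]; lra.
move=> p q _ _; pose z := p +i* q.
have small (e : R) : 0 < e -> exists2 d : R, 0 < d & forall x y s, 0 < s < d ->
    x <= p <= x + s * (2 * N) -> y <= q <= y + s * (2 * N) ->
    forall w, rset x (x + s * (2 * N)) y (y + s * (2 * N)) w -> cmod (w - z) < e.
  move=> e0; exists (e / (4 * N + 1)); first by rewrite divr_gt0 //; lra.
  move=> x y s /andP[s0]; rewrite ltr_pdivlMr; last by lra.
  move=> se hx hy w rw.
  have rp : rect x (x + s * (2 * N)) y (y + s * (2 * N)) z by rewrite /rect /= hx hy.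
  by have := rect_dist rp rw; lra.
have [n1|e1] := pselect (~ E1 z).
  have [e e0 He] := avoid cE1 n1; have [d d0 Hd] := small e e0.
  exists d => // x y s sd hx hy; exists (fun=> false), (fun z => `[< V z >]); split=> //.
    by move=> w _; exists 1.
  move=> w [rw n2]; have [|r r0 Hr] := @V_const (rset x (x + s * (2 * N)) y (y + s * (2 * N))) w.
    by split=> // -[] //; exact: He (Hd x y s sd hx hy w rw).
  exists r => // w' [rw' n2'] ww'; apply: Hr => //; split=> // -[] //.
  exact: He (Hd x y s sd hx hy w' rw').
have n2 : ~ E2 z by move=> z2; apply: e1 => z1; exact: E12 z1 z2.
have [e e0 He] := avoid cE2 n2; have [d d0 Hd] := small e e0.
exists d => // x y s sd hx hy; exists (fun z => `[< V z >]), (fun=> false); split=> //.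
- move=> w [rw n1]; have [|r r0 Hr] := @V_const (rset x (x + s * (2 * N)) y (y + s * (2 * N))) w.
    by split=> // -[] //; exact: He (Hd x y s sd hx hy w rw).
  exists r => // w' [rw' n1'] ww'; apply: Hr => //; split=> // -[] //.
  exact: He (Hd x y s sd hx hy w' rw').
- by move=> w _; exists 1.
- by move=> w _ _ _; rewrite addbF.
Qed.

(* This is Janiszewski's theorem in disguise: the cocycle [1_V] on the complement
   of [E1 `|` E2] splits because the plane is simply connected. *)
Theorem separation : exists W1 W2 : set C,
  [/\ open W1 /\ cbounded W1, open W2 /\ cbounded W2,
      forall z, bd W1 z -> E1 z, forall z, bd W2 z -> E2 z & V `<=` W1 `|` W2].
Proof.
have [B0 HB0] := closure_bounded bV; pose B := Num.max B0 0.
have B_ge0 : 0 <= B by rewrite le_max lexx orbT.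
have HB z : closure V z -> cmod z <= B by move=> /HB0 h; rewrite le_max h.
have EB z : E1 z \/ E2 z -> cmod z <= B by move=> /bdE[/HB].
(* The frame of the square of half-side B + 1 lies outside [V], [E1] and [E2]; the frame is
   connected, so a1 and a2 are constant on it. *)
pose N := B + 1; have N0 : 0 <= N by rewrite /N; lra.
have [a1 [a2 [h1 h2 h3]]] := good_square N0.
have far z : N <= cmod z -> [/\ ~ E1 z, ~ E2 z & ~ V z].
  rewrite /N => zN; split=> [z1|z2|Vz].
  - by have := EB z (or_introl z1); lra.
  - by have := EB z (or_intror z2); lra.
  - by have := HB z (subset_closure Vz); lra.
have NN : `|N| = N by rewrite ger0_norm.
have side z : [|| Re z == - N, Re z == N, Im z == - N | Im z == N] -> N <= cmod z.
  by case/or4P => /eqP e; [have := Re_cmod z|have := Re_cmod z|have := Im_cmod z|have := Im_cmod z];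
    rewrite e ?normrN NN.
have cst (a : C -> bool) E x1 x2 y1 y2 : loc_const (rset (- N) N (- N) N `\` E) a ->
    (forall z, N <= cmod z -> ~ E z) ->
    (forall z, rect x1 x2 y1 y2 z -> rect (- N) N (- N) N z /\ N <= cmod z) ->
    forall z w, rect x1 x2 y1 y2 z -> rect x1 x2 y1 y2 w -> a z = a w.
  move=> la nE sub; apply: rect_const => z /= rz; have [r1 r2] := sub z rz.
  have [e e0 He] := la z (conj r1 (nE z r2)); exists e => // w rw wz.
  have [s1 s2] := sub w rw.
  by apply: He => //; split=> //; exact: nE.
have frame (a : C -> bool) E : loc_const (rset (- N) N (- N) N `\` E) a ->
    (forall z, N <= cmod z -> ~ E z) ->
    forall z, bdry (- N) N (- N) N z -> a z = a ((- N) +i* (- N)).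
  move=> la nE z /andP[rz bz].
  have sub x1 x2 y1 y2 : (x1 == x2) && ((x1 == - N) || (x1 == N)) && (- N <= y1) && (y2 <= N) ||
      (y1 == y2) && ((y1 == - N) || (y1 == N)) && (- N <= x1) && (x2 <= N) ->
      forall z, rect x1 x2 y1 y2 z -> rect (- N) N (- N) N z /\ N <= cmod z.
    move=> H u; rewrite /rect => hu; split.
      move: H hu => /orP[/andP[/andP[/andP[/eqP e1 /orP[]/eqP e2] e3] e4]|
        /andP[/andP[/andP[/eqP e1 /orP[]/eqP e2] e3] e4]]; lra.
    apply: side; move: H hu => /orP[/andP[/andP[/andP[/eqP e1 /orP[]/eqP e2] e3] e4]|
        /andP[/andP[/andP[/eqP e1 /orP[]/eqP e2] e3] e4]] /andP[/andP[u1 u2] /andP[u3 u4]].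
    - by rewrite (_ : Re u = - N) ?eqxx //; lra.
    - by rewrite (_ : Re u = N) ?eqxx ?orbT //; lra.
    - by rewrite (_ : Im u = - N) ?eqxx ?orbT //; lra.
    - by rewrite (_ : Im u = N) ?eqxx ?orbT //; lra.
  have left1 := cst a E (- N) (- N) (- N) N la nE (sub (- N) (- N) (- N) N _).
  have bot1 := cst a E (- N) N (- N) (- N) la nE (sub (- N) N (- N) (- N) _).
  have right1 := cst a E N N (- N) N la nE (sub N N (- N) N _).
  have top1 := cst a E (- N) N N N la nE (sub (- N) N N N _).
  have NNN : - N <= N by lra.
  rewrite !eqxx !lexx ?orbT ?andbT /= in left1 bot1 right1 top1.
  move: rz => /andP[rz1 rz2].
  case/or4P: bz => /eqP e.
  - by apply: left1; rewrite /rect /= ?e ?lexx ?NNN.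
  - rewrite (right1 isT _ (N +i* (- N))); [|by rewrite /rect /= ?e ?lexx ?NNN..].
    by apply: bot1; rewrite /rect /= ?lexx ?NNN.
  - by apply: bot1; rewrite /rect /= ?e ?lexx ?NNN ?rz1.
  - rewrite (top1 isT _ ((- N) +i* N)); [|by rewrite /rect /= ?e ?lexx ?NNN ?rz1..].
    by apply: left1; rewrite /rect /= ?lexx ?NNN.
pose k1 := a1 ((- N) +i* (- N)); pose k2 := a2 ((- N) +i* (- N)).
(* The indicator of [V] is 0 at the corner, so both summands have the same value on the frame. On
   [V] the sum is 1, hence there at least one of them differs from this value. *)
have k12 : k1 = k2.
  have fN : N <= cmod ((- N) +i* (- N)) by apply: side; rewrite /= eqxx.
  have [n1 n2 nV] := far _ fN.
  have := h3 _ _ n1 n2; rewrite (asboolF nV) -/k1 -/k2 => H.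
  have : rset (- N) N (- N) N ((- N) +i* (- N)) by rewrite /rset /= /rect /= !lexx; lra.
  by move/H; case: (k1) (k2) => [] [].
(* The piece where [a] differs from its frame value stays off the frame, which makes it open in the
   plane; since [a] is locally constant off [E], its boundary lies in [E]. *)
have build (a : C -> bool) E : closed E -> loc_const (rset (- N) N (- N) N `\` E) a ->
    (forall z, N <= cmod z -> ~ E z) -> a ((- N) +i* (- N)) = k1 ->
    let W := [set z | rset (- N) N (- N) N z /\ ~ E z /\ a z != k1] in
    (open W /\ cbounded W) /\ forall z, bd W z -> E z.
  move=> cE la nE ak W; split; first split.
  - apply/openCP => z [rz [nz az]]; have nb : ~~ bdry (- N) N (- N) N z.
      by apply/negP => /(frame a E la nE) e; rewrite e ak eqxx in az.
    have [e e0 He] := la z (conj rz nz); have [d d0 Hd] := avoid cE nz.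
    move: nb; rewrite /bdry (rz : rect _ _ _ _ _) /= !negb_or => /and4P[b1 b2 b3 b4].
    move: (rz); rewrite /rset /= /rect => /andP[/andP[z1 z2] /andP[z3 z4]].
    have z1' : 0 < Re z - - N by rewrite subr_gt0 lt_def b1.
    have z2' : 0 < N - Re z by rewrite subr_gt0 lt_def eq_sym b2.
    have z3' : 0 < Im z - - N by rewrite subr_gt0 lt_def b3.
    have z4' : 0 < N - Im z by rewrite subr_gt0 lt_def eq_sym b4.
    exists (Num.min (Num.min e d) (Num.min (Num.min (Re z - - N) (N - Re z))
      (Num.min (Im z - - N) (N - Im z)))).
      by rewrite !lt_min e0 d0 z1' z2' z3' z4'.
    move=> w; rewrite !lt_min => /andP[/andP[we wd] /andP[/andP[w1 w2] /andP[w3 w4]]].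
    have rw : rset (- N) N (- N) N w.
      have v1 := le_lt_trans (Re_cmod _) w1; have v2 := le_lt_trans (Re_cmod _) w2.
      have v3 := le_lt_trans (Im_cmod _) w3; have v4 := le_lt_trans (Im_cmod _) w4.
      move: v1 v2 v3 v4; rewrite Re_sub Im_sub !ltr_norml => /andP[v1 _] /andP[_ v2].
      move=> /andP[v3 _] /andP[_ v4].
      by rewrite /rset /= /rect; apply/andP; split; apply/andP; split; lra.
    have nw := Hd w wd; split=> //; split=> //.
    by rewrite He.
  - by have [B' HB'] := @rect_bounded R (- N) N (- N) N; exists B' => z [/HB'].
  move=> z [cz nWz]; apply: contrapT => nz; apply: nWz.
  have rz : rset (- N) N (- N) N z.
    move/closedCP : (@rect_closed R (- N) N (- N) N); apply=> e e0.
    by have [w [rw _] wz] := (closureCP _ _).1 cz e e0; exists w.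
  have [e e0 He] := la z (conj rz nz).
  have [w [rw [nw aw]] wz] := (closureCP _ _).1 cz e e0.
  by split=> //; split=> //; rewrite -(He w).
have far1 z : N <= cmod z -> ~ E1 z by move=> /far[].
have far2 z : N <= cmod z -> ~ E2 z by move=> /far[].
have [W1o W1b] := build a1 E1 cE1 h1 far1 erefl.
have [W2o W2b] := build a2 E2 cE2 h2 far2 (esym k12).
exists [set z | rset (- N) N (- N) N z /\ ~ E1 z /\ a1 z != k1].
exists [set z | rset (- N) N (- N) N z /\ ~ E2 z /\ a2 z != k1].
split=> // z Vz.
have n1 : ~ E1 z by move=> z1; have [_] := (bdE z).2 (or_introl z1).
have n2 : ~ E2 z by move=> z2; have [_] := (bdE z).2 (or_intror z2).
have rz : rset (- N) N (- N) N z.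
  have zB := HB z (subset_closure Vz).
  have := le_trans (Re_cmod z) zB; have := le_trans (Im_cmod z) zB.
  by rewrite /rset /= /rect !ler_norml /N; lra.
have := h3 z rz n1 n2; rewrite (asboolT Vz).
have [e|ne] := eqVneq (a1 z) k1; last by left.
have [e'|ne'] := eqVneq (a2 z) k1; last by right.
by rewrite e e' addbb.
Qed.

End Separation.

(** * Normal families and the sphere *)

Section NormalFamilies.
Variable R : realType.
Local Notation C := R[i].
Implicit Types (h : C -> C) (f : nat -> C -> C) (z w p : C) (U V A B : set C).

Lemma entourageCP (E : set (C * C)) : entourage E <->
  exists2 e : R, 0 < e & forall x y, cmod (y - x) < e -> E (x, y).
Proof.
rewrite -entourage_from_ballE; split=> [[e /= e0 H]|[e e0 H]].
  have /complex_realP[k ek] : e \is Num.real by exact: gtr0_real.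
  move: e0 H; rewrite ek ltcR => k0 H; exists k => // x y xy.
  by apply: (H (x, y)); rewrite /ball /= distrC normE ltcR.
exists e%:C; first by rewrite /= ltcR.
by move=> [x y] /=; rewrite /ball /= distrC normE ltcR; exact: H.
Qed.

Lemma uniform_cvgP V f h : {uniform V, f @ \oo --> h} <->
  forall e : R, 0 < e -> exists N, forall k, (N <= k)%N -> forall z, V z -> cmod (f k z - h z) < e.
Proof.
split=> [H e e0|H P /uniform_nbhs[E [/entourageCP[e e0 HE] HP]]].
  have /H[N _ HN] : nbhs (h : {uniform` V -> C}) [set g | forall z, V z -> cmod (g z - h z) < e].
    apply/uniform_nbhs; exists [set xy | cmod (xy.2 - xy.1) < e]; split=> //.
    by apply/entourageCP; exists e.
  by exists N => k Nk z Vz; apply: (HN k Nk).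
have [N HN] := H e e0; exists N => // k /= Nk; apply: HP => z Vz; apply: HE; exact: HN.
Qed.

(** The Cauchy form involves only the entire functions [f j - f k], to which the maximum principle
    applies; a limit function would at this stage be known near the boundary alone. *)
Definition uniformly_cauchy A f := forall e : R, 0 < e -> exists N, forall j k,
  (N <= j)%N -> (N <= k)%N -> forall z, A z -> cmod (f j z - f k z) <= e.

Definition uniformly_infinite A f := forall r : R, exists N, forall k, (N <= k)%N ->
  forall z, A z -> r < cmod (f k z).

Definition fin_at f z := exists2 d : R, 0 < d & uniformly_cauchy [set w | cmod (w - z) < d] f.
Definition inf_at f z := exists2 d : R, 0 < d & uniformly_infinite [set w | cmod (w - z) < d] f.

Lemma fin_inf_disjoint f z : fin_at f z -> inf_at f z -> False.
Proof.
move=> [d d0 Hf] [d' d'0 Hi]; have [N HN] := Hf 1 ltr01.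
have [N' HN'] := Hi (cmod (f N z) + 1).
have zd : cmod (z - z) < d by rewrite subrr cmod0.
have zd' : cmod (z - z) < d' by rewrite subrr cmod0.
have := HN (maxn N N') N (leq_maxl _ _) (leqnn _) z zd.
have := HN' (maxn N N') (leq_maxr _ _) z zd'.
by have := cmod_subl (f (maxn N N') z) (f N z); lra.
Qed.

Definition subseq_map (phi : nat -> nat) := {homo phi : m n / (m < n)%N}.

Lemma subseq_ge phi k : subseq_map phi -> (k <= phi k)%N.
Proof. by move=> H; elim: k => // k IH; apply: leq_ltn_trans IH (H _ _ _). Qed.

Lemma fin_at_sub f phi z : subseq_map phi -> fin_at f z -> fin_at (f \o phi) z.
Proof.
move=> sp [d d0 H]; exists d => // e e0; have [N HN] := H e e0; exists N => j k Nj Nk.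
by apply: HN; [exact: leq_trans (subseq_ge j sp)|exact: leq_trans (subseq_ge k sp)].
Qed.

Lemma inf_at_sub f phi z : subseq_map phi -> inf_at f z -> inf_at (f \o phi) z.
Proof.
move=> sp [d d0 H]; exists d => // r; have [N HN] := H r; exists N => k Nk.
by apply: HN; exact: leq_trans (subseq_ge k sp).
Qed.

Lemma fin_at_open f z : fin_at f z -> exists2 d : R, 0 < d & forall w, cmod (w - z) < d -> fin_at f w.
Proof.
move=> [d d0 H]; exists d => // w wd; exists (d - cmod (w - z)); first by rewrite subr_gt0.
move=> e /H[N HN]; exists N => j k Nj Nk u /= uw; apply: HN => //=.
by have := cmod_tri w u z; lra.
Qed.

Lemma inf_at_open f z : inf_at f z -> exists2 d : R, 0 < d & forall w, cmod (w - z) < d -> inf_at f w.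
Proof.
move=> [d d0 H]; exists d => // w wd; exists (d - cmod (w - z)); first by rewrite subr_gt0.
move=> r; have [N HN] := H r; exists N => k Nk u /= uw; apply: HN => //=.
by have := cmod_tri w u z; lra.
Qed.

Variable G : set (C -> C).

(** The radius is chosen before the sequence, as the compactness induction in [compact_subseq]
    requires. The alternative is taken pointwise, since different points of a compact set may show
    different kinds of limit. *)
Lemma Fatou_local z : Fatou G z -> exists2 d : R, 0 < d &
  forall f, (forall k, G (f k)) -> exists2 phi, subseq_map phi &
    forall w, cmod (w - z) < d -> fin_at (f \o phi) w \/ inf_at (f \o phi) w.
Proof.
move=> [U [oU nU] Uz]; have [d d0 Hd] := (openCP U).1 oU z Uz; exists d => // f Gf.
have [phi sp H] := nU f Gf; exists phi => // w /Hd Uw.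
case: H => [[h _ Hh]|Hi].
  have [V /nbhsCP[e e0 HV] /uniform_cvgP Hu] := Hh w Uw; left; exists e => // r r0.
  have r2 : 0 < r / 2 by lra.
  have [N HN] := Hu _ r2; exists N => j k Nj Nk u /HV Vu.
  have := HN j Nj u Vu; have := HN k Nk u Vu.
  by have := cmod_tri (h u) ((f \o phi) j u) ((f \o phi) k u);
    rewrite (cmodBC (h u) ((f \o phi) k u)); lra.
have [V /nbhsCP[e e0 HV] Hu] := Hi w Uw; right; exists e => // r.
have [N _ HN] := Hu r; exists N => k Nk u /HV Vu.
by have := HN k Nk u Vu; rewrite normE ltcR.
Qed.

Lemma compact_subseq K f : closed K -> cbounded K -> K `<=` Fatou G -> (forall k, G (f k)) ->
  exists2 phi, subseq_map phi & forall z, K z -> fin_at (f \o phi) z \/ inf_at (f \o phi) z.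
Proof.
move=> cK bK KF.
(* The property inducted on quantifies over all sequences: for a union, a second subsequence is
   extracted from the first. *)
have Q : forall f, (forall k, G (f k)) -> exists2 phi, subseq_map phi &
    forall z, K z -> fin_at (f \o phi) z \/ inf_at (f \o phi) z.
  apply: (@compact_ind _ K (fun A => forall f, (forall k, G (f k)) -> exists2 phi, subseq_map phi &
    forall z, A z -> fin_at (f \o phi) z \/ inf_at (f \o phi) z) cK bK).
  - by move=> f' _; exists id.
  - by move=> A B AB H f' /H[phi sp Hp]; exists phi => // z /AB/Hp.
  - move=> A B HA HB f' Gf; have [phi sp Hp] := HA f' Gf.
    have [|psi sq Hq] := HB (f' \o phi); first by move=> k; exact: Gf.
    exists (phi \o psi); first by move=> m n /sq/sp.
    move=> z [/Hp[h|h]|/Hq//]; [left; exact: fin_at_sub h|right; exact: inf_at_sub h].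
  - by move=> z /KF/Fatou_local.
exact: Q.
Qed.

Lemma compact_uniformly_cauchy K f : closed K -> cbounded K -> (forall z, K z -> fin_at f z) ->
  uniformly_cauchy K f.
Proof.
move=> cK bK H; apply: (@compact_ind _ K (fun A => uniformly_cauchy A f) cK bK).
- by move=> e e0; exists 0%N.
- by move=> A B AB HB e /HB[N HN]; exists N => j k Nj Nk z /AB; exact: HN.
- move=> A B HA HB e e0; have [N HN] := HA e e0; have [N' HN'] := HB e e0.
  exists (maxn N N') => j k; rewrite !geq_max => /andP[j1 j2] /andP[k1 k2] z [?|?].
    exact: HN.
  exact: HN'.
- by move=> z /H[d d0 Hd]; exists d.
Qed.

Lemma compact_uniformly_infinite K f : closed K -> cbounded K -> (forall z, K z -> inf_at f z) ->
  uniformly_infinite K f.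
Proof.
move=> cK bK H; apply: (@compact_ind _ K (fun A => uniformly_infinite A f) cK bK).
- by move=> r; exists 0%N.
- by move=> A B AB HB r; have [N HN] := HB r; exists N => k Nk z /AB; exact: HN.
- move=> A B HA HB r; have [N HN] := HA r; have [N' HN'] := HB r.
  by exists (maxn N N') => k; rewrite geq_max => /andP[k1 k2] z [/HN|/HN']; apply.
- by move=> z /H[d d0 Hd]; exists d.
Qed.

Hypothesis Gentire : forall h, G h -> centire h.
Variable M0 : R.
Hypothesis Gfull : forall h (M : R) V, G h -> M0 < M -> open V -> cbounded V ->
  (forall z, bd V z -> M < cmod (h z)) -> forall z, V z -> M < cmod (h z).

Lemma cauchy_interior W f : open W -> cbounded W -> (forall k, G (f k)) ->
  uniformly_cauchy (bd W) f -> uniformly_cauchy W f.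
Proof.
move=> oW bW Gf H e e0; have [N HN] := H e e0; exists N => j k Nj Nk.
apply: (@max_modulus _ (fun z => f j z - f k z)) => //.
  by move=> z; apply: cdableB; exact: Gentire.
by move=> z bz; exact: HN.
Qed.

Lemma infinite_interior W f : open W -> cbounded W -> (forall k, G (f k)) ->
  uniformly_infinite (bd W) f -> uniformly_infinite W f.
Proof.
(* The lower bound passes from the boundary to the interior only for levels above M0. *)
move=> oW bW Gf H r; pose r' := Num.max r (M0 + 1).
have r1 : M0 < r' by rewrite lt_max; apply/orP; right; lra.
have r2 : r <= r' by rewrite le_max lexx.
have [N HN] := H r'; exists N => k Nk z Wz; apply: le_lt_trans r2 _.
by apply: (Gfull (Gf k) r1 oW bW) => // u; exact: HN.
Qed.

Lemma cauchy_limit W f : open W -> (forall k, G (f k)) -> uniformly_cauchy W f ->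
  exists2 h, holomorphic_on W h & forall e : R, 0 < e -> exists N, forall k, (N <= k)%N ->
    forall z, W z -> cmod (f k z - h z) < e.
Proof.
move=> oW Gf H.
have /choice[h Hh] : forall z, exists l, W z -> forall e : R, 0 < e -> exists N, forall k,
    (N <= k)%N -> cmod (f k z - l) <= e.
  move=> z; have [Wz|nW] := pselect (W z); last by exists 0.
  have [|l Hl] := @complex_cauchy _ (f^~ z); last by exists l.
  by move=> e /H[N HN]; exists N => m n mN nN; exact: HN.
have unif e : 0 < e -> exists N, forall k, (N <= k)%N -> forall z, W z -> cmod (f k z - h z) < e.
  move=> e0; have e3 : 0 < e / 3 by lra.
  have [N HN] := H _ e3; exists N => k Nk z Wz; have [N' HN'] := Hh z Wz _ e3.
  have := HN k (maxn N N') Nk (leq_maxl _ _) z Wz; have := HN' (maxn N N') (leq_maxr _ _).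
  by have := cmod_tri (f (maxn N N') z) (f k z) (h z); lra.
exists h => // z Wz; apply/derivable_cdiff.
have [d d0 Hd] := (openCP W).1 oW z Wz.
have d4 : 0 < d / 4 by lra.
apply: (@weierstrass _ f h z (d / 4) d4).
  by move=> k w _; exact: Gentire.
move=> e e0; have [N HN] := unif e e0; exists N => k Nk w wz; apply: ltW; apply: HN => //.
by apply: Hd; lra.
Qed.

(** The boundary of [W] avoids [V], so [W] is open and closed relative to [V], and a segment inside
    [V] that starts in [W] cannot leave it. *)
Lemma ball_in_piece (V W : set C) z (r : R) : open V -> open W ->
  (forall w, bd W w -> ~ V w) -> (forall w, cmod (w - z) < r -> V w) -> W z -> 0 < r ->
  forall w, cmod (w - z) < r -> W w.
Proof.
move=> oV oW bW rV Wz r0 w wr.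
have := @itv_locally_const _ (fun t => W (z + t%:C * (w - z))) 0 1 ler01 _ 1 0.
rewrite rmorph0 rmorph1 mul0r addr0 mul1r subrKC => H; apply: (proj2 (H _ _ _)) => //;
  rewrite ?lexx ?ler01 //.
move=> t /andP[t0 t1]; set p := z + _.
have Vp : V p.
  apply: rV; rewrite /p addrC addKr cmodM cmod_real ger0_norm //.
  by apply: le_lt_trans wr; rewrite ler_piMl ?cmod_ge0.
have [e e0 He] : exists2 e : R, 0 < e & forall u, cmod (u - p) < e -> (W u <-> W p).
  have [Wp|nW] := pselect (W p).
    by have [e e0 He] := (openCP W).1 oW p Wp; exists e => // u /He.
  have nc : (~` closure W) p by move=> cp; apply: (bW p).
  have [e e0 He] := (openCP _).1 (closed_openC (@closed_closure _ W)) p nc.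
  exists e => // u /He nu; split=> // Wu; case: nu; exact: subset_closure.
by have [d d0 Hd] := segment_cvx z w t e0; exists d => // s _ /Hd/He.
Qed.

(** The disc [U] about [z0] is fixed before the sequence, while the covering sets depend on it.
    Whichever of them contains [z0] contains all of [U], so that one kind of limit occurs on [U], as
    [normal_on] demands. *)
Theorem Fatou_fill V : open V -> cbounded V -> bd V `<=` Fatou G -> V `<=` Fatou G.
Proof.
move=> oV bV bF z0 Vz0; have [r r0 Hr] := (openCP V).1 oV z0 Vz0.
pose U := [set w | cmod (w - z0) < r].
have Uz0 : U z0 by rewrite /U /= subrr cmod0.
have oU : open U.
  apply/openCP => z zr; exists (r - cmod (z - z0)); first by rewrite subr_gt0.
  by move=> w wz; rewrite /U /=; have := cmod_tri z w z0; lra.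
exists U => //; split=> // f Gf.
have [phi sp Hphi] := compact_subseq (bd_closed oV) (bd_bounded bV) bF Gf.
pose E1 z := bd V z /\ fin_at (f \o phi) z; pose E2 z := bd V z /\ inf_at (f \o phi) z.
have Gfp k : G ((f \o phi) k) by exact: Gf.
have cE1 : closed E1.
  apply/closedCP => z H; have bz : bd V z.
    by move/closedCP : (bd_closed oV); apply=> e /H[w [bw _] wz]; exists w.
  split=> //; case: (Hphi z bz) => // iz; exfalso.
  have [d d0 Hd] := inf_at_open iz; have [w [_ fw] wz] := H d d0.
  exact: fin_inf_disjoint fw (Hd w wz).
have cE2 : closed E2.
  apply/closedCP => z H; have bz : bd V z.
    by move/closedCP : (bd_closed oV); apply=> e /H[w [bw _] wz]; exists w.
  split=> //; case: (Hphi z bz) => // iz; exfalso.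
  have [d d0 Hd] := fin_at_open iz; have [w [_ fw] wz] := H d d0.
  exact: fin_inf_disjoint (Hd w wz) fw.
have E12 z : E1 z -> E2 z -> False by move=> [_ h1] [_ h2]; exact: fin_inf_disjoint h1 h2.
have bdE z : bd V z <-> E1 z \/ E2 z.
  split=> [bz|[[]|[]] //]; by case: (Hphi z bz) => h; [left|right].
have [W1 [W2 [[oW1 bW1] [oW2 bW2] b1 b2 VW]]] := separation oV bV cE1 cE2 E12 bdE.
exists phi => //.
have out1 w : bd W1 w -> ~ V w by move/b1 => [[_]].
have out2 w : bd W2 w -> ~ V w by move/b2 => [[_]].
case: (VW z0 Vz0) => Wz0.
  have UW : U `<=` W1 by move=> w; exact: ball_in_piece oV oW1 out1 Hr Wz0 r0 w.
  left; have uc : uniformly_cauchy W1 (f \o phi).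
    apply: cauchy_interior => //; apply: compact_uniformly_cauchy.
    - exact: bd_closed.
    - exact: bd_bounded.
    - by move=> w /b1[].
  have [h hh Hh] := cauchy_limit oW1 Gfp uc.
  exists h; first by move=> w /UW; exact: hh.
  move=> w Uw; exists U; first exact: open_nbhs_nbhs.
  apply/uniform_cvgP => e /Hh[N HN]; exists N => k Nk u /UW; exact: HN.
have UW : U `<=` W2 by move=> w; exact: ball_in_piece oV oW2 out2 Hr Wz0 r0 w.
right; have ui : uniformly_infinite W2 (f \o phi).
  apply: infinite_interior => //; apply: compact_uniformly_infinite.
  - exact: bd_closed.
  - exact: bd_bounded.
  - by move=> w /b2[].
move=> w Uw; exists U; first exact: open_nbhs_nbhs.
move=> M; have [N HN] := ui M; exists N => // k /= Nk u /UW Wu.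
by rewrite normE ltcR; exact: HN.
Qed.

Lemma Fatou_open : open (Fatou G).
Proof. by apply: bigcup_open => U []. Qed.

End NormalFamilies.

(** * From filled bounded sets to connectedness in the sphere *)

Section Sphere.
Variable R : realType.
Local Notation C := R[i].
Implicit Types (z w : C) (F K O V : set C).

Lemma compact_cbounded K : compact K -> cbounded K.
Proof.
move=> /compact_near_coveringP/(_ R (+oo)%R (fun (r : R) z => cmod z <= r)) H.
have [|B [_ HB]] := H _ _.
  move=> z Kz; exists ([set w | cmod (w - z) < 1], [set r | cmod z + 1 < r]) => /=.
    split; first by apply/nbhsCP; exists 1.
    by exists (cmod z + 1); split=> //; exact: num_real.
  by move=> [w r] /= [wz rz]; have := cmod_subl w z; lra.
by exists (B + 1) => z; apply: (HB (B + 1)); rewrite ltrDl.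
Qed.

Lemma compact_neighborhood K O : closed K -> cbounded K -> open O -> K `<=` O ->
  exists V, [/\ open V, cbounded V, K `<=` V & closure V `<=` O].
Proof.
move=> cK [B HB] oO KO.
have [e e0 He] : exists2 e : R, 0 < e & forall z, K z -> K z -> forall w, cmod (w - z) < e -> O w.
  apply: (@compact_ind _ K (fun A => exists2 e : R, 0 < e & forall z, A z -> K z ->
    forall w, cmod (w - z) < e -> O w) cK).
  - by exists B.
  - by exists 1.
  - by move=> A D AD [e e0 H]; exists e => // z /AD/H.
  - move=> A D [e e0 H] [e' e'0 H']; exists (Num.min e e'); first by rewrite lt_min e0.
    move=> z [/H h|/H' h] Kz w; rewrite lt_min => /andP[w1 w2]; exact: h.
  - move=> z /KO Oz; have [d d0 Hd] := (openCP O).1 oO z Oz; have d2 : 0 < d / 2 by lra.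
    exists (d / 2) => //; exists (d / 2) => // w /= wz _ u uw; apply: Hd.
    by have := cmod_tri w u z; lra.
pose V := [set w | exists2 z, K z & cmod (w - z) < e / 2].
exists V; split.
- apply/openCP => w [z Kz wz]; exists (e / 2 - cmod (w - z)); first by rewrite subr_gt0.
  by move=> u uw; exists z => //; have := cmod_tri w u z; lra.
- by exists (B + e / 2) => w [z /HB zB wz]; have := cmod_subl w z; lra.
- by move=> z Kz; exists z => //; rewrite subrr cmod0; lra.
- move=> w cw; have e2 : 0 < e / 2 by lra.
  have [u [z Kz uz] uw] := (closureCP _ _).1 cw _ e2.
  by apply: (He z Kz Kz); have := cmod_tri u w z; rewrite (cmodBC w u); lra.
Qed.

(** A relatively clopen part of the complement that misses infinity corresponds to a compact plane
    set [K]. A neighbourhood [V] of [K] inside the open set cutting out that part has its boundary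
    in [F], so [fill] puts [K] into [F], and the part is empty. *)
Lemma sphere_complement_connected F : open F ->
  (forall V, open V -> cbounded V -> bd V `<=` F -> V `<=` F) ->
  connected (~` (Some @` F) : set (one_point_compactification C)).
Proof.
move=> oF fill; pose J : set (one_point_compactification C) := ~` (Some @` F).
rewrite -/J.
have JS z : J (Some z) <-> ~ F z.
  by split=> [H Fz|nF [w Fw [wz]]]; [apply: H; exists z|apply: nF; rewrite -wz].
have JN : J None by case.
have key (X : set (one_point_compactification C)) :
    (exists2 O, open O & X = J `&` O) -> (exists2 D, closed D & X = J `&` D) ->
    ~ X None -> X = set0.
  move=> [S oO XO] [D cD XD] nX.
  pose K := [set z : C | X (Some z)]; pose O' := [set z : C | S (Some z)].
  have oO' : open O'.
    by move/continuousP : (@one_point_compactification_some_continuous C); apply.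
  have cD' : closed [set z : C | D (Some z)].
    by move/continuous_closedP : (@one_point_compactification_some_continuous C); apply.
  have KE : K = ~` F `&` [set z : C | D (Some z)].
    by apply/seteqP; split=> z; rewrite /K /= XD => -[/JS].
  have cK : closed K by rewrite KE; apply: closedI => //; exact: open_closedC.
  (* The closed set [D] misses infinity, so its finite points lie in a compact subset of the
     plane. *)
  have bK : cbounded K.
    have nD : (~` D) None by move=> DN; apply: nX; rewrite XD.
    have [B [cB _] HB] : nbhs (None : one_point_compactification C) (~` D).
      by apply: open_nbhs_nbhs; split=> //; exact: closed_openC.
    have [N HN] := compact_cbounded cB; exists N => z; rewrite KE => -[_ Dz].
    apply: HN; apply: contrapT => nB; have : (~` D) (Some z) by apply: HB; left; exists z.
    exact.
  have KO : K `<=` O' by move=> z; rewrite /K /= XO => -[].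
  have [V [oV bV KV VO]] := compact_neighborhood cK bK oO' KO.
  have VF : V `<=` F.
    (* A boundary point outside [F] would belong to [J] and to [O'], hence to [K], which lies in the
       open set [V]. *)
    apply: fill => // z [cz nV]; apply: contrapT => nF; apply: nV; apply: KV.
    by rewrite /K /= XO; split; [exact/JS|exact: VO].
  apply/seteqP; split=> // -[z|//] Xz.
  have Fz : F z by apply: VF; apply: KV.
  by move: Xz; rewrite XO => -[/JS].
move=> X Xn hO hD.
have [XN|nX] := pselect (X None); last first.
  by move: Xn => [x]; rewrite (key X hO hD nX).
(* When [X] contains infinity, the claim is applied to its relative complement, which is clopen in
   [J] as well and misses infinity. *)
have := key (J `\` X); move: hO hD => [S oO XO] [D cD XD] H.
have : J `\` X = set0.
  apply: H; last by case.
    exists (~` D); first exact: closed_openC.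
    by apply/seteqP; split=> x [Jx nx]; split=> // hx; apply: nx; [rewrite XD|move: hx; rewrite XD => -[]].
  exists (~` S); first exact: open_closedC.
  by apply/seteqP; split=> x [Jx nx]; split=> // hx; apply: nx; [rewrite XO|move: hx; rewrite XO => -[]].
rewrite setD_eq0 => JX; apply/seteqP; split=> //; first by rewrite XO => x [].
Qed.

End Sphere.

Theorem theorem3p4 (R : realType) (n : nat) (hn : (0 < n)%N)
    (g : 'I_n -> R[i]%C -> R[i]%C)
    (hg : forall i, transcendental_entire (g i))
    (hb : forall i, bounded_type (g i)) :
  connected (Julia (semigroup g)).
Proof.
have [M0 _ full] := semigroup_full hg hb.
apply: sphere_complement_connected; first exact: Fatou_open.
move=> V; apply: (@Fatou_fill _ _ _ M0) => [h /(semigroup_entire hg)[]//|h M U sh].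
exact: full.
Qed.
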